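(* Let $S_+^\circ$ be the open north hemisphere of the Grushin sphere with the north pole removed, with coordinates $x\in(0,\pi/2)$, $\phi\in[0,2\pi]/\sim$ and volume $d\omega=\frac1{\tan(x)}\,dx\,d\phi$, let $b\in\mathbb{R}$, and let $$\Delta^b=\partial_x^2-\frac1{\sin(x)\cos(x)}\partial_x+\tan(x)^2\left(\partial_\phi^2-2ib\,\partial_\phi-b^2\right)$$ with Dirichlet boundary conditions. The operator $-\Delta^b$ acting on $L^2(S_+^\circ,d\omega)$ has purely discrete spectrum $$\sigma_{\rm d}(-\Delta^b)=\{\lambda_{n,k}=4n(n+|k-b|)\mid n\in\mathbb{N},\ k\in\mathbb{Z}\}.$$ The corresponding eigenfunctions are given by $$\psi_{n,k}(x,\phi)=e^{ik\phi}\,e^{i(k-b)\frac\pi2}\cos(x)^{|k-b|}\,F\left(-n,\ n+|k-b|;\ 1+|k-b|;\ \cos(x)^2\right),$$ where $F(a,b;c;z)$ is the Gauss hypergeometric function with parameters $a,b,c$.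
   Context: $\mathbb{N}=\{1,2,3,\dots\}$. The Grushin sphere is $\mathbb{S}^2=\{y_1^2+y_2^2+y_3^2=1\}$ with orthonormal frame $Y_1=(-y_3,0,y_1)^T$, $Y_2=(0,-y_3,y_2)^T$; in spherical coordinates $(\cos x\cos\phi,\cos x\sin\phi,\sin x)$ an equivalent frame is $X_1=\partial_x$, $X_2=\tan(x)\,\partial_\phi$, with singular set the equator $\{x=0\}$. The north pole is $x=\pi/2$. The operator $\Delta^b$ is the magnetic Laplace-Beltrami operator associated with the Aharonov-Bohm vector potential $A_b=-ib\,d\phi$ on $S_+^\circ$. It is taken with Dirichlet boundary conditions: it is the self-adjoint operator whose (form) domain is the closure of $C_c^\infty(S_+^\circ)$ with respect to the Sobolev norm $W^{1,2}_0(S_+^\circ)$ (i.e. the Friedrichs realisation from $C_c^\infty(S_+^\circ)$). Eigenfunctions are not normalized. *)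

(* Defs.v *)
From mathcomp Require Import all_boot all_order all_algebra.
From mathcomp Require Import complex.
From mathcomp Require Import all_classical all_reals all_analysis.

Set Implicit Arguments.
Unset Strict Implicit.
Unset Printing Implicit Defensive.

Import Order.TTheory GRing.Theory Num.Theory.
Import numFieldNormedType.Exports.

Local Open Scope classical_set_scope.
Local Open Scope ring_scope.
Local Open Scope complex_scope.

(* A function on the punctured open hemisphere (0,pi/2) x (R / 2 pi Z) is given
   by a function [R * R -> R[i]] of the coordinates (x, phi).  Measure-theoretic
   notions only look at its restriction to the fundamental domain [hemi], and
   smoothness is smoothness of a 2 pi-periodic function on R * R. *)

Section Hemisphere.
Variable R : realType.

Definition cfun := R * R -> R[i].

Definition hemi : set (R * R) := `]0, pi / 2[ `*` `[0, pi *+ 2[.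

Definition leb2 := (@lebesgue_measure R \x @lebesgue_measure R)%E.

(* density of the Grushin volume with respect to dx dphi *)
Definition vol (p : R * R) : R := (tan p.1)^-1.

Definition sqmod (z : R[i]) : R := complex.Re z ^+ 2 + complex.Im z ^+ 2.

Definition square_integrable (f : cfun) : Prop :=
  [/\ measurable_fun hemi (fun p => complex.Re (f p)),
      measurable_fun hemi (fun p => complex.Im (f p)) &
      (\int[leb2]_(p in hemi) (sqmod (f p) * vol p)%:E < +oo)%E].

Definition ae_equal (f g : cfun) : Prop :=
  {ae leb2, forall p, hemi p -> f p = g p}.

Definition integralC (f : cfun) : R[i] :=
  (\int[leb2]_(p in hemi) (complex.Re (f p) * vol p))
  +i* (\int[leb2]_(p in hemi) (complex.Im (f p) * vol p)).

Definition inner (f g : cfun) : R[i] := integralC (fun p => f p * conjc (g p)).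

Definition norm2 (f : cfun) : R :=
  Num.sqrt (\int[leb2]_(p in hemi) (sqmod (f p) * vol p)).

Fixpoint Ck (n : nat) (g : R * R -> R) : Prop :=
  continuous g /\
  if n is m.+1 then
    forall v : R * R, v = (1, 0) \/ v = (0, 1) ->
      (forall p, derivable g p v) /\ Ck m (fun p => 'D_v g p)
  else True.

Definition smooth (f : cfun) : Prop :=
  forall n, Ck n (fun p => complex.Re (f p)) /\
            Ck n (fun p => complex.Im (f p)).

(* C_c^oo of the punctured open hemisphere: every compact subset of
   (0,pi/2) x S^1 is contained in some [e, pi/2 - e] x S^1 *)
Definition test_function (f : cfun) : Prop :=
  [/\ smooth f,
      forall x phi, f (x, phi + pi *+ 2) = f (x, phi) &
      exists2 e : R, 0 < e &
        forall x phi, x < e \/ pi / 2 - e < x -> f (x, phi) = 0].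

Definition partialC (v : R * R) (f : cfun) : cfun := fun p =>
  ('D_v (fun q => complex.Re (f q)) p)
  +i* ('D_v (fun q => complex.Im (f q)) p).

Definition d_x : cfun -> cfun := partialC (1, 0).
Definition d_phi : cfun -> cfun := partialC (0, 1).

Definition magnetic_laplacian (b : R) (f : cfun) : cfun := fun p =>
  d_x (d_x f) p
  - ((sin p.1 * cos p.1)^-1)%:C * d_x f p
  + (tan p.1 ^+ 2)%:C *
      (d_phi (d_phi f) p - 2 * (0 +i* 1) * b%:C * d_phi f p
       - (b ^+ 2)%:C * f p).

(* the form (u, v) |-> < - Delta^b u, v > on test functions *)
Definition qform (b : R) (u v : cfun) : R[i] :=
  inner (fun p => - magnetic_laplacian b u p) v.

Definition cvgC (z : nat -> R[i]) (l : R[i]) : Prop :=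
  (fun j => complex.Re (z j)) @ \oo --> complex.Re l /\
  (fun j => complex.Im (z j)) @ \oo --> complex.Im l.

(* [w] is a sequence of test functions tending to [u] in L^2 and Cauchy for the
   form norm; the form domain (the W^{1,2}_0-closure of C_c^oo) consists of the
   [u] for which such a sequence exists. *)
Definition form_approx (b : R) (u : cfun) (w : nat -> cfun) : Prop :=
  [/\ forall j, test_function (w j),
      (fun j => norm2 (fun p => w j p - u p)) @ \oo --> (0 : R) &
      forall e : R, 0 < e -> exists N : nat, forall j l : nat,
        (N <= j)%N -> (N <= l)%N ->
        let d : cfun := fun p => w j p - w l p in complex.Re (qform b d d) < e].

Definition form_domain (b : R) (u : cfun) : Prop :=
  square_integrable u /\ exists w, form_approx b u w.

(* [closed_form b u v z]: the closure of [qform b] takes the value z at (u, v) *)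
Definition closed_form (b : R) (u v : cfun) (z : R[i]) : Prop :=
  forall wu wv, form_approx b u wu -> form_approx b v wv ->
    cvgC (fun j => qform b (wu j) (wv j)) z.

(* Unbounded operators on L^2 are given by their graphs. *)
Definition operator := cfun -> cfun -> Prop.

(* graph of the Friedrichs realisation of - Delta^b on C_c^oo, i.e. of the
   operator associated with the closed form *)
Definition friedrichs (b : R) : operator := fun u f =>
  [/\ form_domain b u, square_integrable f &
      forall v, form_domain b v -> closed_form b u v (inner f v)].

Definition eigenspace (A : operator) (z : R[i]) : set cfun :=
  [set u | A u (fun p => z * u p)].

Definition eigenfunction (A : operator) (z : R[i]) (u : cfun) : Prop :=
  eigenspace A z u /\ ~ ae_equal u (fun=> 0).

Definition eigenvalue (A : operator) (z : R[i]) : Prop :=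
  exists u, eigenfunction A z u.

(* A - z is a bijection from the domain of A onto L^2 with bounded inverse *)
Definition resolvent_set (A : operator) : set R[i] :=
  [set z | (forall u, eigenspace A z u -> ae_equal u (fun=> 0)) /\
    exists C : R, forall f, square_integrable f ->
      exists2 u, A u (fun p => z * u p + f p) & norm2 u <= C * norm2 f].

Definition spectrum (A : operator) : set R[i] := ~` resolvent_set A.

(* finite linear combinations, up to equality almost everywhere *)
Definition lin_span (B : set cfun) : set cfun :=
  [set u | exists (m : nat) (c : 'I_m -> R[i]) (g : 'I_m -> cfun),
    (forall i, B (g i)) /\ ae_equal u (fun p => \sum_(i < m) c i * g i p)].

Definition finite_multiplicity (A : operator) (z : R[i]) : Prop :=
  exists (m : nat) (g : 'I_m -> cfun),
    eigenspace A z `<=` lin_span (range g).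

Definition isolated_point (S : set R[i]) (z : R[i]) : Prop :=
  S z /\ exists2 e : R, 0 < e &
    forall w, S w -> Num.sqrt (sqmod (w - z)) < e -> w = z.

Definition discrete_spectrum (A : operator) : set R[i] :=
  [set z | [/\ isolated_point (spectrum A) z, eigenvalue A z &
               finite_multiplicity A z]].

Definition pochhammer (a : R) (j : nat) : R := \prod_(i < j) (a + i%:R).

Definition hypergeometric (a b c z : R) : R :=
  limn (series (fun j : nat =>
    pochhammer a j * pochhammer b j / (pochhammer c j * j`!%:R) * z ^+ j)).

Definition expi (t : R) : R[i] := cos t +i* sin t.

Definition lambda (b : R) (n : nat) (k : int) : R :=
  4 * n%:R * (n%:R + `|k%:~R - b|).

Definition psi (b : R) (n : nat) (k : int) : cfun := fun p =>
  let m : R := `|k%:~R - b| in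
  expi (k%:~R * p.2) * expi ((k%:~R - b) * (pi / 2)) *
  ((cos p.1 `^ m) *
   hypergeometric (- n%:R) (n%:R + m) (1 + m) (cos p.1 ^+ 2))%:C.

End Hemisphere.

(* Main.v *)
Require Import Defs.
From HB Require Import structures.
From mathcomp Require Import all_boot all_order all_algebra.
From mathcomp Require Import complex.
From mathcomp Require Import all_classical all_reals all_analysis.
From mathcomp Require Import measurable_realfun.
From mathcomp Require Import ring lra.

Set Implicit Arguments.
Unset Strict Implicit.
Unset Printing Implicit Defensive.

Import Order.TTheory GRing.Theory Num.Theory.
Import numFieldNormedType.Exports.

Local Open Scope classical_set_scope.
Local Open Scope ring_scope.
Local Open Scope complex_scope.


(* The functions psi_(n,k) are smooth eigenfunctions of the differential
   expression, pairwise orthogonal in L^2; after division by the factor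
   cos^|k-b|, their radial parts span the polynomials in cos(x)^2 vanishing at
   1.  Completeness: a function orthogonal to all of them has, for each k, a
   k-th Fourier coefficient (a function of x) all of whose moments against
   sin(x)^2 cos(x)^(|k-b|+2j) vanish.  Polynomials converging boundedly to the
   indicator of [s, 1] turn vanishing moments into vanishing primitives, hence
   into a vanishing coefficient by Lebesgue differentiation; the same argument
   in the angular variable then kills the function on almost every circle.

   The eigenfunctions are limits, in form norm, of test functions: with a cutoff
   chi in the variable log tan(x) / L, the energy of chi psi exceeds lambda
   |chi psi|^2 by the integral of |chi' psi|^2, which is O(1/L).

   Hence the closed form is diagonal in the orthonormal basis of normalized
   eigenfunctions, and so is the Friedrichs operator: u is in the domain with
   image f iff f has coefficients lambda_i <u, e_i>.  As only finitely many
   lambda_(n,k) lie below any bound, the spectrum is discrete. *)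

(** * Complex numbers and real sequences *)

Section ComplexModulus.
Variable R : realType.
Implicit Types z w : R[i].

(** The volume dx dphi / tan(x) is infinite near x = 0, so the modes have to vanish there. For n >=
    1 they do: at 1 the hypergeometric equation reduces to n (n + m) p(1) = 0, so the radial
    polynomial has the factor 1 - cos(x)^2 = sin(x)^2, and this factor pays for the volume in every
    integral below. The behaviour at the two ends of (0, pi/2) enters the spectral argument through
    two facts only. Against a test function u all boundary terms vanish, so the pairing of -Delta^b
    u with psi is lambda <u, psi>; Parseval then makes the form diagonal on test functions, and its
    symmetry, positivity and closability are read off the coefficients. Secondly, each eigenfunction
    has approximating test functions w of energy at most lambda |w|^2 + r; this upper bound alone
    puts the eigenfunction in the form domain, again by expanding in coefficients. The bound lambda
    >= 4 lets the energy control the L^2 norm. *)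

Lemma sqmodE z : (sqmod z)%:C = z * conjc z.
Proof. by case: z => a b; rewrite /sqmod /=; simpc; congr (_ +i* _); ring. Qed.

Lemma sqmod_ge0 z : 0 <= sqmod z.
Proof. by rewrite addr_ge0 ?sqr_ge0. Qed.

Lemma sqmodM z w : sqmod (z * w) = sqmod z * sqmod w.
Proof. by case: z w => [a b] [c d]; rewrite /sqmod /=; ring. Qed.

Lemma sqmodN z : sqmod (- z) = sqmod z.
Proof. by case: z => [a b]; rewrite /sqmod /=; ring. Qed.

Lemma sqmod_real (a : R) : sqmod a%:C = a ^+ 2.
Proof. by rewrite /sqmod /=; ring. Qed.

Lemma sqmod0 : sqmod (0 : R[i]) = 0.
Proof. by rewrite /sqmod /=; ring. Qed.

Lemma sqmod_eq0 z : sqmod z = 0 -> z = 0.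
Proof.
case: z => a b /eqP; rewrite /sqmod /= paddr_eq0 ?sqr_ge0// !sqrf_eq0.
by case/andP => /eqP -> /eqP ->.
Qed.

Lemma sqmodD_le z w : sqmod (z + w) <= 2 * sqmod z + 2 * sqmod w.
Proof.
case: z w => [a b] [c d]; rewrite /sqmod /= -subr_ge0.
have -> : 2 * (a ^+ 2 + b ^+ 2) + 2 * (c ^+ 2 + d ^+ 2) -
  ((a + c) ^+ 2 + (b + d) ^+ 2) = (a - c) ^+ 2 + (b - d) ^+ 2 by ring.
by rewrite addr_ge0 ?sqr_ge0.
Qed.

Lemma cconjM z w : conjc (z * w) = conjc z * conjc w.
Proof. by case: z w => [a b] [c d]; simpc; congr (_ +i* _); ring. Qed.

Lemma cconj_sum n (F : 'I_n -> R[i]) :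
  conjc (\sum_(i < n) F i) = \sum_(i < n) conjc (F i).
Proof. exact: (raddf_sum conjc). Qed.

Lemma cReD z w : complex.Re (z + w) = complex.Re z + complex.Re w.
Proof. by case: z w => [a b] [c d]. Qed.

Lemma cImD z w : complex.Im (z + w) = complex.Im z + complex.Im w.
Proof. by case: z w => [a b] [c d]. Qed.

Lemma cReN z : complex.Re (- z) = - complex.Re z.
Proof. by case: z. Qed.

Lemma cImN z : complex.Im (- z) = - complex.Im z.
Proof. by case: z. Qed.

Lemma cRe_conj z : complex.Re (conjc z) = complex.Re z.
Proof. by case: z. Qed.

Lemma cRe_sum n (F : 'I_n -> R[i]) :
  complex.Re (\sum_(i < n) F i) = \sum_(i < n) complex.Re (F i).
Proof. by elim/big_rec2: _ => // i x y _ <-; rewrite cReD. Qed.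

Lemma real_complexM (a c : R) : (a * c)%:C = a%:C * c%:C.
Proof. by simpc. Qed.

Lemma Re_realM (a : R) z : complex.Re (a%:C * z) = a * complex.Re z.
Proof. by case: z => x y /=; ring. Qed.

Lemma cvgC_sqmod (z : nat -> R[i]) l :
  (fun j => sqmod (z j - l)) @ \oo --> (0 : R) -> cvgC z l.
Proof.
move=> h.
have aux (f : R[i] -> R) : (forall w, f w ^+ 2 <= sqmod w) ->
    (forall w1 w2, f (w1 - w2) = f w1 - f w2) ->
    (fun j => f (z j)) @ \oo --> f l.
  move=> fle fB; apply/cvgrPdist_lt => e e0.
  have e20 : 0 < e ^+ 2 by rewrite exprn_gt0.
  have /cvgrPdist_lt/(_ _ e20) := h.
  apply: filterS => j /=; rewrite sub0r normrN ger0_norm ?sqmod_ge0// => lt.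
  rewrite -fB -(ltr_pXn2r (n := 2))// ?nnegrE// ?ltW//.
  by rewrite real_normK ?num_real// (le_lt_trans (fle _))// -sqmodN opprB.
by split; apply: aux => [[a c]|[a c] [a' c']] //=;
  rewrite /sqmod/= ?lerDl ?lerDr sqr_ge0.
Qed.

Lemma cvgC_unique (z : nat -> R[i]) l1 l2 : cvgC z l1 -> cvgC z l2 -> l1 = l2.
Proof.
case: l1 l2 => [a c] [a' c'] [/= h1 h2] [/= h3 h4].
by rewrite (cvg_unique _ h1 h3) // (cvg_unique _ h2 h4).
Qed.

Lemma cvgC_conj (z : nat -> R[i]) l :
  cvgC z l -> cvgC (fun j => conjc (z j)) (conjc l).
Proof.
case=> h1 h2; split; first by under eq_fun do rewrite cRe_conj; rewrite cRe_conj.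
have E w : complex.Im (conjc w) = - complex.Im w :> R by case: w.
by under eq_fun do rewrite E; rewrite E; apply: cvgN.
Qed.

End ComplexModulus.

(** * Friedrichs extensions with a known orthonormal eigenbasis *)

Section InnerProduct.
Variables (R : realType) (V : lmodType R[i]) (L : V -> Prop).
Variable ip : V -> V -> R[i].
Hypothesis L0 : L 0.
Hypothesis L_lin : forall a u v, L u -> L v -> L (a *: u + v).
Hypothesis ip_lin : forall a u v w, L u -> L v -> L w ->
  ip (a *: u + v) w = a * ip u w + ip v w.
Hypothesis ip_conj : forall u v, L u -> L v -> ip v u = conjc (ip u v).
Hypothesis ip_ge0 : forall u, L u -> 0 <= complex.Re (ip u u).

(** [L] is a predicate on an ambient space of functions and [ip] is only semidefinite on it: there
    is no quotient by null functions, so equality of vectors is expressed by [nsq (u - v) = 0]. *)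
Definition nsq (u : V) : R := complex.Re (ip u u).

Lemma L_add u v : L u -> L v -> L (u + v).
Proof. by move=> Lu Lv; rewrite -[u]scale1r; apply: L_lin. Qed.

Lemma L_scale a u : L u -> L (a *: u).
Proof. by move=> Lu; rewrite -[_ *: _]addr0; apply: L_lin. Qed.

Lemma L_opp u : L u -> L (- u).
Proof. by move=> Lu; rewrite -scaleN1r; apply: L_scale. Qed.

Lemma L_sub u v : L u -> L v -> L (u - v).
Proof. by move=> Lu Lv; apply: L_add => //; apply: L_opp. Qed.

Lemma L_sum n (F : 'I_n -> V) : (forall i, L (F i)) -> L (\sum_(i < n) F i).
Proof. by move=> LF; elim/big_ind: _ => // u v; apply: L_add. Qed.

Lemma ipD u v w : L u -> L v -> L w -> ip (u + v) w = ip u w + ip v w.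
Proof. by move=> Lu Lv Lw; rewrite -{1}[u]scale1r ip_lin// mul1r. Qed.

Lemma ip0l w : L w -> ip 0 w = 0.
Proof.
move=> Lw; have := ipD L0 L0 Lw; rewrite addr0 => /eqP.
by rewrite -[X in X == _]addr0 (inj_eq (addrI _)) eq_sym => /eqP.
Qed.

Lemma ipZ a u w : L u -> L w -> ip (a *: u) w = a * ip u w.
Proof. by move=> Lu Lw; rewrite -[_ *: _]addr0 ip_lin// ip0l// addr0. Qed.

Lemma ipN u w : L u -> L w -> ip (- u) w = - ip u w.
Proof. by move=> Lu Lw; rewrite -scaleN1r ipZ// mulN1r. Qed.

Lemma ipB u v w : L u -> L v -> L w -> ip (u - v) w = ip u w - ip v w.
Proof. by move=> Lu Lv Lw; rewrite ipD ?ipN//; apply: L_opp. Qed.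

Lemma ipDr u v w : L u -> L v -> L w -> ip w (u + v) = ip w u + ip w v.
Proof.
move=> Lu Lv Lw; rewrite ip_conj//; last exact: L_add.
by rewrite ipD// rmorphD/= -!ip_conj.
Qed.

Lemma ipZr a u w : L u -> L w -> ip w (a *: u) = conjc a * ip w u.
Proof.
move=> Lu Lw; rewrite ip_conj//; last exact: L_scale.
by rewrite ipZ// cconjM -!ip_conj.
Qed.

Lemma ipBr u v w : L u -> L v -> L w -> ip w (u - v) = ip w u - ip w v.
Proof.
move=> Lu Lv Lw; rewrite ip_conj//; last exact: L_sub.
by rewrite ipB// rmorphB/= -!ip_conj.
Qed.

Lemma ip_sum n (F : 'I_n -> V) w : (forall i, L (F i)) -> L w ->
  ip (\sum_(i < n) F i) w = \sum_(i < n) ip (F i) w.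
Proof.
move=> LF Lw; elim: n F LF => [|n IH] F LF; first by rewrite !big_ord0 ip0l.
rewrite !big_ord_recr/= ipD// ?IH//.
exact: L_sum.
Qed.

Lemma nsqE u : L u -> ip u u = (nsq u)%:C.
Proof.
move=> Lu; have := ip_conj Lu Lu; rewrite /nsq; case: (ip u u) => x y /= [].
by move=> /eqP; rewrite -addr_eq0 -mulr2n mulrn_eq0/= => /eqP ->.
Qed.

Lemma nsqN u : L u -> nsq (- u) = nsq u.
Proof.
move=> Lu; rewrite /nsq -scaleN1r ipZ//; last exact: L_scale.
by rewrite ipZr// rmorphN1 mulN1r mulN1r opprK.
Qed.

Lemma nsqBC u v : L u -> L v -> nsq (u - v) = nsq (v - u).
Proof. by move=> Lu Lv; rewrite -nsqN ?opprB//; apply: L_sub. Qed.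

Lemma nsqD u v : L u -> L v ->
  nsq (u + v) = nsq u + nsq v + 2 * complex.Re (ip u v).
Proof.
move=> Lu Lv; rewrite /nsq ipD//; last exact: L_add.
rewrite !ipDr// !cReD (ip_conj Lu Lv) cRe_conj; ring.
Qed.

Lemma nsqB u v : L u -> L v ->
  nsq (u - v) = nsq u + nsq v - 2 * complex.Re (ip u v).
Proof.
move=> Lu Lv; rewrite nsqD//; last exact: L_opp.
rewrite nsqN// -(scaleN1r v) ipZr// rmorphN1 mulN1r cReN; ring.
Qed.

Lemma nsqZ a u : L u -> nsq (a *: u) = sqmod a * nsq u.
Proof.
move=> Lu; rewrite /nsq ipZ//; last exact: L_scale.
by rewrite ipZr// mulrA -sqmodE Re_realM.
Qed.

(** Nonnegativity of [nsq] at [u - t <u, v> v] for real [t]. As [ip] need not be definite, the case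
    [nsq v = 0] is settled by a large [t], for which the bound would read 0 <= - nsq u - 2. *)
Lemma cauchy_schwarz u v : L u -> L v -> sqmod (ip u v) <= nsq u * nsq v.
Proof.
move=> Lu Lv.
have key (t : R) :
    0 <= nsq u + t ^+ 2 * sqmod (ip u v) * nsq v - 2 * t * sqmod (ip u v).
  have Lw : L (t%:C * ip u v *: v) by apply: L_scale.
  have := ip_ge0 (L_sub Lu Lw); rewrite -/(nsq _) nsqB// nsqZ// ipZr//.
  have -> : conjc (t%:C * ip u v) * ip u v = (t * sqmod (ip u v))%:C.
    rewrite cconjM conjc_real -[LHS]mulrA (mulrC (conjc _)) -sqmodE.
    by rewrite -real_complexM.
  by rewrite sqmodM sqmod_real /= mulrA.
have v0 : 0 <= nsq v := ip_ge0 Lv.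
have s0 := sqmod_ge0 (ip u v).
move: v0; rewrite le_eqVlt => /predU1P[v0|v0].
  rewrite -v0 mulr0 leNgt; apply/negP => s1.
  have u0 : 0 <= nsq u := ip_ge0 Lu.
  have := key ((nsq u + 1) / sqmod (ip u v)); rewrite -v0 mulr0 addr0.
  by rewrite -mulrA divfK ?gt_eqF//; lra.
have := key (nsq v)^-1.
have -> : nsq u + (nsq v)^-1 ^+ 2 * sqmod (ip u v) * nsq v -
  2 * (nsq v)^-1 * sqmod (ip u v) = nsq u - sqmod (ip u v) / nsq v.
  by field; rewrite gt_eqF.
by rewrite subr_ge0 ler_pdivrMr.
Qed.

Lemma nsq_eq0_ip u v : L u -> L v -> nsq u = 0 -> ip u v = 0.
Proof.
move=> Lu Lv u0; apply: sqmod_eq0; apply/eqP; rewrite eq_le sqmod_ge0 andbT.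
by have := cauchy_schwarz Lu Lv; rewrite u0 mul0r.
Qed.

Hypothesis L_complete : forall w : nat -> V, (forall j, L (w j)) ->
  (forall e : R, 0 < e -> exists N, forall j l, (N <= j)%N -> (N <= l)%N ->
    nsq (w j - w l) < e) ->
  exists2 u, L u & (fun j => nsq (w j - u)) @ \oo --> (0 : R).
Variable e : nat -> V.
Hypothesis L_e : forall i, L (e i).
Hypothesis e_orth : forall i j, ip (e i) (e j) = (i == j)%:R.
Hypothesis e_total : forall u, L u -> (forall i, ip u (e i) = 0) -> nsq u = 0.

Definition coef u i := ip u (e i).
Definition psum (c : nat -> R[i]) n := \sum_(i < n) c i *: e i.

Lemma L_psum c n : L (psum c n).
Proof. by apply: L_sum => i; apply: L_scale. Qed.

Lemma coef_e i j : coef (e i) j = (i == j)%:R.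
Proof. exact: e_orth. Qed.

Lemma coef_sub u v i : L u -> L v -> coef (u - v) i = coef u i - coef v i.
Proof. by move=> Lu Lv; rewrite /coef ipB. Qed.

Lemma ip_psum c n v : L v ->
  ip (psum c n) v = \sum_(i < n) c i * conjc (coef v i).
Proof.
move=> Lv; rewrite ip_sum// => [|i]; last exact: L_scale.
by apply: eq_bigr => i _; rewrite ipZ// ip_conj.
Qed.

Lemma coef_psum c n i : coef (psum c n) i = if (i < n)%N then c i else 0.
Proof.
rewrite /coef ip_psum//; case: ltnP => [lt|ge].
  rewrite (bigD1 (Ordinal lt))//= big1 ?addr0 => [|j].
    by rewrite /coef e_orth eqxx rmorph1 mulr1.
  by rewrite -val_eqE/= /coef e_orth eq_sym => /negbTE ->; rewrite rmorph0 mulr0.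
rewrite big1// => j _; rewrite /coef e_orth gtn_eqF ?rmorph0 ?mulr0//.
exact: leq_trans ge.
Qed.

Lemma nsq_psum c n : nsq (psum c n) = \sum_(i < n) sqmod (c i).
Proof.
rewrite /nsq ip_psum; last exact: L_psum.
rewrite cRe_sum; apply: eq_bigr => i _.
by rewrite coef_psum ltn_ord -sqmodE.
Qed.

Lemma nsq_sub_psum u n : L u ->
  nsq (u - psum (coef u) n) = nsq u - \sum_(i < n) sqmod (coef u i).
Proof.
move=> Lu; have Lp := L_psum (coef u) n.
rewrite nsqB// (ip_conj Lp)// cRe_conj nsq_psum ip_psum// cRe_sum.
have -> : \sum_(i < n) complex.Re (coef u i * conjc (coef u i)) =
          \sum_(i < n) sqmod (coef u i).
  by apply: eq_bigr => i _; rewrite -sqmodE.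
ring.
Qed.

Lemma bessel u n : L u -> \sum_(i < n) sqmod (coef u i) <= nsq u.
Proof.
move=> Lu; rewrite -subr_ge0 -nsq_sub_psum//.
by apply: ip_ge0; apply: L_sub => //; exact: L_psum.
Qed.

(** [N] is an index at which the partial sums come within [r] of their supremum, which serves all
    [n] at once. *)
Lemma psum_cauchy (x : nat -> R) (M : R) : (forall i, 0 <= x i) ->
  (forall n, \sum_(i < n) x i <= M) ->
  forall r, 0 < r -> exists N, forall n, \sum_(i < n) x i < \sum_(i < N) x i + r.
Proof.
move=> x0 xM r r0; set S := fun n => \sum_(i < n) x i.
have ubS : has_sup (range S).
  by split; [exists (S 0%N); exists 0%N | exists M => _ [n _ <-]; apply: xM].
have [_ [N _ <-] lt] := sup_adherent r0 ubS.
exists N => n; rewrite -ltrBlDr.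
apply: le_lt_trans lt; rewrite lerD2r.
by apply: ub_le_sup; [case: ubS | exists n].
Qed.

Lemma psum_le (x : nat -> R) m n : (forall i, 0 <= x i) -> (m <= n)%N ->
  \sum_(i < m) x i <= \sum_(i < n) x i.
Proof.
move=> x0 mn; rewrite -(subnKC mn) big_split_ord/= lerDl.
exact: sumr_ge0.
Qed.

Lemma sum_trunc (x : nat -> R) m n : (m <= n)%N ->
  (forall i, (m <= i)%N -> x i = 0) -> \sum_(i < n) x i = \sum_(i < m) x i.
Proof.
move=> mn x0; rewrite -(subnKC mn) big_split_ord/= [X in _ + X]big1 ?addr0//.
by move=> i _; rewrite x0// leq_addr.
Qed.

Lemma coef_lim w u i : (forall j, L (w j)) -> L u ->
  (fun j => nsq (w j - u)) @ \oo --> (0 : R) ->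
  cvgC (fun j => coef (w j) i) (coef u i).
Proof.
move=> Lw Lu wu; apply: cvgC_sqmod.
apply: (squeeze_cvgr _ (cvg_cst 0) wu); apply: nearW => j /=.
rewrite sqmod_ge0/= -coef_sub//.
have := cauchy_schwarz (L_sub (Lw j) Lu) (L_e i).
by rewrite /nsq e_orth eqxx mulr1.
Qed.

Lemma nsq_sub_psum_cvg u : L u ->
  (fun n => nsq (psum (coef u) n - u)) @ \oo --> (0 : R) ->
  forall r, 0 < r -> exists n, nsq (u - psum (coef u) n) < r.
Proof.
move=> Lu /cvgrPdist_lt h r r0; have [N _ hN] := h _ r0; exists N.
have := hN N (leqnn N); rewrite /= sub0r normrN nsqBC//; last exact: L_psum.
exact/le_lt_trans/ler_norm.
Qed.

(** The partial sums are Cauchy because the squared distance of two of them is a block of the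
    series. Each coefficient is eventually constant along them, so it passes to the limit. *)
Lemma riesz_fischer (c : nat -> R[i]) (M : R) :
  (forall n, \sum_(i < n) sqmod (c i) <= M) ->
  exists u, [/\ L u, coef u = c &
    (fun n => nsq (psum c n - u)) @ \oo --> (0 : R)].
Proof.
move=> cM.
have diffE m n : (m <= n)%N -> nsq (psum c n - psum c m) =
    \sum_(i < n) sqmod (c i) - \sum_(i < m) sqmod (c i).
  move=> mn; rewrite nsqB; [|exact: L_psum..].
  rewrite !nsq_psum ip_psum; last exact: L_psum.
  rewrite cRe_sum (sum_trunc mn (x := fun i =>
    complex.Re (c i * conjc (coef (psum c m) i)))); last first.
    by move=> i mi; rewrite coef_psum ifN ?conjc0 ?mulr0// -leqNgt.
  have -> : \sum_(i < m) complex.Re (c i * conjc (coef (psum c m) i)) =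
      \sum_(i < m) sqmod (c i).
    by apply: eq_bigr => i _; rewrite coef_psum ltn_ord -sqmodE.
  ring.
have [|r r0|u Lu cu] := @L_complete (psum c).
- by move=> j; exact: L_psum.
- have [N hN] := psum_cauchy (fun i => sqmod_ge0 (c i)) cM r0.
  exists N => j l; wlog jl : j l / (j <= l)%N.
    move=> H; case: (leqP j l) => [jl|/ltnW lj] Nj Nl; first exact: H.
    by rewrite nsqBC; [exact: H|exact: L_psum..].
  move=> Nj Nl; rewrite nsqBC; [|exact: L_psum..].
  have := psum_le (x := fun i => sqmod (c i)) (fun i => sqmod_ge0 (c i)) Nj.
  by have := hN l; rewrite diffE//; lra.
exists u; split => //; apply/funext => i.
apply: (cvgC_unique (coef_lim i (L_psum c) Lu cu)); apply: cvgC_sqmod.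
apply: cvg_near_cst.
exists i.+1 => // j /= ij; rewrite coef_psum ij subrr.
by rewrite sqmod0.
Qed.

(** Riesz-Fischer applied to the coefficients of [u] gives a limit [v] with the same coefficients;
    totality makes [v - u] null, and by Cauchy-Schwarz a null vector does not change distances. *)
Lemma psum_cvg u : L u -> (fun n => nsq (psum (coef u) n - u)) @ \oo --> (0 : R).
Proof.
move=> Lu; have [v [Lv vu cv]] := riesz_fischer (fun n => bessel n Lu).
have uv0 : nsq (v - u) = 0.
  by apply: e_total; [exact: L_sub|move=> i; rewrite -/(coef _ i) coef_sub// vu subrr].
suff -> : (fun n => nsq (psum (coef u) n - u)) =
          (fun n => nsq (psum (coef u) n - v)) by [].
apply/funext => n; have Lp := L_psum (coef u) n.
have Lpv := L_sub Lp Lv; have Lvu := L_sub Lv Lu.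
have -> : psum (coef u) n - u = (psum (coef u) n - v) + (v - u).
  by rewrite addrA subrK.
rewrite nsqD// uv0 addr0 (ip_conj Lvu)// nsq_eq0_ip// conjc0.
by rewrite mulr0 addr0.
Qed.

Lemma nsq_le u M : L u -> (forall n, \sum_(i < n) sqmod (coef u i) <= M) -> nsq u <= M.
Proof.
move=> Lu uM; apply/ler_addgt0Pr => r r0.
have [n] := nsq_sub_psum_cvg Lu (psum_cvg Lu) r0.
by rewrite nsq_sub_psum//; have := uM n; lra.
Qed.

Lemma ip_psum_cvg u v : L u -> L v ->
  cvgC (fun n => \sum_(i < n) coef u i * conjc (coef v i)) (ip u v).
Proof.
move=> Lu Lv; apply: cvgC_sqmod.
have h : (fun n => nsq (psum (coef u) n - u) * nsq v) @ \oo --> (0 : R).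
  by rewrite -(mul0r (nsq v)); apply: cvgM; [exact: psum_cvg|exact: cvg_cst].
apply: (squeeze_cvgr _ (cvg_cst 0) h); apply: nearW => n /=.
have Lp := L_psum (coef u) n.
rewrite sqmod_ge0/= -ip_psum// -ipB//.
by apply: cauchy_schwarz => //; apply: L_sub.
Qed.

Lemma cvg_ord_sum n (F : 'I_n -> nat -> R) (l : 'I_n -> R) :
  (forall i, F i @ \oo --> l i) ->
  (fun k => \sum_(i < n) F i k) @ \oo --> \sum_(i < n) l i.
Proof.
elim: n F l => [|n IH] F l Fl.
  by rewrite big_ord0; under eq_fun do rewrite big_ord0; apply: cvg_cst.
rewrite big_ord_recr/=; under eq_fun do rewrite big_ord_recr/=.
by apply: cvgD => //; apply: IH.
Qed.

Lemma cvg_le_cst (x : nat -> R) l r :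
  x @ \oo --> l -> (forall n, x n <= r) -> l <= r.
Proof.
move=> xl xr; rewrite -(cvg_lim (@Rhausdorff R) xl); apply: limr_le.
  by apply/cvg_ex; exists l.
exact: nearW.
Qed.

Lemma cvgC_sqmod_le (z : nat -> R[i]) l r :
  cvgC z l -> (forall n, sqmod (z n) <= r) -> sqmod l <= r.
Proof.
move=> [h1 h2]; apply: cvg_le_cst.
by rewrite /sqmod; apply: cvgD; rewrite expr2; under eq_fun do rewrite expr2;
  apply: cvgM.
Qed.

(** * The form of a diagonal operator, its closure and its Friedrichs extension *)

Variables (D : V -> Prop) (H : V -> V) (lam : nat -> R) (c0 : R).
Hypothesis D_L : forall u, D u -> L u.
Hypothesis D0 : D 0.
Hypothesis D_lin : forall a u v, D u -> D v -> D (a *: u + v).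
Hypothesis H_L : forall u, D u -> L (H u).
Hypothesis H_coef : forall u i, D u -> ip (H u) (e i) = (lam i)%:C * ip u (e i).
Hypothesis c0_gt0 : 0 < c0.
Hypothesis lam_ge : forall i, c0 <= lam i.
Hypothesis e_approx : forall i r, 0 < r ->
  exists w, [/\ D w, nsq (w - e i) < r & complex.Re (ip (H w) w) < lam i * nsq w + r].

(** Reads: the sum of all lam_i |<u, e_i>|^2 is at most [r]. A bound on partial sums makes sense for
    every [u], inside the form domain or not, and passes to limits one coefficient at a time. *)
Definition energy_le u (r : R) :=
  forall n, \sum_(i < n) lam i * sqmod (coef u i) <= r.

Lemma lam_gt0 i : 0 < lam i.
Proof. exact: lt_le_trans (lam_ge i). Qed.

Lemma lam_sqmod_ge0 u i : 0 <= lam i * sqmod (coef u i).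
Proof. by rewrite mulr_ge0 ?sqmod_ge0// ltW// lam_gt0. Qed.

Lemma D_sub u v : D u -> D v -> D (u - v).
Proof.
by move=> Du Dv; rewrite addrC -scaleN1r; apply: D_lin.
Qed.

Lemma energy_leW u r s : r <= s -> energy_le u r -> energy_le u s.
Proof. by move=> rs h n; apply: le_trans rs. Qed.

Lemma energy_le_ge0 u r : energy_le u r -> 0 <= r.
Proof. by move/(_ 0%N); rewrite big_ord0. Qed.

Lemma energy_leN u r : L u -> energy_le u r -> energy_le (- u) r.
Proof.
move=> Lu h n; under eq_bigr do rewrite /coef ipN// sqmodN.
exact: h.
Qed.

Lemma energy_leD u v r s : L u -> L v -> energy_le u r -> energy_le v s ->
  energy_le (u + v) (2 * r + 2 * s).
Proof.
move=> Lu Lv hu hv n.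
apply: (@le_trans _ _ (2 * \sum_(i < n) lam i * sqmod (coef u i) +
                     2 * \sum_(i < n) lam i * sqmod (coef v i))); last first.
  by have := hu n; have := hv n; lra.
rewrite !mulr_sumr -big_split/=; apply: ler_sum => i _.
rewrite (mulrCA 2) (mulrCA 2 _ (sqmod (coef v i))) -mulrDr ler_pM2l ?lam_gt0//.
by rewrite /coef ipD//; apply: sqmodD_le.
Qed.

Lemma energy_leB u v r s : L u -> L v -> energy_le u r -> energy_le v s ->
  energy_le (u - v) (2 * r + 2 * s).
Proof.
move=> Lu Lv hu hv; apply: energy_leD => //; first exact: L_opp.
exact: energy_leN.
Qed.

Lemma energy_leZ a u r : L u -> energy_le u r ->
  energy_le (a *: u) (sqmod a * r).
Proof.
move=> Lu hu n; apply: (@le_trans _ _ (sqmod a * \sum_(i < n) lam i * sqmod (coef u i))).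
  rewrite mulr_sumr; apply: ler_sum => i _.
  by rewrite /coef ipZ// sqmodM mulrCA.
by rewrite ler_wpM2l ?sqmod_ge0.
Qed.

Lemma energy_nsq u r : L u -> energy_le u r -> nsq u <= r / c0.
Proof.
move=> Lu hu; apply: nsq_le => // n; rewrite ler_pdivlMr//.
apply: le_trans (hu n); rewrite mulr_suml; apply: ler_sum => i _.
by rewrite mulrC ler_wpM2r ?sqmod_ge0.
Qed.

(** Parseval for [H u] and [v]: on [D] the form is diagonal. Its symmetry ([form_sym]) and its
    comparison with the energy ([form_energy], [form_le]) come from this series, without any
    integration by parts. *)
Lemma form_cvg u v : D u -> L v ->
  cvgC (fun n => \sum_(i < n) (lam i)%:C * (coef u i * conjc (coef v i)))
    (ip (H u) v).
Proof.
move=> Du Lv; have := ip_psum_cvg (H_L Du) Lv.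
suff -> : (fun n => \sum_(i < n) coef (H u) i * conjc (coef v i)) =
  (fun n => \sum_(i < n) (lam i)%:C * (coef u i * conjc (coef v i))) by [].
apply/funext => n; apply: eq_bigr => i _.
by rewrite {1}/coef H_coef// mulrA.
Qed.

Lemma form_re_cvg u : D u ->
  (fun n => \sum_(i < n) lam i * sqmod (coef u i)) @ \oo -->
    complex.Re (ip (H u) u).
Proof.
move=> Du; have [] := form_cvg Du (D_L Du) => + _.
suff -> : (fun j => complex.Re
     (\sum_(i < j) (lam i)%:C * (coef u i * conjc (coef u i)))) =
  (fun n => \sum_(i < n) lam i * sqmod (coef u i)) by [].
apply/funext => n; rewrite cRe_sum; apply: eq_bigr => i _.
by rewrite -sqmodE -real_complexM.
Qed.

Lemma form_energy u : D u -> energy_le u (complex.Re (ip (H u) u)).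
Proof.
move=> Du n; have cv := form_re_cvg Du.
rewrite -(cvg_lim (@Rhausdorff R) cv).
apply: (nondecreasing_cvgn_le (u_ := fun n => \sum_(i < n) lam i * sqmod (coef u i))).
  move=> m k mk; apply: (psum_le (x := fun i => lam i * sqmod (coef u i))) => //.
  by move=> i; apply: lam_sqmod_ge0.
by apply/cvg_ex; eexists; exact: cv.
Qed.

Lemma form_le u r : D u -> energy_le u r -> complex.Re (ip (H u) u) <= r.
Proof. by move=> Du hu; apply: (cvg_le_cst (form_re_cvg Du)). Qed.

Lemma form_sym u v : D u -> D v -> ip (H v) u = conjc (ip (H u) v).
Proof.
move=> Du Dv; apply: (cvgC_unique (form_cvg Dv (D_L Du))).
have := cvgC_conj (form_cvg Du (D_L Dv)).
suff -> : (fun j => conjc (\sum_(i < j) (lam i)%:C * (coef u i * conjc (coef v i)))) =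
 (fun n => \sum_(i < n) (lam i)%:C * (coef v i * conjc (coef u i))) by [].
apply/funext => n; rewrite cconj_sum; apply: eq_bigr => i _.
by rewrite !cconjM conjc_real conjcK (mulrC (coef v i)).
Qed.

(** Cauchy-Schwarz for the finite sums with coefficients [sqrt (lam i) * x i] and
    [sqrt (lam i) * y i]. *)
Lemma weighted_cauchy_schwarz (x y : nat -> R[i]) n :
  sqmod (\sum_(i < n) (lam i)%:C * (x i * conjc (y i))) <=
  (\sum_(i < n) lam i * sqmod (x i)) * (\sum_(i < n) lam i * sqmod (y i)).
Proof.
pose sx z i : R[i] := (Num.sqrt (lam i))%:C * z i.
have E z : nsq (psum (sx z) n) = \sum_(i < n) lam i * sqmod (z i).
  rewrite nsq_psum; apply: eq_bigr => i _.
  by rewrite sqmodM sqmod_real sqr_sqrtr// ltW// lam_gt0.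
rewrite -!E; have := cauchy_schwarz (L_psum (sx x) n) (L_psum (sx y) n).
rewrite ip_psum; last exact: L_psum.
suff -> : \sum_(i < n) sx x i * conjc (coef (psum (sx y) n) i) =
  \sum_(i < n) (lam i)%:C * (x i * conjc (y i)) by [].
apply: eq_bigr => i _; rewrite coef_psum ltn_ord /sx cconjM conjc_real.
rewrite mulrACA -real_complexM -expr2 sqr_sqrtr//.
by rewrite ltW// lam_gt0.
Qed.

(* [form_approx], [form_domain] and [friedrichs] for an abstract space, with [nsq]
   in place of [norm2]. *)
Definition fapprox u w := [/\ forall j, D (w j),
  (fun j => nsq (w j - u)) @ \oo --> (0 : R) &
  forall r, 0 < r -> exists N, forall j l, (N <= j)%N -> (N <= l)%N ->
    complex.Re (ip (H (w j - w l)) (w j - w l)) < r].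

Definition fdom u := L u /\ exists w, fapprox u w.

Definition fried u f := [/\ fdom u, L f & forall v, fdom v ->
  forall wu wv, fapprox u wu -> fapprox v wv ->
    cvgC (fun j => ip (H (wu j)) (wv j)) (ip f v)].

(** Closability of the form: the partial energies of [w j - w l] are bounded by the form, and
    letting [l] tend to infinity in finitely many coefficients replaces [w l] by [u]. *)
Lemma fapprox_energy u w : L u -> fapprox u w -> forall r, 0 < r ->
  exists N, forall j, (N <= j)%N -> energy_le (w j - u) r.
Proof.
move=> Lu [Dw wu wC] r r0; have [N hN] := wC _ r0.
exists N => j Nj n.
have Lw l : L (w l) by apply: D_L.
have h : (fun l => \sum_(i < n) lam i * sqmod (coef (w j) i - coef (w l) i)) @ \oo
    --> \sum_(i < n) lam i * sqmod (coef (w j) i - coef u i).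
  apply: cvg_ord_sum => i; apply: cvgM; first exact: cvg_cst.
  have [h1 h2] := coef_lim i Lw Lu wu.
  by rewrite /sqmod; apply: cvgD; rewrite expr2; under eq_fun do rewrite expr2;
    apply: cvgM; rewrite ?(cReD,cReN,cImD,cImN);
    under eq_fun do rewrite ?(cReD,cReN,cImD,cImN);
    apply: cvgB => //; exact: cvg_cst.
under eq_bigr do rewrite coef_sub//.
rewrite -(cvg_lim (@Rhausdorff R) h); apply: limr_le.
  by apply/cvg_ex; eexists; exact: h.
exists N => // l /= Nl; apply/ltW; apply: le_lt_trans (hN j l Nj Nl).
under eq_bigr do rewrite -coef_sub//.
exact: (form_energy (D_sub (Dw j) (Dw l))).
Qed.

Definition energy_closure u := L u /\ forall r, 0 < r ->
  exists2 w, D w & energy_le (w - u) r.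

(** From right to left, approximants with energy error 1/(j+1) converge in norm since the energy
    dominates [c0 * nsq], and the form at [w j - w l] is at most 2/(j+1) + 2/(l+1), hence the
    threshold [r / 4]. *)
Lemma fdomP u : fdom u <-> energy_closure u.
Proof.
split=> [[Lu [w wa]]|[Lu h]].
  split => // r r0; have [N hN] := fapprox_energy Lu wa r0.
  by exists (w N); [case: wa|exact: hN].
split=> //.
have hj j : {w | D w & energy_le (w - u) j.+1%:R^-1}.
  by apply/cid2/h; rewrite invr_gt0 ltr0n.
exists (fun j => s2val (hj j)).
have Dj j : D (s2val (hj j)) := s2valP (hj j).
have Ej j : energy_le (s2val (hj j) - u) j.+1%:R^-1 := s2valP' (hj j).
have Lj j : L (s2val (hj j) - u) by apply: L_sub => //; apply: D_L.
split=> //.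
  have lim0 : (fun j => j.+1%:R^-1 / c0) @ \oo --> (0 : R).
    rewrite -(mul0r c0^-1); apply: cvgM; last exact: cvg_cst.
    exact: cvg_harmonic.
  apply: (squeeze_cvgr _ (cvg_cst 0) lim0); apply: nearW => j /=.
  by rewrite ip_ge0//= energy_nsq.
move=> r r0.
have /cvgrPdist_lt/(_ (r / 4)) := @cvg_harmonic R.
case; [by rewrite divr_gt0|move=> N _ hN].
exists N => j l Nj Nl.
have Ew : energy_le (s2val (hj j) - s2val (hj l))
   (2 * j.+1%:R^-1 + 2 * l.+1%:R^-1).
  have -> : s2val (hj j) - s2val (hj l) = (s2val (hj j) - u) - (s2val (hj l) - u).
    by rewrite opprB addrA subrK.
  exact: energy_leB.
move/le_lt_trans: (form_le (D_sub (Dj j) (Dj l)) Ew); apply.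
have hh k : (N <= k)%N -> k.+1%:R^-1 < r / 4.
  move=> Nk; have := hN k Nk; rewrite /= sub0r normrN.
  exact/le_lt_trans/ler_norm.
have := hh _ Nj; have := hh _ Nl.
by move: (j.+1%:R^-1 : R) (l.+1%:R^-1 : R) => {Ew Ej Lj}x y; lra.
Qed.

Lemma energy_closure_lin a u v :
  energy_closure u -> energy_closure v -> energy_closure (a *: u + v).
Proof.
move=> [Lu hu] [Lv hv]; split=> [|r r0]; first exact: L_lin.
have s0 := sqmod_ge0 a.
(* The [+ 1] covers [a = 0]. Each of the two errors contributes at most [r / 2] to the bound of
   [energy_leD]. *)
have [|wu Du Eu] := hu (r / (4 * (sqmod a + 1))).
  by rewrite divr_gt0// mulr_gt0// ltr_wpDl.
have [|wv Dv Ev] := hv (r / 4); first by rewrite divr_gt0.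
exists (a *: wu + wv); first exact: D_lin.
have -> : a *: wu + wv - (a *: u + v) = a *: (wu - u) + (wv - v).
  by rewrite scalerBr opprD addrACA.
have Lu' : L (wu - u) by apply: L_sub => //; apply: D_L.
have Lv' : L (wv - v) by apply: L_sub => //; apply: D_L.
have := energy_leD (L_scale a Lu') Lv' (energy_leZ a Lu' Eu) Ev.
apply: energy_leW.
have E : sqmod a * (r / (4 * (sqmod a + 1))) = sqmod a / (sqmod a + 1) * (r / 4).
  by field; rewrite gt_eqF// ltr_wpDl.
have h : sqmod a / (sqmod a + 1) <= 1 by rewrite ler_pdivrMr ?ltr_wpDl// mul1r lerDl.
rewrite E; have : sqmod a / (sqmod a + 1) * (r / 4) <= 1 * (r / 4).
  by rewrite ler_wpM2r// divr_ge0// ltW.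
lra.
Qed.

(** Expanding the square, the energy of [w - e i] is that of [w] plus
    [lam i * (nsq (w - e i) - nsq w)]. The bound on the form at [w] in [e_approx] cancels
    [lam i * nsq w] and leaves at most [d + lam i * d = r]. *)
Lemma energy_closure_e i : energy_closure (e i).
Proof.
split=> // r r0; have li := lam_gt0 i.
have [|w [Dw wn wq]] := @e_approx i (r / (lam i + 1)).
  by rewrite divr_gt0// addr_gt0.
set d := r / (lam i + 1) in wn wq.
have rE : r = lam i * d + d by rewrite /d; field; rewrite gt_eqF// addr_gt0.
have Lw := D_L Dw.
exists w => // n0.
(* Enlarging the truncation so that it contains the index [i] can only increase the partial
   energy. *)
pose n := maxn n0 i.+1; have lt : (i < n)%N by rewrite leq_max leqnn orbT.
have := psum_le (x := fun j => lam j * sqmod (coef (w - e i) j))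
  (fun j => lam_sqmod_ge0 _ j) (leq_maxl n0 i.+1).
move/le_trans; apply.
have E : \sum_(j < n) lam j * sqmod (coef (w - e i) j) =
    \sum_(j < n) lam j * sqmod (coef w j) + lam i * (1 - 2 * complex.Re (coef w i)).
  rewrite (bigD1 (Ordinal lt))//= [in RHS](bigD1 (Ordinal lt))//=.
  rewrite addrAC; congr (_ + _).
    rewrite coef_sub// coef_e eqxx /sqmod.
    by case: (coef w i) => x y /=; ring.
  apply: eq_bigr => j; rewrite -val_eqE/= eq_sym => /negbTE ij.
  by rewrite coef_sub// coef_e ij subr0.
have nE : 1 - 2 * complex.Re (coef w i) = nsq (w - e i) - nsq w.
  by rewrite nsqB// [nsq (e i)]/nsq e_orth eqxx/= /coef; ring.
have fe := form_energy Dw n.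
have : lam i * nsq (w - e i) <= lam i * d by rewrite ler_pM2l// ltW.
rewrite -/n E nE mulrBr; lra.
Qed.

Lemma energy_closure_psum c n : energy_closure (psum c n).
Proof.
rewrite /psum; elim: n => [|n IH].
  rewrite big_ord0; split=> // r r0; exists 0 => // n.
  rewrite subr0 big1 ?ltW// => i _.
  by rewrite /coef ip0l// sqmod0 mulr0.
rewrite big_ord_recr/= addrC; apply: energy_closure_lin => //.
exact: energy_closure_e.
Qed.

(** The tail of the energy series beyond [N] costs [r / 4], and the finite sum up to [N] is
    approximated from [D] within another [r / 4]. *)
Lemma fdom_energy u M : L u -> energy_le u M -> fdom u.
Proof.
move=> Lu uM; apply/fdomP; split=> // r r0.
have r4 : 0 < r / 4 by rewrite divr_gt0.
have [N hN] := psum_cauchy (fun i => lam_sqmod_ge0 u i) uM r4.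
have [_ /(_ _ r4)[w Dw Ew]] := energy_closure_psum (coef u) N.
have Lp := L_psum (coef u) N.
exists w => //.
have -> : w - u = (w - psum (coef u) N) - (u - psum (coef u) N).
  by rewrite opprB addrA subrK.
have Et : energy_le (u - psum (coef u) N) (r / 4).
  move=> n; pose m := maxn n N.
  have := psum_le (x := fun j => lam j * sqmod (coef (u - psum (coef u) N) j))
    (fun j => lam_sqmod_ge0 _ j) (leq_maxl n N).
  move/le_trans; apply; rewrite -/m.
  have Nm : (N <= m)%N by exact: leq_maxr.
  have := hN m; rewrite -(subnKC Nm) !big_split_ord/=.
  rewrite [X in _ -> X + _ <= _]big1 => [|i _]; last first.
    by rewrite coef_sub// coef_psum ltn_ord subrr sqmod0 mulr0.
  rewrite add0r => h; rewrite -(lerD2l (\sum_(i < N) lam i * sqmod (coef u i))).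
  apply: le_trans (ltW h); rewrite lerD2l; apply: ler_sum => i _.
  by rewrite coef_sub// coef_psum ltnNge leq_addr/= subr0.
have Lw := D_L Dw.
have := energy_leB (L_sub Lw Lp) (L_sub Lu Lp) Ew Et.
by apply: energy_leW; lra.
Qed.

Lemma fdom_energy_bound u : fdom u -> exists M, energy_le u M.
Proof.
move=> /fdomP[Lu /(_ _ ltr01)[w Dw Ew]].
have -> : u = w - (w - u) by rewrite subKr.
have Lw := D_L Dw.
eexists; apply: energy_leB => //; [exact: L_sub|exact: form_energy].
Qed.

(** [H (wu j)] need not tend to [f] in norm, so the difference is split as <H wu - f, wv> + <f, wv -
    v>. The coefficients of [H wu - f] are [lam] times those of [wu - u], and the weighted
    Cauchy-Schwarz inequality bounds the first term by the energies of [wu - u] and [wv]. *)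
Lemma form_limit u v f wu wv : fdom u -> fdom v -> L f ->
  (forall i, coef f i = (lam i)%:C * coef u i) ->
  fapprox u wu -> fapprox v wv ->
  cvgC (fun j => ip (H (wu j)) (wv j)) (ip f v).
Proof.
move=> fu fv Lf fE au av; have [Lu _] := fu; have [Lv _] := fv.
have [Du _ _] := au; have [Dv nv _] := av.
have Lwu j := D_L (Du j); have Lwv j := D_L (Dv j).
apply: cvgC_sqmod.
have [M vM] := fdom_energy_bound fv.
have M0 := energy_le_ge0 vM.
have [N1 h1] := fapprox_energy Lv av ltr01.
have nfv : (fun j => nsq f * nsq (wv j - v)) @ \oo --> (0 : R).
  by rewrite -(mulr0 (nsq f)); apply: cvgM => //; exact: cvg_cst.
apply/cvgrPdist_lt => r r0.
have /cvgrPdist_lt/(_ (r / 4)) := nfv.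
case; [by rewrite divr_gt0|move=> N2 _ h2].
(* [K] bounds the energy of [wv j] as soon as that of [wv j - v] is at most 1. *)
pose K := 2 + 2 * M.
have K0 : 0 < K by rewrite /K; lra.
have [|N3 h3] := fapprox_energy Lu au (r := r / (4 * K)).
  by rewrite divr_gt0// mulr_gt0.
exists (maxn N1 (maxn N2 N3)) => // j /=; rewrite !geq_max => /and3P[j1 j2 j3].
rewrite sub0r normrN ger0_norm ?sqmod_ge0//.
have -> : ip (H (wu j)) (wv j) - ip f v =
   ip (H (wu j) - f) (wv j) + ip f (wv j - v).
  by rewrite ipB// ?ipBr//; [rewrite addrA subrK|exact: H_L].
have LHf : L (H (wu j) - f) by apply: L_sub => //; exact: H_L.
have LB : L (wv j - v) by apply: L_sub.
apply: le_lt_trans (sqmodD_le _ _) _.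
have t2 : sqmod (ip f (wv j - v)) < r / 4.
  apply: le_lt_trans (cauchy_schwarz Lf LB) _.
  by have := h2 j j2; rewrite /= sub0r normrN; apply: le_lt_trans; exact: ler_norm.
have t1 : sqmod (ip (H (wu j) - f) (wv j)) <= r / 4.
  apply: (cvgC_sqmod_le (ip_psum_cvg LHf (Lwv j))) => n.
  have -> : \sum_(i < n) coef (H (wu j) - f) i * conjc (coef (wv j) i) =
    \sum_(i < n) (lam i)%:C * (coef (wu j - u) i * conjc (coef (wv j) i)).
    apply: eq_bigr => i _; rewrite !coef_sub//; last exact: H_L.
    by rewrite {1}/coef H_coef// fE -mulrBr mulrA.
  apply: le_trans (weighted_cauchy_schwarz _ _ _) _.
  have -> : r / 4 = r / (4 * K) * K by field; rewrite gt_eqF.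
  apply: ler_pM; rewrite ?sumr_ge0//=.
  - by move=> i _; apply: lam_sqmod_ge0.
  - by move=> i _; apply: lam_sqmod_ge0.
  - exact: h3.
  - have -> : wv j = (wv j - v) + v by rewrite subrK.
    have := energy_leD LB Lv (h1 j j1) vM n.
    by rewrite mulr1.
lra.
Qed.

(** Testing with [v = e i] identifies the coefficients: the same limit is computed a second time by
    [form_limit], with [e i] and its image [lam i *: e i] in the first slot, and conjugated by
    [form_sym]. Conversely lam_i |u_i|^2 <= |f_i|^2 / c0, so [u] has finite energy and [form_limit]
    applies. *)
Lemma friedP u f : fried u f <->
  [/\ L u, L f & forall i, coef f i = (lam i)%:C * coef u i].
Proof.
split=> [[fu Lf h]|[Lu Lf fE]].
  have [Lu [wu au]] := fu; split=> // i.
  have fe : fdom (e i) by apply/fdomP; exact: energy_closure_e.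
  have [_ [wv av]] := fe.
  have c1 := h _ fe _ _ au av.
  apply: (cvgC_unique c1).
  have Ee k : coef ((lam i)%:C *: e i) k = (lam k)%:C * coef (e i) k.
    rewrite {1}/coef ipZ// -/(coef _ _) coef_e; case: eqP => [->//|_].
    by rewrite !mulr0.
  have := cvgC_conj (form_limit fe fu (L_scale _ (L_e i)) Ee av au).
  have -> : conjc (ip ((lam i)%:C *: e i) u) = (lam i)%:C * coef u i.
    by rewrite ipZ// cconjM conjc_real -ip_conj.
  suff -> : (fun j => conjc (ip (H (wv j)) (wu j))) =
    (fun j => ip (H (wu j)) (wv j)) by [].
  by apply/funext => j; rewrite -form_sym//; [case: av|case: au].
have uM : energy_le u (nsq f / c0).
  move=> n; apply: (@le_trans _ _ ((\sum_(i < n) sqmod (coef f i)) / c0)).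
    rewrite mulr_suml; apply: ler_sum => i _.
    rewrite fE sqmodM sqmod_real ler_pdivlMr// mulrAC ler_wpM2r ?sqmod_ge0//.
    by rewrite expr2 ler_pM2l ?lam_gt0.
  by rewrite ler_pM2r ?invr_gt0//; exact: bessel.
have fu := fdom_energy Lu uM.
split=> // v fv wu wv au av.
exact: form_limit au av.
Qed.

(** [d] bounds squared distances. The solution has the coefficients [coef f i / (lam i - z)], which
    are square summable by Bessel. *)
Lemma fried_resolvent (z : R[i]) d f : 0 < d -> L f ->
  (forall i, d <= sqmod ((lam i)%:C - z)) ->
  exists2 u, fried u (z *: u + f) & nsq u <= nsq f / d.
Proof.
move=> d0 Lf dz; pose c i := coef f i / ((lam i)%:C - z).
have nz i : (lam i)%:C - z != 0.
  apply/eqP => E; have := dz i; rewrite E sqmod0; lra.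
have cM n : \sum_(i < n) sqmod (c i) <= nsq f / d.
  apply: (@le_trans _ _ ((\sum_(i < n) sqmod (coef f i)) / d)).
    rewrite mulr_suml; apply: ler_sum => i _.
    rewrite ler_pdivlMr//; have -> : coef f i = c i * ((lam i)%:C - z).
      by rewrite /c divfK.
    by rewrite sqmodM ler_wpM2l ?sqmod_ge0.
  by rewrite ler_pM2r ?invr_gt0//; exact: bessel.
have [u [Lu uc _]] := riesz_fischer cM.
exists u; last by apply: nsq_le => // n; rewrite uc.
apply/friedP; split=> [//||i]; first exact: L_lin.
rewrite /coef ip_lin// -/(coef u i) -/(coef f i) uc /c.
by field; exact: nz.
Qed.

Lemma fried_eigen_coef z u i : fried u (z *: u) -> (lam i)%:C != z -> coef u i = 0.
Proof.
move=> /friedP[Lu _ /(_ i)] + nz; rewrite /coef ipZ// => /eqP.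
rewrite -subr_eq0 -mulrBl mulf_eq0 subr_eq0 eq_sym (negbTE nz)/=.
by move/eqP.
Qed.

Lemma fried_eigen_span z u K : fried u (z *: u) ->
  (forall i, (K <= i)%N -> (lam i)%:C != z) -> nsq (u - psum (coef u) K) = 0.
Proof.
move=> fu Kz; have [Lu _ _] := (friedP _ _).1 fu.
apply: e_total => [|i]; first by apply: L_sub => //; exact: L_psum.
rewrite -/(coef _ i) coef_sub//; last exact: L_psum.
rewrite coef_psum; case: ltnP => [_|Ki]; first by rewrite subrr.
by rewrite subr0 (fried_eigen_coef fu (Kz _ Ki)).
Qed.

End InnerProduct.

(** * Integration over the hemisphere *)

Section PlaneMeasurability.
Variable R : realType.

Lemma rat_dense (x d : R) : 0 < d -> exists q : rat, `|ratr q - x| < d.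
Proof.
move=> d0; have [|q] := @rat_in_itvoo R (x - d) (x + d); first lra.
by rewrite in_itv/= => /andP[h1 h2]; exists q; rewrite ltr_norml; lra.
Qed.

(** An open set is the union of the boxes with rational centre and radius 1/(n+1) that it contains;
    [F] empties the other boxes, so that the union runs over a whole countable type. *)
Lemma open2_measurable (U : set (R * R)) : open U -> measurable U.
Proof.
move=> oU; pose box (t : rat * rat * nat) : set (R * R) :=
  ball (ratr t.1.1 : R) t.2.+1%:R^-1 `*` ball (ratr t.1.2 : R) t.2.+1%:R^-1.
pose F t := if `[< box t `<=` U >] then box t else set0.
have -> : U = \bigcup_t F t.
  apply/seteqP; split=> [[x y] Uxy|p [t _]]; last first.
    by rewrite /F; case: asboolP => // h /h.
  have /nbhs_ballP[e /= e0 eU] : nbhs (x, y) U by rewrite nbhsE; exists U.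
  have [n nP] : exists n, n.+1%:R^-1 < e / 2.
    have /cvgrPdist_lt/(_ (e / 2)) := @cvg_harmonic R.
    case; [by rewrite divr_gt0|move=> n _ /(_ n (leqnn _))/=].
    rewrite sub0r normrN => h; exists n; apply: le_lt_trans h; exact: ler_norm.
  have n0 : 0 < n.+1%:R^-1 :> R by rewrite invr_gt0.
  have [q1 q1P] := rat_dense x n0; have [q2 q2P] := rat_dense y n0.
  exists (q1, q2, n) => //; rewrite /F asboolT; first by split.
  move=> [x' y'] [/= h1 h2]; apply: eU; split => /=; rewrite /ball/= /ball_/=.
    have -> : x - x' = (x - ratr q1) + (ratr q1 - x') by rewrite addrA subrK.
    apply: le_lt_trans (ler_normD _ _) _; rewrite (splitr e).
    by apply: ltrD; rewrite (lt_trans _ nP)// distrC.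
  have -> : y - y' = (y - ratr q2) + (ratr q2 - y') by rewrite addrA subrK.
  apply: le_lt_trans (ler_normD _ _) _; rewrite (splitr e).
  by apply: ltrD; rewrite (lt_trans _ nP)// distrC.
apply: countable_bigcupT_measurable; first exact: countableP.
move=> t; rewrite /F; case: asboolP => // _.
by apply: measurableX; rewrite ball_itv; apply: measurable_itv.
Qed.

Lemma continuous2_measurable (f : R * R -> R) :
  continuous f -> measurable_fun setT f.
Proof.
move=> /continuousP cf; apply: (measurability _ (measurable_realfun.RGenOpens.measurableE R)).
move=> _ [_ [a [b ->] <-]]; rewrite setTI; apply: open2_measurable.
exact/cf/interval_open.
Qed.

End PlaneMeasurability.

#[global] Instance leb2_ae_filter (R : realType) :
  Filter (nbhs (almost_everywhere (@leb2 R))).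
Proof. exact: ae_filter_ringOfSetsType. Qed.

Section HemisphereIntegral.
Variable R : realType.
Notation mu := (@lebesgue_measure R).
Notation plane := (measurableTypeR R * measurableTypeR R)%type.
Notation hemi := (@hemi R : set plane).
Notation leb2 := (@leb2 R).
Implicit Types (f g : R * R -> R) (K : R -> R).

Definition hmeas f := measurable_fun (T := plane) hemi f.

Lemma measurable_hemi : measurable hemi.
Proof. by apply: measurableX; apply: measurable_itv. Qed.

Definition rint f := \int[leb2]_(p in hemi) f p.
Definition rintegrable f := leb2.-integrable hemi (EFin \o f).

Lemma rintegrable_measurable f : rintegrable f -> hmeas f.
Proof. by move=> /measurable_int /measurable_EFinP. Qed.

Lemma rintegrableD f g : rintegrable f -> rintegrable g ->
  rintegrable (fun p => f p + g p).
Proof. by move=> h1 h2; exact: (integrableD measurable_hemi h1 h2). Qed.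

Lemma rintegrableZ a f : rintegrable f -> rintegrable (fun p => a * f p).
Proof. by move=> h1; exact: (integrableZl measurable_hemi a h1). Qed.

Lemma rintegrableB f g : rintegrable f -> rintegrable g ->
  rintegrable (fun p => f p - g p).
Proof. by move=> h1 h2; exact: (integrableB measurable_hemi h1 h2). Qed.

Lemma rintegrable0 : rintegrable (fun=> 0).
Proof. exact: integrable0. Qed.

Lemma rintD f g : rintegrable f -> rintegrable g ->
  rint (fun p => f p + g p) = rint f + rint g.
Proof. by move=> h1 h2; apply: RintegralD => //; exact: measurable_hemi. Qed.

Lemma rintB f g : rintegrable f -> rintegrable g ->
  rint (fun p => f p - g p) = rint f - rint g.
Proof. by move=> h1 h2; apply: RintegralB => //; exact: measurable_hemi. Qed.

Lemma rintZ a f : rintegrable f -> rint (fun p => a * f p) = a * rint f.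
Proof. by move=> h1; apply: RintegralZl => //; exact: measurable_hemi. Qed.

Lemma eq_rint f g : (forall p, hemi p -> f p = g p) -> rint f = rint g.
Proof. by move=> fg; apply: eq_Rintegral => p; rewrite inE; apply: fg. Qed.

Lemma eq_rintegrable f g : (forall p, hemi p -> f p = g p) ->
  rintegrable f -> rintegrable g.
Proof.
move=> fg; apply: eq_integrable => [|p]; first exact: measurable_hemi.
by rewrite inE => /fg /= ->.
Qed.

Lemma rint0 : rint (fun=> 0) = 0.
Proof. by rewrite /rint /Rintegral integral0. Qed.

Lemma rint_ge0 f : (forall p, hemi p -> 0 <= f p) -> 0 <= rint f.
Proof. by move=> h; apply: Rintegral_ge0. Qed.

Lemma le_rint f g : rintegrable f -> rintegrable g ->
  (forall p, hemi p -> f p <= g p) -> rint f <= rint g.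
Proof. by move=> h1 h2; apply: le_Rintegral => //; exact: measurable_hemi. Qed.

Lemma rintegrable_le f g : hmeas f -> rintegrable g ->
  (forall p, hemi p -> `|f p| <= g p) -> rintegrable f.
Proof.
move=> mf ig fg; apply: (le_integrable measurable_hemi) ig.
  exact/measurable_EFinP.
by move=> p hp; rewrite /= lee_fin (le_trans (fg _ hp))// ler_norm.
Qed.

Lemma rintegrable_norm f : rintegrable f -> rintegrable (fun p => `|f p|).
Proof. by move=> h; exact: (integrable_norm h). Qed.

Lemma leb2_hemi_fin : (leb2 hemi < +oo)%E.
Proof.
rewrite /leb2 product_measure1E; [|exact: measurable_itv..].
have fin (a b : R) x y : (mu [set` Interval (BSide x a) (BSide y b)] < +oo)%E.
  by rewrite lebesgue_measure_itv/=; case: ifP => _; rewrite ?ltry// -EFinD ltry.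
apply: lte_mul_pinfty => //; last exact: fin.
by rewrite ge0_fin_numE//; exact: fin.
Qed.

Lemma rintegrable_cst a : rintegrable (fun=> a).
Proof.
apply: measurable_bounded_integrable; first exact: measurable_hemi.
- exact: leb2_hemi_fin.
- exact: measurable_cst.
- exact: bounded_cst.
Qed.

Lemma rintegrable_bounded f M : hmeas f ->
  (forall p, hemi p -> `|f p| <= M) -> rintegrable f.
Proof. by move=> mf fM; exact: (rintegrable_le mf (rintegrable_cst M) fM). Qed.

Lemma hemiP x y : hemi (x, y) <-> (0 < x < pi / 2) /\ (0 <= y < pi *+ 2).
Proof. by rewrite /Defs.hemi /= !in_itv. Qed.

Lemma rint_fubini f : rintegrable f ->
  (forall y, 0 <= y < pi *+ 2 -> (\int[mu]_(x in `]0%R, (pi / 2)%R[) (f (x, y))%:E = 0)%E) ->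
  rint f = 0.
Proof.
move=> fi f0; have /(integrable_mkcond _ measurable_hemi) fi' := fi.
rewrite /rint /Rintegral integral_mkcond -integral21_prod_meas1//.
rewrite (_ : fubini_G _ _ = fun=> 0%E) ?integral0//.
apply/funext => y; rewrite /fubini_G.
have [hy|hy] := boolP (0 <= y < pi *+ 2); last first.
  apply: integral0_eq => x _; rewrite patchE; case: ifPn => // /[!inE] -[_] /=.
  by rewrite in_itv/= (negbTE hy).
rewrite -(f0 _ hy) [RHS]integral_mkcond; apply: eq_integral => x _.
rewrite !patchE; have [/[!inE] hx|hx] := boolP (x \in `]0, (pi / 2)[%classic).
  by rewrite mem_set//; apply/hemiP; split=> //; move: hx; rewrite /= in_itv.
by rewrite memNset// => -[/= hx' _]; case/negP: hx; rewrite inE.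
Qed.

Lemma rint_fubini' f : rintegrable f ->
  (forall x, 0 < x < pi / 2 -> (\int[mu]_(y in `[0%R, (pi *+ 2)%R[) (f (x, y))%:E = 0)%E) ->
  rint f = 0.
Proof.
move=> fi f0; have /(integrable_mkcond _ measurable_hemi) fi' := fi.
rewrite /rint /Rintegral integral_mkcond -integral12_prod_meas1//.
rewrite (_ : fubini_F _ _ = fun=> 0%E) ?integral0//.
apply/funext => x; rewrite /fubini_F.
have [hx|hx] := boolP (0 < x < pi / 2); last first.
  apply: integral0_eq => y _; rewrite patchE; case: ifPn => // /[!inE] -[] /=.
  by rewrite in_itv/= (negbTE hx).
rewrite -(f0 _ hx) [RHS]integral_mkcond; apply: eq_integral => y _.
rewrite !patchE; have [/[!inE] hy|hy] := boolP (y \in `[0%R, (pi *+ 2)[%classic).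
  by rewrite mem_set//; apply/hemiP; split=> //; move: hy; rewrite /= in_itv.
by rewrite memNset// => -[/= _ hy']; case/negP: hy; rewrite inE.
Qed.

Lemma hmeas_x K : {in `]0, (pi / 2)[, continuous K} -> hmeas (fun p => K p.1).
Proof.
move=> cK; have mK : measurable_fun (T := measurableTypeR R) `]0, (pi / 2)[%classic K.
  apply: open_continuous_measurable_fun; first exact: interval_open.
  by move=> x /set_mem hx; exact: cK.
apply: (measurable_comp (F := `]0, (pi / 2)[%classic) _ _ mK).
- exact: measurable_itv.
- by move=> _ [p [hp _] <-].
- by apply: measurable_funTS; exact: measurable_fst.
Qed.

Lemma hmeas_cont f : continuous f -> hmeas f.
Proof. by move=> cf; apply: measurable_funTS; exact: continuous2_measurable. Qed.

Lemma hmeas_y K : continuous K -> hmeas (fun p => K p.2).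
Proof.
move=> cK; apply: measurable_funTS; apply: measurableT_comp; last exact: measurable_snd.
exact: continuous_measurable_fun.
Qed.

Lemma hmeasM f g : hmeas f -> hmeas g -> hmeas (fun p => f p * g p).
Proof. exact: measurable_funM. Qed.
Lemma hmeasD f g : hmeas f -> hmeas g -> hmeas (fun p => f p + g p).
Proof. exact: measurable_funD. Qed.
Lemma hmeasB f g : hmeas f -> hmeas g -> hmeas (fun p => f p - g p).
Proof. exact: measurable_funB. Qed.
Lemma hmeas_cst a : hmeas (fun=> a).
Proof. exact: measurable_cst. Qed.
Lemma eq_hmeas f g : (forall p, hemi p -> f p = g p) -> hmeas f -> hmeas g.
Proof. by move=> fg; apply: eq_measurable_fun => p; rewrite inE; apply: fg. Qed.

Lemma rint_dominated (f_ : nat -> R * R -> R) f g :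
  (forall n, hmeas (f_ n)) -> hmeas f ->
  {ae leb2, forall p, hemi p -> f_ ^~ p @ \oo --> f p} ->
  rintegrable g -> (forall n p, hemi p -> `|f_ n p| <= g p) ->
  rintegrable f /\ (fun n => rint (f_ n)) @ \oo --> rint f.
Proof.
move=> mf_ mf cf ig fg.
have := @dominated_convergence _ _ _ leb2 _ measurable_hemi
  (fun n => EFin \o f_ n) (EFin \o f) (EFin \o g).
case=> //.
- by move=> n; apply/measurable_EFinP; exact: mf_.
- exact/measurable_EFinP.
- by apply: filterS cf => p h hp; apply: cvg_EFin; [exact: nearW|exact: h].
- by apply: aeW => p n hp; rewrite /= lee_fin; exact: fg.
move=> fi _ h; split => //; rewrite /rint /Rintegral.
apply: fine_cvg; rewrite fineK; first exact: h.
by apply: integrable_fin_num => //; exact: measurable_hemi.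
Qed.

End HemisphereIntegral.

(** * The space of square-integrable functions *)

Section RealSequences.
Variable R : realType.

Lemma cvgn_geometric (x : nat -> R) (C : R) :
  (forall k, `|x k.+1 - x k| <= C / 2 ^+ k) -> cvgn x.
Proof.
move=> xC.
have h : cvgn (series (telescope x)).
  apply: normed_cvg; apply: (@series_le_cvg _ _ (geometric C 2^-1)).
  - by move=> n /=.
  - move=> n /=; rewrite exprVn.
    by apply: le_trans (normr_ge0 (x n.+1 - x n)) _; exact: xC.
  - by move=> n /=; rewrite exprVn; apply: xC.
  - by apply: is_cvg_geometric_series; rewrite ger0_norm// invf_lt1// ltr1n.
have -> : x = (fun n => x 0%N + series (telescope x) n).
  by apply/funext => n; exact: eq_sum_telescope.
by apply: is_cvgD => //; exact: is_cvg_cst.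
Qed.

End RealSequences.

Section SquareIntegrable.
Variable R : realType.
Notation plane := (measurableTypeR R * measurableTypeR R)%type.
Notation hemi := (@hemi R : set plane).
Notation leb2 := (@leb2 R).
Notation C := R[i].
Implicit Types (f g h : cfun R).

Lemma hemi_sin_gt0 (p : R * R) : hemi p -> 0 < sin p.1.
Proof. by case: p => x y /hemiP[hx _]; exact: sin_gt0_pihalf. Qed.

Lemma hemi_cos_gt0 (p : R * R) : hemi p -> 0 < cos p.1.
Proof.
case: p => x y /hemiP[/andP[x0 x1] _]; apply: cos_gt0_pihalf.
by rewrite x1 andbT (lt_trans _ x0)// oppr_lt0 divr_gt0// pi_gt0.
Qed.

Lemma vol_gt0 (p : R * R) : hemi p -> 0 < vol p.
Proof.
by move=> hp; rewrite /vol invr_gt0 divr_gt0// ?hemi_sin_gt0 ?hemi_cos_gt0.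
Qed.

Lemma hmeas_vol : hmeas (@vol R).
Proof.
apply: (@hmeas_x _ (fun x => (tan x)^-1)) => x; rewrite in_itv/= => /andP[x0 x1].
have hx : hemi (x, 0) by apply/hemiP; rewrite x0 x1 lexx mulrn_wgt0// pi_gt0.
have cx := hemi_cos_gt0 hx; have sx := hemi_sin_gt0 hx.
apply: continuousV; last by apply: continuous_tan; rewrite gt_eqF.
by rewrite gt_eqF// divr_gt0.
Qed.

Definition hmeasC f := hmeas (fun p => complex.Re (f p)) /\
                       hmeas (fun p => complex.Im (f p)).

Definition cintegrable f := rintegrable (fun p => complex.Re (f p) * vol p) /\
                       rintegrable (fun p => complex.Im (f p) * vol p).

Lemma integralCE f : integralC f = rint (fun p => complex.Re (f p) * vol p) +i*
  rint (fun p => complex.Im (f p) * vol p).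
Proof. by []. Qed.

Lemma integralC_lin (a : C) f g : cintegrable f -> cintegrable g ->
  integralC (fun p => a * f p + g p) = a * integralC f + integralC g.
Proof.
case: a => a1 a2 [f1 f2] [g1 g2]; rewrite !integralCE.
have -> : rint (fun p => complex.Re ((a1 +i* a2) * f p + g p) * vol p) =
   (a1 * rint (fun p => complex.Re (f p) * vol p) -
    a2 * rint (fun p => complex.Im (f p) * vol p)) +
   rint (fun p => complex.Re (g p) * vol p).
  rewrite -!rintZ// -rintB; [|exact: rintegrableZ..].
  rewrite -rintD//; last by apply: rintegrableB; exact: rintegrableZ.
  by apply: eq_rint => p _; case: (f p) (g p) => [x y] [z t] /=; ring.
have -> : rint (fun p => complex.Im ((a1 +i* a2) * f p + g p) * vol p) =
   (a1 * rint (fun p => complex.Im (f p) * vol p) +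
    a2 * rint (fun p => complex.Re (f p) * vol p)) +
   rint (fun p => complex.Im (g p) * vol p).
  rewrite -!rintZ// -rintD; [|exact: rintegrableZ..].
  rewrite -rintD//; last by apply: rintegrableD; exact: rintegrableZ.
  by apply: eq_rint => p _; case: (f p) (g p) => [x y] [z t] /=; ring.
by simpc; congr (_ +i* _); ring.
Qed.

Lemma eq_integralC f g : (forall p, hemi p -> f p = g p) ->
  integralC f = integralC g.
Proof.
by move=> fg; rewrite !integralCE; congr (_ +i* _); apply: eq_rint => p hp;
  rewrite fg.
Qed.


Lemma hmeas_sqmod f : hmeasC f -> hmeas (fun p => sqmod (f p)).
Proof.
by move=> [h1 h2]; apply: hmeasD; apply: hmeasM.
Qed.

Lemma sqintP f : square_integrable f <->
  hmeasC f /\ rintegrable (fun p => sqmod (f p) * vol p).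
Proof.
have pos p : hemi p -> 0 <= sqmod (f p) * vol p.
  by move=> /vol_gt0 /ltW hp; rewrite mulr_ge0 ?sqmod_ge0.
split=> [[h1 h2 h3]|[[h1 h2] /integrableP[_ h3]]].
  split=> //; apply/integrableP; split.
    apply/measurable_EFinP; apply: hmeasM; last exact: hmeas_vol.
    exact: hmeas_sqmod.
  apply: le_lt_trans h3; rewrite le_eqVlt; apply/orP; left; apply/eqP.
  by apply: eq_integral => p /[!inE] hp; rewrite gee0_abs// lee_fin pos.
split => //; apply: le_lt_trans h3; rewrite le_eqVlt; apply/orP; left; apply/eqP.
by apply: eq_integral => p /[!inE] hp; rewrite gee0_abs// lee_fin pos.
Qed.

Lemma hmeasC_lin (a : C) f g : hmeasC f -> hmeasC g ->
  hmeasC (fun p => a * f p + g p).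
Proof.
case: a => a1 a2 [f1 f2] [g1 g2]; split.
- apply: (eq_hmeas (f := fun p =>
    (a1 * complex.Re (f p) - a2 * complex.Im (f p)) + complex.Re (g p))).
    by move=> p _; case: (f p) (g p) => [x y] [z t].
  by apply: hmeasD => //; apply: hmeasB; apply: hmeasM => //; exact: hmeas_cst.
- apply: (eq_hmeas (f := fun p =>
    (a1 * complex.Im (f p) + a2 * complex.Re (f p)) + complex.Im (g p))).
    by move=> p _; case: (f p) (g p) => [x y] [z t].
  by apply: hmeasD => //; apply: hmeasD; apply: hmeasM => //; exact: hmeas_cst.
Qed.

Lemma sqint_lin (a : C) f g : square_integrable f -> square_integrable g ->
  square_integrable (a *: f + g).
Proof.
move=> /sqintP[mf sf] /sqintP[mg sg]; apply/sqintP.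
have m : hmeasC (a *: f + g) by exact: hmeasC_lin.
split=> //.
apply: (rintegrable_le (g := fun p => 2 * sqmod a * (sqmod (f p) * vol p) +
   2 * (sqmod (g p) * vol p))).
- by apply: hmeasM; [exact: hmeas_sqmod|exact: hmeas_vol].
- by apply: rintegrableD; apply: rintegrableZ.
move=> p hp; have v0 := vol_gt0 hp; rewrite ger0_norm; last by rewrite mulr_ge0 ?sqmod_ge0 ?ltW.
have -> : 2 * sqmod a * (sqmod (f p) * vol p) + 2 * (sqmod (g p) * vol p) =
  (2 * sqmod (a * f p) + 2 * sqmod (g p)) * vol p by rewrite sqmodM; ring.
by rewrite ler_pM2r//; exact: sqmodD_le.
Qed.

Lemma sqint0 : square_integrable (0 : cfun R).
Proof.
apply/sqintP; split; first by split; exact: hmeas_cst.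
apply: (eq_rintegrable (f := fun=> 0)); last exact: rintegrable0.
by move=> p _; rewrite sqmod0 mul0r.
Qed.

Lemma hmeasC_mulconj f g : hmeasC f -> hmeasC g ->
  hmeasC (fun p => f p * conjc (g p)).
Proof.
move=> [f1 f2] [g1 g2]; split.
- apply: (eq_hmeas (f := fun p =>
    complex.Re (f p) * complex.Re (g p) + complex.Im (f p) * complex.Im (g p))).
    by move=> p _; case: (f p) (g p) => [x y] [z t] /=; ring.
  by apply: hmeasD; apply: hmeasM.
- apply: (eq_hmeas (f := fun p =>
    complex.Im (f p) * complex.Re (g p) - complex.Re (f p) * complex.Im (g p))).
    by move=> p _; case: (f p) (g p) => [x y] [z t] /=; ring.
  by apply: hmeasB; apply: hmeasM.
Qed.

Lemma cintegrable_le f (g : R * R -> R) : hmeasC f ->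
  rintegrable (fun p => g p * vol p) ->
  (forall p, hemi p -> `|complex.Re (f p)| <= g p /\ `|complex.Im (f p)| <= g p) ->
  cintegrable f.
Proof.
move=> [m1 m2] ig fg; split.
  apply: rintegrable_le ig _; first by apply: hmeasM => //; exact: hmeas_vol.
  move=> p hp; have v0 := vol_gt0 hp.
  by rewrite normrM (gtr0_norm v0) ler_pM2r//; have [] := fg p hp.
apply: rintegrable_le ig _; first by apply: hmeasM => //; exact: hmeas_vol.
move=> p hp; have v0 := vol_gt0 hp.
by rewrite normrM (gtr0_norm v0) ler_pM2r//; have [] := fg p hp.
Qed.

Lemma mulconj_le (z w : C) :
  `|complex.Re (z * conjc w)| <= sqmod z + sqmod w /\
  `|complex.Im (z * conjc w)| <= sqmod z + sqmod w.
Proof.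
case: z w => [a b] [c d]; rewrite /sqmod /=.
have := sqr_ge0 (a - c); have := sqr_ge0 (a + c); have := sqr_ge0 (b - d).
have := sqr_ge0 (b + d); have := sqr_ge0 (a - d); have := sqr_ge0 (a + d).
have := sqr_ge0 (b - c); have := sqr_ge0 (b + c).
by split; rewrite ler_norml; apply/andP; split; nra.
Qed.

Lemma sqint_mulconj f g : square_integrable f -> square_integrable g ->
  cintegrable (fun p => f p * conjc (g p)).
Proof.
move=> /sqintP[mf sf] /sqintP[mg sg].
apply: (cintegrable_le (g := fun p => sqmod (f p) + sqmod (g p))).
- exact: hmeasC_mulconj.
- by apply: (eq_rintegrable _ (rintegrableD sf sg)) => p _; rewrite [RHS]mulrDl.
- by move=> p _; exact: mulconj_le.
Qed.

Lemma inner_lin (a : C) f g h : square_integrable f -> square_integrable g ->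
  square_integrable h -> inner (a *: f + g) h = a * inner f h + inner g h.
Proof.
move=> Lf Lg Lh; rewrite /inner -integralC_lin; [|exact: sqint_mulconj..].
by apply: eq_integralC => p _; rewrite mulrA -mulrDl.
Qed.

Lemma inner_conj f g : square_integrable f -> square_integrable g ->
  inner g f = conjc (inner f g).
Proof.
move=> Lf Lg; have [h1 h2] := sqint_mulconj Lf Lg.
rewrite /inner !integralCE /=; congr (_ +i* _).
  by apply: eq_rint => p _; case: (f p) (g p) => [x y] [z t] /=; ring.
rewrite -mulN1r -rintZ//.
by apply: eq_rint => p _; case: (f p) (g p) => [x y] [z t] /=; ring.
Qed.

Lemma inner_ge0 f : square_integrable f -> 0 <= complex.Re (inner f f).
Proof.
move=> Lf; rewrite /inner integralCE /=; apply: rint_ge0 => p hp.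
have -> : complex.Re (f p * conjc (f p)) = sqmod (f p) by rewrite -sqmodE.
by rewrite mulr_ge0 ?sqmod_ge0// ltW// vol_gt0.
Qed.

Lemma nsq_inner f : nsq (@inner R) f = rint (fun p => sqmod (f p) * vol p).
Proof.
by rewrite /nsq /inner integralCE /=; apply: eq_rint => p hp; rewrite -sqmodE.
Qed.

Lemma norm2E f : norm2 f = Num.sqrt (nsq (@inner R) f).
Proof. by rewrite nsq_inner. Qed.

Lemma nsq_ge0 f : 0 <= nsq (@inner R) f.
Proof.
rewrite nsq_inner; apply: rint_ge0 => p hp.
by rewrite mulr_ge0 ?sqmod_ge0// ltW// vol_gt0.
Qed.

Lemma nsq_eq0 f : square_integrable f -> nsq (@inner R) f = 0 <-> ae_equal f (fun=> 0).
Proof.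
move=> /sqintP[mf sf]; have := sf => /integrableP[mfv _].
have pos p : hemi p -> 0 <= sqmod (f p) * vol p.
  by move=> /vol_gt0 /ltW hp; rewrite mulr_ge0 ?sqmod_ge0.
have E : (\int[leb2]_(p in hemi) `|(sqmod (f p) * vol p)%:E| = (nsq (@inner R) f)%:E)%E.
  rewrite nsq_inner /rint /Rintegral fineK; last first.
    by apply: integrable_fin_num => //; exact: measurable_hemi.
  by apply: eq_integral => p /[!inE] hp; rewrite gee0_abs// lee_fin pos.
have := ae_eq_integral_abs leb2 (@measurable_hemi R) mfv; rewrite [X in X = _ <-> _]E.
move=> [h1 h2]; split=> [f0|ae0].
  have /h1 : (nsq (@inner R) f)%:E = 0%E by rewrite f0.
  apply: filterS => p hp Hp; have := hp Hp => /= -[] /eqP.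
  by rewrite mulf_eq0 (gt_eqF (vol_gt0 Hp)) orbF => /eqP /sqmod_eq0.
have : (nsq (@inner R) f)%:E = 0%E; last by case.
apply: h2; apply: filterS ae0 => p hp Hp /=.
by rewrite hp// sqmod0 mul0r.
Qed.

Lemma sqint_ae f g : square_integrable f -> square_integrable g ->
  nsq (@inner R) (f - g) = 0 <-> ae_equal f g.
Proof.
move=> Lf Lg; have Ld : square_integrable (f - g).
  by apply: (L_sub sqint0 sqint_lin).
rewrite nsq_eq0//; split; apply: filterS => p h hp.
  by have /eqP := h hp; rewrite subr_eq0 => /eqP.
by have := h hp => /eqP; rewrite -subr_eq0 => /eqP.
Qed.

End SquareIntegrable.

(** * Completeness of the weighted L^2 space *)

Section Completeness.
Variable R : realType.
Notation plane := (measurableTypeR R * measurableTypeR R)%type.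
Notation hemi := (@hemi R : set plane).
Notation leb2 := (@leb2 R).
Notation C := R[i].
Notation nsq := (nsq (@inner R)).
Notation L := (@square_integrable R).

Lemma sqmod_cvg (x y : nat -> R) (a b : R) (z : C) :
  x @ \oo --> a -> y @ \oo --> b ->
  (fun k => sqmod (z - (x k +i* y k))) @ \oo --> sqmod (z - (a +i* b)).
Proof.
move=> xa yb; case: z => z1 z2; rewrite /sqmod /=.
by apply: cvgD; rewrite expr2; under eq_fun do rewrite expr2; apply: cvgM;
  apply: cvgB => //; exact: cvg_cst.
Qed.

Lemma sqint_sub f g : L f -> L g -> L (f - g).
Proof. exact: (L_sub (sqint0 R) (@sqint_lin R)). Qed.

Lemma limn_einf_le_cst (u : nat -> \bar R) (e : \bar R) :
  (forall n, (u n <= e)%E) -> (limn_einf u <= e)%E.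
Proof.
move=> ue; rewrite limn_einf_lim; apply: lime_le; first exact: is_cvg_einfs.
apply: nearW => n; apply: le_trans (ue n); apply: ereal_inf_lbound.
by exists n => /=.
Qed.

(** Fatou's lemma off the null set [N]; one estimate of the integral of the limit yields both its
    square integrability and the bound. *)
Lemma sqint_fatou (f : nat -> cfun R) (h : cfun R) (N : set plane) (e : R) :
  (forall k, L (f k)) -> hmeasC h -> measurable N -> leb2 N = 0%E ->
  (forall p, hemi p -> ~ N p -> (fun k => sqmod (f k p)) @ \oo --> sqmod (h p)) ->
  (forall k, nsq (f k) <= e) -> L h /\ nsq h <= e.
Proof.
move=> Lf mh mN N0 fh fe.
have pos (g : cfun R) p : hemi p -> 0 <= sqmod (g p) * vol p.
  by move=> /vol_gt0 /ltW hp; rewrite mulr_ge0 ?sqmod_ge0.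
have mE (g : cfun R) : hmeasC g ->
    measurable_fun hemi (fun p => (sqmod (g p) * vol p)%:E).
  move=> mg; apply/measurable_EFinP; apply: hmeasM; last exact: hmeas_vol.
  exact: hmeas_sqmod.
have mf k : hmeasC (f k) by case/sqintP: (Lf k).
pose D := hemi `\` N.
have mD : measurable D by apply: measurableD => //; exact: measurable_hemi.
have DH : D `<=` hemi by move=> p [].
have IE (g : cfun R) : L g -> (\int[leb2]_(p in hemi) (sqmod (g p) * vol p)%:E = (nsq g)%:E)%E.
  move=> /sqintP[_ ig]; rewrite nsq_inner /rint /Rintegral fineK//.
  by apply: integrable_fin_num => //; exact: measurable_hemi.
have ID (g : cfun R) : hmeasC g -> (\int[leb2]_(p in D) (sqmod (g p) * vol p)%:E =
    \int[leb2]_(p in hemi) (sqmod (g p) * vol p)%:E)%E.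
  move=> mg; apply/esym; apply: ge0_negligible_integral => //.
  - exact: measurable_hemi.
  - exact: mE.
  - by move=> p hp; rewrite lee_fin pos.
have le_e : (\int[leb2]_(p in hemi) (sqmod (h p) * vol p)%:E <= e%:E)%E.
  rewrite -ID//.
  pose F k (p : plane) := (sqmod (f k p) * vol p)%:E.
  have -> : (\int[leb2]_(p in D) (sqmod (h p) * vol p)%:E =
     \int[leb2]_(p in D) limn_einf (F^~ p))%E.
    apply: eq_integral => p /[!inE] -[hp Np].
    have cv : F ^~ p @ \oo --> (sqmod (h p) * vol p)%:E.
      apply: cvg_EFin; first exact: nearW.
      by apply: cvgM; [exact: fh|exact: cvg_cst].
    apply/esym; rewrite is_cvg_limn_einfE; first exact/cvg_lim.
    by apply/cvg_ex; eexists; exact: cv.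
  apply: le_trans (fatou leb2 mD _ _) _.
  - move=> k; apply: measurable_funS (mE _ (mf k)) => //.
    exact: measurable_hemi.
  - by move=> k p /DH hp; rewrite lee_fin pos.
  - by apply: limn_einf_le_cst => k; rewrite ID// IE// lee_fin.
have Lh : L h.
  split; [by case: mh|by case: mh|].
  by apply: le_lt_trans le_e _; rewrite ltry.
by split => //; rewrite -lee_fin -IE.
Qed.

(** A fast subsequence [v] has nsq (v k.+1 - v k) < 8^-k = 4^-k 2^-k. The series of these integrands
    weighted by 4^k has finite integral, hence is finite almost everywhere, and there |v k.+1 - v k|
    is at most a constant times 2^-k. So [v] converges pointwise almost everywhere, and Fatou turns
    this into convergence in norm of the whole sequence. *)
Lemma sqint_complete (w : nat -> cfun R) : (forall j, L (w j)) ->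
  (forall e : R, 0 < e -> exists N, forall j l, (N <= j)%N -> (N <= l)%N ->
    nsq (w j - w l) < e) ->
  exists2 u, L u & (fun j => nsq (w j - u)) @ \oo --> (0 : R).
Proof.
move=> Lw wC.
have /boolp.choice[N hN] : forall k, exists N, forall j l,
    (N <= j)%N -> (N <= l)%N -> nsq (w j - w l) < (8 ^+ k)^-1.
  by move=> k; apply: wC; rewrite invr_gt0 exprn_gt0.
(* Cumulative sums make the indices nondecreasing while keeping [n_ k] at least [N k]. *)
pose n_ k := (k + \sum_(i < k.+1) N i)%N.
have n_ge k : (N k <= n_ k)%N.
  by rewrite /n_ big_ord_recr/= addnA leq_addl.
have n_mono k : (n_ k <= n_ k.+1)%N.
  by rewrite /n_ [X in (_ <= _ + X)%N]big_ord_recr/= addSn addnA ltnW// ltnS leq_addr.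
pose v k := w (n_ k).
have Lv k : L (v k) by exact: Lw.
have dv k : nsq (v k.+1 - v k) < (8 ^+ k)^-1.
  by apply: hN; rewrite ?n_ge// (leq_trans (n_ge k)).
pose g k (p : R * R) : R := 4 ^+ k * (sqmod ((v k.+1 - v k) p) * vol p).
have Ld k : L (v k.+1 - v k) by exact: sqint_sub.
have g0 k p : hemi p -> 0 <= g k p.
  move=> /vol_gt0 /ltW hp.
  by rewrite mulr_ge0 ?exprn_ge0// mulr_ge0 ?sqmod_ge0.
have ig k : rintegrable (g k) by apply: rintegrableZ; case/sqintP: (Ld k).
(* 2 / 2^(k+1) is 2^-k in the shape of [epsilon_trick], which bounds the sum of the series by 2. *)
have intg k : (\int[leb2]_(p in hemi) (g k p)%:E <= (2 / (2 ^ k.+1)%:R)%:E)%E.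
  have -> : (\int[leb2]_(p in hemi) (g k p)%:E = (rint (g k))%:E)%E.
    rewrite /rint /Rintegral fineK//.
    exact: (integrable_fin_num (@measurable_hemi R) (ig k)).
  rewrite rintZ; last by case/sqintP: (Ld k).
  rewrite -nsq_inner lee_fin.
  have -> : 2 / (2 ^ k.+1)%:R = 4 ^+ k * (8 ^+ k)^-1 :> R.
    rewrite natrX exprS -exprVn -exprMn invfM mulrA divff// mul1r -exprVn.
    by congr (_ ^+ _); field.
  by rewrite ler_pM2l ?exprn_gt0//; exact/ltW.
have mg k : measurable_fun hemi (EFin \o g k).
  by apply/measurable_EFinP; exact: rintegrable_measurable.
pose S p := (\sum_(k <oo) (g k p)%:E)%E.
have S0 p : hemi p -> (0 <= S p)%E.
  by move=> hp; apply: nneseries_ge0 => k _ _; rewrite lee_fin g0.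
have iS : leb2.-integrable hemi S.
  apply/integrableP; split.
    apply: ge0_emeasurable_sum => //; first by move=> k x hx _; rewrite lee_fin g0.
    by move=> k _; exact: mg.
  have -> : (\int[leb2]_(p in hemi) `|S p| = \int[leb2]_(p in hemi) S p)%E.
    by apply: eq_integral => p /[!inE] hp; rewrite gee0_abs// S0.
  rewrite integral_nneseries; last 3 first.
  - exact: measurable_hemi.
  - exact: mg.
  - by move=> k p hp; rewrite lee_fin g0.
  have := @epsilon_trick R (fun=> 0%E) 2 xpredT (fun=> lexx _).
  rewrite [X in (_ <= X + _)%E]eseries0// add0e => H.
  apply: (@le_lt_trans _ _ 2%:E); last by rewrite ltry.
  apply: le_trans (H _) => //; apply: lee_nneseries => [k _ _|k _].
    by apply: integral_ge0 => p hp; rewrite lee_fin g0.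
  by rewrite add0e; exact: intg.
have [A [mA A0 SA]] := integrable_ae (@measurable_hemi R) iS.
have bound p : hemi p -> ~ A p -> exists c, forall k, sqmod (v k.+1 p - v k p) <= (c / 2 ^+ k) ^+ 2.
  move=> hp nA; have fS : S p \is a fin_num.
    by apply: contrapT => nf; apply/nA/SA => /(_ hp).
  exists (Num.sqrt (fine (S p) / vol p)) => k.
  have v0 := vol_gt0 hp.
  have gk : g k p <= fine (S p).
    rewrite -lee_fin fineK//; apply: (@le_trans _ _ (\sum_(i < k.+1) (g i p)%:E)%E).
      by rewrite big_ord_recr/= leeDr// sume_ge0// => i _; rewrite lee_fin g0.
    rewrite -(big_mkord xpredT (fun i => (g i p)%:E)); apply: nneseries_lim_ge => i _.
    by move=> _; rewrite lee_fin g0.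
  rewrite exprMn sqr_sqrtr; last first.
    by apply: divr_ge0; [apply: fine_ge0; exact: S0|exact: ltW].
  move: gk; rewrite /g; set s := sqmod _ => gk.
  have -> : ((2 ^+ k)^-1 : R) ^+ 2 = (4 ^+ k)^-1.
    by rewrite -!exprVn -exprM mulnC exprM; congr (_ ^+ _); field.
  by rewrite ler_pdivlMr ?exprn_gt0// ler_pdivlMr// (mulrC s) -mulrA.
(* Multiplication by the indicator of the complement of the null set makes the sequences converge at
   every point of the hemisphere, so that their limits are measurable. *)
pose ind p : R := \1_(~` A) p.
have mind : hmeas ind by apply: measurable_indic; exact: measurableC.
pose x k p := complex.Re (v k p) * ind p.
pose y k p := complex.Im (v k p) * ind p.
have mx k : hmeas (x k) by apply: hmeasM => //; case: (Lv k).
have my k : hmeas (y k) by apply: hmeasM => //; case: (Lv k).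
have cx p : hemi p -> cvgn (x ^~ p).
  move=> hp; rewrite /x /ind indicE; case: (boolP (p \in ~` A)) => [/[!inE] nA|_].
    have [c hc] := bound _ hp nA; apply: (@cvgn_geometric _ _ `|c|) => k.
    rewrite !mulr1 -(@ler_pXn2r _ 2)// ?nnegrE ?divr_ge0 ?exprn_ge0//.
    rewrite real_normK ?num_real// [leRHS]exprMn real_normK ?num_real// -exprMn.
    by apply: le_trans (hc k); case: (v k.+1 p) (v k p) => [a b] [a' b'];
      rewrite /sqmod /= lerDl sqr_ge0.
  by under eq_fun do rewrite mulr0n mulr0; exact: is_cvg_cst.
have cy p : hemi p -> cvgn (y ^~ p).
  move=> hp; rewrite /y /ind indicE; case: (boolP (p \in ~` A)) => [/[!inE] nA|_].
    have [c hc] := bound _ hp nA; apply: (@cvgn_geometric _ _ `|c|) => k.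
    rewrite !mulr1 -(@ler_pXn2r _ 2)// ?nnegrE ?divr_ge0 ?exprn_ge0//.
    rewrite real_normK ?num_real// [leRHS]exprMn real_normK ?num_real// -exprMn.
    by apply: le_trans (hc k); case: (v k.+1 p) (v k p) => [a b] [a' b'];
      rewrite /sqmod /= lerDr sqr_ge0.
  by under eq_fun do rewrite mulr0n mulr0; exact: is_cvg_cst.
pose u : cfun R := fun p => limn (x ^~ p) +i* limn (y ^~ p).
have mU : hmeasC u.
  by split; apply: measurable_fun_cvg; [exact: mx|exact: cx|exact: my|exact: cy].
have close j e : (exists K, forall k, (K <= k)%N -> nsq (w j - v k) <= e) ->
    L (w j - u) /\ nsq (w j - u) <= e.
  move=> [K hK].
  apply: (@sqint_fatou (fun k => w j - v (k + K)%N) _ A) => //.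
  - by move=> k; exact: sqint_sub.
  - have mw : hmeasC (w j) by case: (Lw j).
    have := @hmeasC_lin _ (-1) _ _ mU mw.
    suff -> : (fun p => -1 * u p + w j p) = w j - u by [].
    by apply/funext => p; rewrite mulN1r addrC.
  - move=> p hp nA.
    have E k : v k p = x k p +i* y k p.
      rewrite /x /y /ind indicE mem_set//; case: (v k p) => a b /=.
      by rewrite !mulr1.
    have := @sqmod_cvg _ _ _ _ (w j p) (cx _ hp) (cy _ hp).
    rewrite -(cvg_shiftn K) => h.
    suff -> : (fun k => sqmod ((w j - v (k + K)%N) p)) =
      (fun k => sqmod (w j p - (x (k + K)%N p +i* y (k + K)%N p))) by exact: h.
    by apply/funext => k; rewrite -E.
  - by move=> k; apply: hK; rewrite leq_addl.
have near e : 0 < e -> exists M, forall j, (M <= j)%N -> L (w j - u) /\ nsq (w j - u) <= e.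
  move=> e0; have [M hM] := wC _ e0; exists M => j Mj; apply: close.
  by exists M => k Mk; apply/ltW/hM => //; rewrite (leq_trans Mk)// leq_addr.
exists u.
  have [M hM] := near 1 ltr01; have [Lwu _] := hM M (leqnn M).
  have -> : u = w M - (w M - u) by rewrite opprB addrC subrK.
  exact: sqint_sub.
apply/cvgrPdist_le => e e0; have [M hM] := near e e0; exists M => // j /= Mj.
by rewrite sub0r normrN ger0_norm ?nsq_ge0//; case: (hM j Mj).
Qed.

End Completeness.

(** * The hypergeometric polynomials *)

Section HypergeometricPolynomial.
Variables (R : realType) (m : R).
Hypothesis m0 : 0 <= m.

Definition hcoef (n j : nat) : R :=
  pochhammer (- n%:R) j * pochhammer (n%:R + m) j /
  (pochhammer (1 + m) j * j`!%:R).

Definition hpoly (n : nat) : {poly R} := \poly_(j < n.+1) hcoef n j.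

Lemma pochhammerS (a : R) j : pochhammer a j.+1 = pochhammer a j * (a + j%:R).
Proof. by rewrite /pochhammer big_ord_recr. Qed.

Lemma pochhammer0 (a : R) : pochhammer a 0 = 1.
Proof. by rewrite /pochhammer big_ord0. Qed.

Lemma pochhammer_neq0 (a : R) j : 0 < a -> pochhammer a j != 0.
Proof.
move=> a0; elim: j => [|j IH]; first by rewrite pochhammer0 oner_eq0.
by rewrite pochhammerS mulf_neq0// gt_eqF// ltr_wpDr.
Qed.

Lemma pochhammerN_eq0 n j : (n < j)%N -> pochhammer (- n%:R : R) j = 0.
Proof.
by move=> nj; rewrite /pochhammer (bigD1 (Ordinal nj))//= addNr mul0r.
Qed.

Lemma pochhammerN_neq0 n j : (j <= n)%N -> pochhammer (- n%:R : R) j != 0.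
Proof.
elim: j => [_|j IH jn]; first by rewrite pochhammer0 oner_eq0.
rewrite pochhammerS mulf_neq0 ?IH//; first exact: ltnW.
by rewrite addrC subr_eq0 eqr_nat ltn_eqF.
Qed.

Lemma hcoef_gt n j : (n < j)%N -> hcoef n j = 0.
Proof. by move=> nj; rewrite /hcoef pochhammerN_eq0// !mul0r. Qed.

Lemma coef_hpoly n j : (hpoly n)`_j = hcoef n j.
Proof. by rewrite coef_poly ltnS; case: leqP => // /hcoef_gt. Qed.

Lemma hcoef0 n : hcoef n 0 = 1.
Proof. by rewrite /hcoef !pochhammer0 fact0 !mulr1 divr1. Qed.

(** The ratio of consecutive coefficients cleared of denominators; in this shape it also holds from
    the degree on, where both sides vanish. *)
Lemma hcoefS n j : hcoef n j.+1 * (j.+1%:R * (j.+1%:R + m)) =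
  hcoef n j * ((j%:R - n%:R) * (n%:R + m + j%:R)).
Proof.
have p0 : pochhammer (1 + m) j != 0 by rewrite pochhammer_neq0// ltr_wpDr.
have f0 : j`!%:R != 0 :> R by rewrite pnatr_eq0 -lt0n fact_gt0.
rewrite /hcoef !pochhammerS factS natrM -natr1; field.
rewrite f0 p0 /=; apply/andP; split; rewrite gt_eqF//.
by rewrite ltr_wpDr// ltr_wpDr.
Qed.

Lemma hcoef_neq0 n : (0 < n)%N -> hcoef n n != 0.
Proof.
move=> n0; rewrite /hcoef !mulf_neq0 ?pochhammerN_neq0 ?pochhammer_neq0//.
  by rewrite ltr_wpDr// ltr0n.
by rewrite invr_eq0 mulf_neq0 ?pochhammer_neq0 ?ltr_wpDr// pnatr_eq0 -lt0n fact_gt0.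
Qed.

Lemma hypergeometricE n z :
  hypergeometric (- n%:R) (n%:R + m) (1 + m) z = (hpoly n).[z].
Proof.
rewrite horner_poly; apply/cvg_lim => //; apply: cvg_near_cst.
exists n.+1 => // N /= nN; rewrite seriesEord /= .
rewrite -(big_mkord xpredT (fun j => hcoef n j * z ^+ j)).
rewrite -(big_mkord xpredT (fun j => hcoef n j * z ^+ j)).
rewrite (big_cat_nat (n := n.+1))//= [X in _ + X = _]big1_seq ?addr0// => j.
by rewrite mem_index_iota => /andP[_ /andP[nj _]]; rewrite hcoef_gt ?mul0r.
Qed.

Lemma poly_ode_coef (p : {poly R}) (c : R) j :
  ('X * (1 - 'X) * p^`()^`() + (1 + m)%:P * (1 - 'X) * p^`() + c%:P * p)`_j =
  p`_j.+1 * (j.+1%:R * (j.+1%:R + m)) - p`_j * (j%:R * (j%:R + m)) + c * p`_j.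
Proof.
have -> : 'X * (1 - 'X) * p^`()^`() + (1 + m)%:P * (1 - 'X) * p^`() + c%:P * p =
  'X * p^`()^`() - 'X * ('X * p^`()^`()) + ((1 + m)%:P * p^`() -
   (1 + m)%:P * ('X * p^`())) + c%:P * p.
  by rewrite !mulrBr !mulr1 !mulrBl -!mulrA.
rewrite !(coefD, coefB, coefN, coefCM, coefXM).
case: j => [|[|j]]; rewrite /= ?coefXM/= !coef_deriv.
- ring.
- ring.
- ring.
Qed.

(** Gauss's equation with parameters a = -n, b = n + m, c = 1 + m. Since a + b + 1 = c, the
    first-order coefficient c - (a + b + 1) X factors as c (1 - X). *)
Lemma hpoly_ode n : 'X * (1 - 'X) * (hpoly n)^`()^`() +
  (1 + m)%:P * (1 - 'X) * (hpoly n)^`() + (n%:R * (n%:R + m))%:P * hpoly n = 0.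
Proof.
apply/polyP => j; rewrite coef0 poly_ode_coef !coef_hpoly hcoefS; ring.
Qed.

Lemma hpoly0 n : (hpoly n).[0] = 1.
Proof. by rewrite horner_coef0 coef_hpoly hcoef0. Qed.

(** At 1 the differential equation loses both derivative terms. *)
Lemma hpoly1 n : (0 < n)%N -> (hpoly n).[1] = 0.
Proof.
move=> n0; have := congr1 (fun p => p.[1]) (hpoly_ode n).
rewrite !hornerE subrr !(mulr0, mul0r) !add0r => /eqP; rewrite mulf_eq0.
by rewrite gt_eqF/= => [/eqP//|]; rewrite mulr_gt0 ?ltr0n ?ltr_wpDr ?ltr0n.
Qed.

(** [hpoly n] has degree exactly [n] for [n > 0], so a multiple of it removes the leading term of
    [p] without leaving the polynomials vanishing at 1; a constant vanishing at 1 is 0. *)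
Lemma hpoly_ind (P : {poly R} -> Prop) : P 0 ->
  (forall a p q, P p -> P q -> P (a *: p + q)) ->
  (forall n, (0 < n)%N -> P (hpoly n)) -> forall p, p.[1] = 0 -> P p.
Proof.
move=> P0 Plin Ph p; have [N] := ubnP (size p); elim: N p => // N IH p.
rewrite ltnS => sp p1.
case: (leqP (size p) 1) => [/size1_polyC pC|s1].
  by move: p1; rewrite pC hornerC => ->.
set n := (size p).-1; have n0 : (0 < n)%N by rewrite /n; case: (size p) s1 => [|[]].
set a := lead_coef p / hcoef n n.
have -> : p = a *: hpoly n + (p - a *: hpoly n) by rewrite addrC subrK.
apply: Plin; first exact: Ph.
apply: IH; last by rewrite !hornerE p1 hpoly1// mulr0 subr0.
apply: leq_trans sp; rewrite -(prednK (ltnW s1)) -/n ltnS.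
apply/leq_sizeP => j nj; rewrite coefB coefZ coef_hpoly.
move: nj; rewrite leq_eqVlt => /predU1P[<-|nj].
  by rewrite /a divfK ?hcoef_neq0// subrr.
rewrite hcoef_gt// mulr0 subr0 nth_default//.
by rewrite -(prednK (ltnW s1)).
Qed.

End HypergeometricPolynomial.

(** * Derivatives and smooth functions of one variable *)

Section Derivatives.
Variable R : realType.
Implicit Types (f g : R -> R) (x : R) (a b : R) (U V : set R).

Definition isd x f a := is_derive x (1 : R) f a.

Lemma isd_eq x f a b : isd x f a -> a = b -> isd x f b.
Proof. by move=> h <-. Qed.

Lemma isd_cst x (c : R) : isd x (fun=> c) 0.
Proof. exact: is_derive_cst. Qed.

Lemma isd_id x : isd x id 1.
Proof. exact: is_derive_id. Qed.

Lemma isdD x f g a b : isd x f a -> isd x g b -> isd x (fun t => f t + g t) (a + b).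
Proof. exact: is_deriveD. Qed.

Lemma isdB x f g a b : isd x f a -> isd x g b -> isd x (fun t => f t - g t) (a - b).
Proof. exact: is_deriveB. Qed.

Lemma isdM x f g a b : isd x f a -> isd x g b ->
  isd x (fun t => f t * g t) (a * g x + f x * b).
Proof.
move=> fa gb; have := is_deriveM fa gb; move/isd_eq; apply.
by rewrite /= addrC; congr (_ + _); rewrite mulrC.
Qed.

Lemma isd_comp x f g a b : isd (g x) f a -> isd x g b ->
  isd x (fun t => f (g t)) (a * b).
Proof. exact: is_derive1_comp. Qed.

Lemma isdV x f a : f x != 0 -> isd x f a ->
  isd x (fun t => (f t)^-1) (- a / f x ^+ 2).
Proof.
move=> f0 fa; apply: isd_eq (is_deriveV f0 fa) _.
by rewrite [LHS]mulNr [RHS]mulNr [in RHS]mulrC.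
Qed.

Lemma isdX x f a k : isd x f a -> isd x (fun t => f t ^+ k) (k%:R * f x ^+ k.-1 * a).
Proof.
move=> fa; have := is_deriveX k fa.
suff -> : f ^+ k = (fun t => f t ^+ k) by [].
by elim: k => [//|k IH]; rewrite exprS IH; apply/funext => t; rewrite exprS.
Qed.

Lemma isd_cont x f a : isd x f a -> {for x, continuous f}.
Proof.
by move=> [fa _]; apply: differentiable_continuous; apply/derivable1_diffP.
Qed.

Lemma isd_near x f g a : (\forall y \near x, f y = g y) -> isd x f a -> isd x g a.
Proof. exact: near_eq_is_derive. Qed.

Lemma isd_unique x f a b : isd x f a -> isd x f b -> a = b.
Proof. by move=> [_ <-] [_ <-]. Qed.

Lemma isd_open U x f g a : open U -> U x -> (forall y, U y -> f y = g y) ->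
  isd x f a -> isd x g a.
Proof.
move=> oU Ux fg; apply: isd_near; have : nbhs x U by exact: open_nbhs_nbhs.
by apply: filterS => y /fg.
Qed.

Lemma isd_quadratic x f c : (forall h, `|f (x + h) - f x| <= c * h ^+ 2) ->
  isd x f 0.
Proof.
move=> fc.
have c0 : 0 <= c.
  have := fc 1; rewrite expr1n mulr1; exact: le_trans.
have lim0 : (fun h : R => h^-1 *: ((f \o shift x) (h *: 1) - f x)) @ 0^' --> (0 : R).
  apply/cvgr0Pnorm_lt => e e0.
  have d0 : 0 < e / (c + 1) by rewrite divr_gt0// ltr_wpDl.
  near=> h.
  have h0 : h != 0 by near: h; exact: nbhs_dnbhs_neq.
  have he : `|h| < e / (c + 1).
    near: h; apply: dnbhs0_lt; exact: d0.
  rewrite /= [h%:A]mulr1 (addrC h) normrM normfV ltr_pdivrMl ?normr_gt0//.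
  apply: le_lt_trans (fc h) _; rewrite -real_normK ?num_real// expr2 mulrA mulrC.
  rewrite ltr_pM2l ?normr_gt0//; apply: (@le_lt_trans _ _ ((c + 1) * `|h|)).
    by rewrite ler_wpM2r// lerDl.
  by rewrite -ltr_pdivlMl ?ltr_wpDl// mulrC.
by apply: DeriveDef; [apply/cvg_ex; exists 0|exact/cvg_lim].
Unshelve. all: by end_near. Qed.

(** Derivatives are witnesses constrained only at points of [U]: local formulas suffice, and pieces
    given on two open sets can be glued ([CnOnU]). *)
Fixpoint CnOn n U f : Prop := (forall x, U x -> {for x, continuous f}) /\
  if n is k.+1 then
    exists2 g, (forall x, U x -> isd x f (g x)) & CnOn k U g
  else True.

Lemma CnOn_eq n U f g : open U -> (forall x, U x -> f x = g x) ->
  CnOn n U f -> CnOn n U g.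
Proof.
move=> oU fg; have cfg : (forall x, U x -> {for x, continuous f}) ->
    forall x, U x -> {for x, continuous g}.
  move=> cf x Ux; have nU : nbhs x U by exact: open_nbhs_nbhs.
  rewrite /prop_for /continuous_at -fg//; apply: cvg_trans (cf x Ux).
  by apply: near_eq_cvg; apply: filterS nU => y Uy; rewrite fg.
case: n => [|n] /= [cf h]; split; try exact: cfg; first by [].
case: h => f' df' cf'; exists f' => // x Ux.
exact: (isd_open oU Ux fg (df' _ Ux)).
Qed.

Lemma CnOnW n U f : CnOn n.+1 U f -> CnOn n U f.
Proof.
elim: n f => [|n IH] f [cf [f' df' cf']]; split => //.
by exists f' => //; apply: IH.
Qed.

Lemma CnOn_sub n U V f : U `<=` V -> CnOn n V f -> CnOn n U f.
Proof.
move=> UV; elim: n f => [|n IH] f [cf h]; split => //; try by move=> x /UV; exact: cf.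
by case: h => f' df' cf'; exists f'; [move=> x /UV; exact: df'|exact: IH].
Qed.

Lemma CnOn_derive n U f g : (forall x, U x -> isd x f (g x)) -> CnOn n U g ->
  CnOn n.+1 U f.
Proof.
move=> fg cg; split; last by exists g.
by move=> x Ux; apply: isd_cont (fg _ Ux).
Qed.

Lemma CnOn_cst n U c : CnOn n U (fun=> c).
Proof.
elim: n c => [|n IH] c; split => //; try by move=> x _; exact: cst_continuous.
by exists (fun=> 0) => // x _; exact: isd_cst.
Qed.

Lemma CnOnD n U f g : CnOn n U f -> CnOn n U g -> CnOn n U (fun x => f x + g x).
Proof.
elim: n f g => [|n IH] f g [cf hf] [cg hg]; split => //;
  try by move=> x Ux; apply: cvgD; [exact: cf|exact: cg].
case: hf hg => [f' df cf'] [g' dg cg'].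
exists (fun x => f' x + g' x); last exact: IH.
by move=> x Ux; apply: isdD; [exact: df|exact: dg].
Qed.

Lemma CnOnM n U f g : CnOn n U f -> CnOn n U g -> CnOn n U (fun x => f x * g x).
Proof.
elim: n f g => [|n IH] f g hf hg; have [cf df] := hf; have [cg dg] := hg;
  split => //; try by move=> x Ux; apply: cvgM; [exact: cf|exact: cg].
case: df dg => [f' df cf'] [g' dg cg'].
exists (fun x => f' x * g x + f x * g' x).
  by move=> x Ux; apply: isdM; [exact: df|exact: dg].
by apply: CnOnD; apply: IH => //; exact: CnOnW.
Qed.

Lemma CnOn_comp n U V f g : (forall x, U x -> V (g x)) ->
  CnOn n V f -> CnOn n U g -> CnOn n U (fun x => f (g x)).
Proof.
move=> UV; elim: n f g UV => [|n IH] f g UV hf hg; have [cf df] := hf;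
  have [cg dg] := hg; split => //;
  try by move=> x Ux; apply: continuous_comp; [exact: cg|apply: cf; exact: UV].
case: df dg => [f' df cf'] [g' dg cg'].
exists (fun x => f' (g x) * g' x).
  by move=> x Ux; apply: isd_comp; [apply: df; exact: UV|exact: dg].
by apply: CnOnM => //; apply: IH => //; exact: CnOnW.
Qed.

(** On the overlap the two derivatives agree by uniqueness, so the glued one restricts correctly to
    both sets. *)
Lemma CnOnU n U V f : open U -> open V -> CnOn n U f -> CnOn n V f ->
  CnOn n (U `|` V) f.
Proof.
move=> oU oV; elim: n f => [|n IH] f [cU dU] [cV dV]; split => //;
  try by move=> x [/cU|/cV].
case: dU dV => [g1 d1 c1] [g2 d2 c2].
pose g x := if x \in U then g1 x else g2 x.
have gU x : U x -> g1 x = g x by move=> Ux; rewrite /g mem_set.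
have gV x : V x -> g2 x = g x.
  move=> Vx; rewrite /g; case: ifPn => // /[!inE] Ux.
  exact: isd_unique (d2 _ Vx) (d1 _ Ux).
exists g; first by move=> x [Ux|Vx]; [rewrite -gU//; exact: d1|rewrite -gV//; exact: d2].
by apply: IH; [exact: CnOn_eq c1|exact: CnOn_eq c2].
Qed.

Lemma CnOn_id n U : CnOn n U id.
Proof.
case: n => [|n].
  by split => // x _; exact: isd_cont (isd_id x).
by apply: (@CnOn_derive _ _ _ (fun=> 1)); [move=> x _; exact: isd_id|exact: CnOn_cst].
Qed.

Lemma CnOnN n U f : CnOn n U f -> CnOn n U (fun x => - f x).
Proof.
move=> cf; have := CnOnM (CnOn_cst n U (-1)) cf.
suff -> : (fun x => -1 * f x) = (fun x => - f x) by [].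
by apply/funext => x; rewrite mulN1r.
Qed.

Lemma CnOn_X n U f k : CnOn n U f -> CnOn n U (fun x => f x ^+ k).
Proof.
move=> cf; elim: k => [|k IH].
  by under eq_fun do rewrite expr0; exact: CnOn_cst.
by under eq_fun do rewrite exprS; exact: CnOnM.
Qed.

Lemma CnOn_poly n U f (p : {poly R}) : CnOn n U f -> CnOn n U (fun x => p.[f x]).
Proof.
move=> cf; elim/poly_ind: p => [|p c IH].
  by under eq_fun do rewrite horner0; exact: CnOn_cst.
under eq_fun do rewrite hornerMXaddC.
by apply: CnOnD; [exact: CnOnM|exact: CnOn_cst].
Qed.

Lemma CnOn_sin_cos n U : CnOn n U sin /\ CnOn n U cos.
Proof.
elim: n => [|n [IHs IHc]].
  by split; split => // x _; [exact: continuous_sin|exact: continuous_cos].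
split; first by apply: CnOn_derive IHc => x _; exact: is_derive_sin.
by apply: CnOn_derive (CnOnN IHs) => x _; exact: is_derive_cos.
Qed.

Lemma CnOn_sin n U : CnOn n U sin. Proof. by case: (CnOn_sin_cos n U). Qed.
Lemma CnOn_cos n U : CnOn n U cos. Proof. by case: (CnOn_sin_cos n U). Qed.

Lemma CnOn_expR n U : CnOn n U expR.
Proof.
elim: n => [|n IH]; first by split => // x _; exact: continuous_expR.
by apply: CnOn_derive IH => x _; exact: is_derive_expR.
Qed.

Lemma CnOn_inv n : CnOn n [set x | x != 0] (fun x => x^-1).
Proof.
elim: n => [|n IH]; first by split => // x x0; exact: inv_continuous.
apply: (@CnOn_derive _ _ _ (fun x => - (x^-1 * x^-1))).
  by move=> x x0; apply: isd_eq (isdV x0 (isd_id x)) _; rewrite expr2 invfM mulN1r.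
exact/CnOnN/CnOnM.
Qed.

Lemma CnOn_ln n : CnOn n [set x | 0 < x] (@ln R).
Proof.
case: n => [|n]; first by split => // x x0; exact: continuous_ln.
apply: (@CnOn_derive _ _ _ (fun x => x^-1)).
  by move=> x x0; exact: is_derive1_ln.
by apply: CnOn_sub (CnOn_inv n) => x /= /gt_eqF ->.
Qed.

Lemma CnOn_ext n U f g : f = g -> CnOn n U f -> CnOn n U g.
Proof. by move=> ->. Qed.

(** * Functions flat at the origin *)

Section FlatFunction.

(** t^-k exp(-1/t) extended by 0; [k = 0] is the classical smooth non-analytic function. The whole
    family is closed under differentiation up to linear combinations, as the induction on the order
    of smoothness needs. *)
Definition flat (k : nat) (t : R) : R :=
  if 0 < t then t^-1 ^+ k * expR (- t^-1) else 0.

(** The exponential of 1/t exceeds the term of degree n = k + j + 1 of its series. *)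
Lemma flat_le k j (t : R) : 0 < t ->
  t^-1 ^+ k * expR (- t^-1) <= (k + j.+1)`!%:R * t ^+ j.+1.
Proof.
move=> t0; rewrite expRN ler_pdivrMr ?expR_gt0// exprVn -[leLHS]mulr1 ler_pdivrMl ?exprn_gt0//.
have i0 : 0 <= t^-1 by rewrite invr_ge0 ltW.
have := expR_ge1Dxn (k + j) i0; rewrite -addnS; set n := (k + j.+1)%N => h.
have {}h : t^-1 ^+ n / n`!%:R <= expR t^-1 by move: h; lra.
have n0 : 0 < n`!%:R :> R by rewrite ltr0n fact_gt0.
have -> : t ^+ k * (n`!%:R * t ^+ j.+1 * expR t^-1) = t ^+ n * (n`!%:R * expR t^-1).
  by rewrite /n exprD; ring.
rewrite -ler_pdivrMl ?exprn_gt0// mulr1 -exprVn.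
by move: h; rewrite ler_pdivrMr// mulrC.
Qed.

Lemma flat_ge0 k t : 0 <= flat k t.
Proof.
rewrite /flat; case: ifP => // t0.
by rewrite mulr_ge0 ?expR_ge0// exprn_ge0// invr_ge0 ltW.
Qed.

Lemma flat_isd k t : isd t (flat k) (flat k.+2 t - k%:R * flat k.+1 t).
Proof.
case: (ltrgtP t 0) => [t0|t0|->].
- have -> : flat k.+2 t - k%:R * flat k.+1 t = 0.
    by rewrite /flat ltNge ltW//= mulr0 subr0.
  apply: (isd_open (open_lt (y := 0)) t0 _ (isd_cst t 0)) => y /= y0.
  by rewrite /flat ltNge ltW.
- apply: (isd_open (open_gt (y := 0)) t0 (f := fun t => t^-1 ^+ k * expR (- t^-1))).
    by move=> y /= y0; rewrite /flat y0.
  have tn : t != 0 by rewrite gt_eqF.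
  have dV : isd t (fun t => t^-1) (- t^-1 ^+ 2).
    by apply: isd_eq (isdV tn (isd_id t)) _; rewrite -exprVn mulN1r.
  have dN : isd t (fun t => - t^-1) (t^-1 ^+ 2).
    have := isdM (isd_cst t (-1)) dV; rewrite mul0r add0r mulN1r opprK.
    suff -> : (fun t : R => -1 * t^-1) = (fun t => - t^-1) by [].
    by apply/funext => s; rewrite mulN1r.
  have := isdM (isdX k dV) (isd_comp (f := expR) (g := fun s => - s^-1) (is_derive_expR (- t^-1)) dN).
  move/isd_eq; apply; rewrite /flat t0.
  case: k => [|k]; first by rewrite !mul0r expr0; ring.
  by rewrite /= !exprS; ring.
- have -> : flat k.+2 0 - k%:R * flat k.+1 0 = 0.
    by rewrite /flat ltxx mulr0 subr0.
  (* By [flat_le] with exponent 2, [flat k] is quadratically small at 0, so its derivative there is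
     0. *)
  apply: (@isd_quadratic _ _ (k + 2)`!%:R) => h; rewrite add0r.
  rewrite [flat k 0]/flat ltxx subr0 ger0_norm ?flat_ge0// /flat.
  case: ifP => [h0|_]; first exact: flat_le.
  by rewrite mulr_ge0 ?sqr_ge0// ler0n.
Qed.

Lemma CnOn_flat n k U : CnOn n U (flat k).
Proof.
elim: n k => [|n IH] k; first by split=> // x _; apply: isd_cont (flat_isd k x).
apply: (@CnOn_derive _ _ _ (fun t => flat k.+2 t - k%:R * flat k.+1 t)).
  by move=> x _; exact: flat_isd.
by apply: CnOnD => //; apply: CnOnN; apply: CnOnM => //; exact: CnOn_cst.
Qed.

Lemma flat_bound k t : flat k t <= k`!%:R.
Proof.
rewrite /flat; case: ifP => t0; last exact: ler0n.
rewrite expRN ler_pdivrMr ?expR_gt0//; case: k => [|k].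
  by rewrite expr0 fact0 mul1r -expR0 ler_expR invr_ge0 ltW.
have i0 : 0 <= t^-1 by rewrite invr_ge0 ltW.
have n0 : 0 < k.+1`!%:R :> R by rewrite ltr0n fact_gt0.
have h := expR_ge1Dxn k i0; rewrite mulrC -ler_pdivrMr//.
by apply: le_trans h; rewrite lerDr.
Qed.

End FlatFunction.
End Derivatives.

(** * Test functions *)

Section OneDimensionalIntegrals.
Variable R : realType.
Notation mu := (@lebesgue_measure R).
Implicit Types (F f g : R -> R).

Lemma ftc F f a b : a < b -> (forall x, a < x < b -> isd x F (f x)) ->
  (forall x, a <= x <= b -> {for x, continuous F}) ->
  (forall x, a <= x <= b -> {for x, continuous f}) ->
  (\int[mu]_(x in `[a, b]) (f x)%:E = (F b - F a)%:E)%E.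
Proof.
move=> ab dF cF cf; rewrite EFinB; apply: continuous_FTC2 => //.
- apply: continuous_in_subspaceT => x; rewrite inE/= in_itv/=; exact: cf.
- split.
  + by move=> x; rewrite in_itv/= => /dF[].
  + by apply: cvg_at_right_filter; apply: cF; rewrite lexx ltW.
  + by apply: cvg_at_left_filter; apply: cF; rewrite lexx ltW.
- by move=> x; rewrite in_itv/= derive1E => /dF[].
Qed.

Lemma integral_support f a b P : 0 < a -> b < P ->
  (forall x, 0 < x < P -> x < a \/ b < x -> f x = 0) ->
  (\int[mu]_(x in `]0%R, P%R[) (f x)%:E = \int[mu]_(x in `[a, b]) (f x)%:E)%E.
Proof.
move=> a0 b1 f0; rewrite integral_mkcond [RHS]integral_mkcond.
apply: eq_integral => x _; rewrite !patchE !mem_setE !in_itv/=.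
case: (boolP (0 < x < P)) => hx; case: (boolP (a <= x <= b)) => hx' //.
  by rewrite f0//; apply/orP; rewrite !ltNge -negb_and.
by case/negP: hx; case/andP: hx' => ax xb; rewrite (lt_le_trans a0 ax) (le_lt_trans xb b1).
Qed.

Lemma ftc_support F f e P : 0 < P -> 0 < e ->
  (forall x, 0 < x < P -> isd x F (f x)) ->
  (forall x, 0 < x < P -> {for x, continuous f}) ->
  (forall x, 0 < x < P -> x < e \/ P - e < x -> F x = 0) ->
  (forall x, 0 < x < P -> x < e \/ P - e < x -> f x = 0) ->
  (\int[mu]_(x in `]0%R, P%R[) (f x)%:E = 0)%E.
Proof.
move=> P0 e0 dF cf F0 f0.
(* [e / 2] puts the ends of [d, P - d] strictly inside the regions where [F] vanishes; [P / 4] keeps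
   the interval nondegenerate. *)
pose d := Num.min (e / 2) (P / 4).
have d0 : 0 < d by rewrite lt_min !divr_gt0.
have de : d <= e / 2 by rewrite ge_min lexx.
have dP : d <= P / 4 by rewrite ge_min lexx orbT.
have in0P x : d <= x <= P - d -> 0 < x < P by move=> /andP[]; lra.
rewrite (@integral_support f d (P - d) P)//; last 2 first.
- by lra.
- by move=> x hx h; apply: f0 => //; case: h => h; [left|right]; lra.
rewrite (@ftc F)//.
- by rewrite !F0 ?subrr//; [apply: in0P; lra|left; lra|apply: in0P; lra|right; lra].
- by lra.
- by move=> x /andP[h1 h2]; apply: dF; apply: in0P; rewrite !ltW.
- by move=> x /in0P /dF /isd_cont.
- by move=> x /in0P /cf.
Qed.

End OneDimensionalIntegrals.

(** * Partial derivatives as derivatives in one variable *)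

Section PartialDerivatives.
Variable R : realType.
Implicit Types (g : R * R -> R).

Lemma is_derive_fst g x y d :
  is_derive (x, y) ((1, 0) : R * R) g d <-> isd x (fun t => g (t, y)) d.
Proof.
have E : (fun h : R => h^-1 *: ((g \o shift (x, y)) (h *: ((1, 0) : R * R)) - g (x, y))) =
  (fun h : R => h^-1 *: (((fun t => g (t, y)) \o shift x) (h *: (1 : R)) - g (x, y))).
  apply/funext => h /=; congr (_ *: (g _ - _)).
  by congr pair; rewrite /= ?scaler0 ?add0r.
by split=> -[h1 h2]; split; move: h1 h2; rewrite /derivable /derive E.
Qed.

Lemma is_derive_snd g x y d :
  is_derive (x, y) ((0, 1) : R * R) g d <-> isd y (fun t => g (x, t)) d.
Proof.
have E : (fun h : R => h^-1 *: ((g \o shift (x, y)) (h *: ((0, 1) : R * R)) - g (x, y))) =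
  (fun h : R => h^-1 *: (((fun t => g (x, t)) \o shift y) (h *: (1 : R)) - g (x, y))).
  apply/funext => h /=; congr (_ *: (g _ - _)).
  by congr pair; rewrite /= ?scaler0 ?add0r.
by split=> -[h1 h2]; split; move: h1 h2; rewrite /derivable /derive E.
Qed.

Lemma Ck_prod n (S T : R -> R) : CnOn n setT S -> CnOn n setT T ->
  Ck n (fun p => S p.1 * T p.2).
Proof.
elim: n S T => [|n IH] S T hS hT; have [cS dS] := hS; have [cT dT] := hT.
  split => // p; apply: cvgM.
    by apply: (@cvg_comp _ _ _ fst S _ (nbhs p.1)); [exact: cvg_fst|exact: cS].
  by apply: (@cvg_comp _ _ _ snd T _ (nbhs p.2)); [exact: cvg_snd|exact: cT].
split.
  move=> p; apply: cvgM.
    by apply: (@cvg_comp _ _ _ fst S _ (nbhs p.1)); [exact: cvg_fst|exact: cS].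
  by apply: (@cvg_comp _ _ _ snd T _ (nbhs p.2)); [exact: cvg_snd|exact: cT].
case: dS dT => [S' dS cS'] [T' dT cT'] v [->|->].
- have D p : is_derive p ((1, 0) : R * R) (fun p => S p.1 * T p.2) (S' p.1 * T p.2).
    case: p => x y; apply/is_derive_fst.
    apply: isd_eq (isdM (dS x I) (isd_cst x (T y))) _.
    by rewrite mulr0 addr0.
  split; first by move=> p; case: (D p).
  suff -> : (fun p => 'D_(1, 0) (fun p => S p.1 * T p.2) p) = (fun p => S' p.1 * T p.2).
    by apply: IH => //; exact: CnOnW.
  by apply/funext => p; case: (D p).
- have D p : is_derive p ((0, 1) : R * R) (fun p => S p.1 * T p.2) (S p.1 * T' p.2).
    case: p => x y; apply/is_derive_snd.
    apply: isd_eq (isdM (isd_cst y (S x)) (dT y I)) _.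
    by rewrite mul0r add0r.
  split; first by move=> p; case: (D p).
  suff -> : (fun p => 'D_(0, 1) (fun p => S p.1 * T p.2) p) = (fun p => S p.1 * T' p.2).
    by apply: IH => //; exact: CnOnW.
  by apply/funext => p; case: (D p).
Qed.

End PartialDerivatives.

(** * Real-valued test functions and their singular multiples *)

Section RealTestFunctions.
Variable R : realType.
Notation plane := (measurableTypeR R * measurableTypeR R)%type.
Notation hemi := (@hemi R : set plane).
Implicit Types (g : R * R -> R) (K T : R -> R).

Definition vanishing (g : R * R -> R) (e : R) := 0 < e /\ forall x y, x < e \/ pi / 2 - e < x -> g (x, y) = 0.

Definition rtest g := [/\ forall n, Ck n g,
  forall x y, g (x, y + pi *+ 2) = g (x, y) & exists e, vanishing g e].

Lemma rtest_cont g : rtest g -> continuous g.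
Proof. by case=> /(_ 0%N)[]. Qed.

Lemma rtest_dx g : rtest g ->
  (forall p, is_derive p ((1, 0) : R * R) g ('D_(1, 0) g p)) /\ rtest (fun p => 'D_(1, 0) g p).
Proof.
move=> [sg pg [e [e0 vg]]].
have d p : is_derive p ((1, 0) : R * R) g ('D_(1, 0) g p).
  by apply: derivableP; have [_ /(_ (1, 0))[|h _]] := sg 1%N; [left|].
split => //; split.
- by move=> n; have [_ /(_ (1, 0))[|_ h]] := sg n.+1; [left|].
- move=> x y; case/is_derive_fst: (d (x, y)) => _ h.
  case/is_derive_fst: (d (x, y + pi *+ 2)) => _ <-; rewrite -{}h.
  by congr ('D_1 _ x); apply/funext => t; rewrite pg.
- exists e; split=> // x y hx; have /is_derive_fst dxy := d (x, y).
  apply: (isd_unique dxy); case: hx => hx.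
    apply: (isd_open (open_lt (y := e)) hx _ (isd_cst x 0)) => t /= ht.
    by rewrite vg//; left.
  apply: (isd_open (open_gt (y := pi / 2 - e)) hx _ (isd_cst x 0)) => t /= ht.
  by rewrite vg//; right.
Qed.

Lemma rtest_dy g : rtest g ->
  (forall p, is_derive p ((0, 1) : R * R) g ('D_(0, 1) g p)) /\ rtest (fun p => 'D_(0, 1) g p).
Proof.
move=> [sg pg [e [e0 vg]]].
have d p : is_derive p ((0, 1) : R * R) g ('D_(0, 1) g p).
  by apply: derivableP; have [_ /(_ (0, 1))[|h _]] := sg 1%N; [right|].
split => //; split.
- by move=> n; have [_ /(_ (0, 1))[|_ h]] := sg n.+1; [right|].
- move=> x y; have /is_derive_snd d1 := d (x, y).
  have /is_derive_snd d2 := d (x, y + pi *+ 2).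
  apply: (isd_unique (x := y) (f := fun t => g (x, t))) d1.
  have ds : isd y (fun t => t + pi *+ 2) 1.
    by apply: isd_eq (isdD (isd_id y) (isd_cst y _)) _; rewrite addr0.
  have := isd_comp (f := fun t => g (x, t)) (g := fun t => t + pi *+ 2) d2 ds.
  rewrite mulr1; suff -> : (fun t => g (x, t + pi *+ 2)) = (fun t => g (x, t)) by [].
  by apply/funext => t; rewrite pg.
- exists e; split=> // x y hx; have /is_derive_snd dxy := d (x, y).
  apply: (isd_unique dxy).
  have -> : (fun t => g (x, t)) = (fun=> 0) by apply/funext => t; rewrite vg.
  exact: isd_cst.
Qed.

(** [K] may blow up at both ends of (0, pi/2), but [g] vanishes there; what remains is a continuous
    function on a compact rectangle. *)
Lemma vanishing_bounded K g e : continuous g -> vanishing g e ->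
  (forall x, 0 < x < pi / 2 -> {for x, continuous K}) ->
  exists M, forall p, hemi p -> `|K p.1 * g p| <= M.
Proof.
move=> cg [e0 vg] cK.
pose d := Num.min e (pi / 8).
have d0 : 0 < d by rewrite lt_min e0 divr_gt0// pi_gt0.
have p0 := pi_gt0 R.
have dp : d <= pi / 8 by rewrite ge_min lexx orbT.
have de : d <= e by rewrite ge_min lexx.
pose A : set (R * R) := `[d, pi / 2 - d] `*` `[0, pi *+ 2].
have cA : compact A by apply: compact_setX; exact: segment_compact.
pose G (p : R * R) := `|K p.1 * g p|.
have A0 : A !=set0.
  exists (d, 0); split; rewrite /= in_itv/= lexx/=; last by rewrite mulrn_wge0// pi_ge0.
  by move: dp; rewrite mulrC; lra.
have cG : {within A, continuous G}.
  apply: continuous_in_subspaceT => -[x y]; rewrite inE => -[/= + _].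
  rewrite in_itv/= => /andP[h1 h2].
  apply: cvg_norm; apply: cvgM; last exact: cg.
  apply: (@cvg_comp _ _ _ fst K _ (nbhs x)); first exact: cvg_fst.
  by apply: cK; rewrite (lt_le_trans d0 h1) (le_lt_trans h2)// ltrBlDr ltrDl.
have [c cA' cM] := compact_EVT_max A0 cA cG.
exists (G c) => -[x y] /hemiP[hx hy].
have [[h1 h2]|/not_andP h] := pselect (d <= x /\ x <= pi / 2 - d).
  apply: cM; rewrite inE; split; rewrite /= in_itv/= ?h1 ?h2//.
  by case/andP: hy => -> /ltW ->.
rewrite vg ?mulr0 ?normr0; first by rewrite /G.
by case: h => /negP; rewrite -ltNge => h; [left|right]; lra.
Qed.

Lemma vanishing_hmeas K g : continuous g ->
  (forall x, 0 < x < pi / 2 -> {for x, continuous K}) ->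
  hmeas (fun p => K p.1 * g p).
Proof.
move=> cg cK; apply: hmeasM; last exact: hmeas_cont.
by apply: hmeas_x => x; rewrite in_itv; exact: cK.
Qed.

Lemma vanishing_integrable K g e : continuous g -> vanishing g e ->
  (forall x, 0 < x < pi / 2 -> {for x, continuous K}) ->
  rintegrable (fun p => K p.1 * g p).
Proof.
move=> cg vg cK; have [M hM] := vanishing_bounded cg vg cK.
by apply: rintegrable_bounded hM; exact: vanishing_hmeas.
Qed.

End RealTestFunctions.

(** * The magnetic Laplacian against separated modes *)

(** Integration by parts with every function and derivative replaced by a scalar: [t] is the
    tangent, [w] is 1/(sin cos), [r] the radial and [c], [s] the angular factors. One integration in
    phi turns the second angular derivatives into first-order terms, which then carry 2b - k; a
    second one adds -k (2b - k) to b^2, whence (k - b)^2. *)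
Lemma weak_eigen_algebra (F : fieldType)
    (t w r k b lam c s u1 u2 u1x u1xx u1y u1yy u2x u2xx u2y u2yy : F) : t != 0 ->
  (2 * b - k) * (t * r * (u1y * s) + t * r * (u1 * (k * c))) -
  (2 * b - k) * (t * r * (u2y * c) + t * r * (u2 * - (k * s))) -
  (t^-1 * r * (u1xx * c) - t^-1 * r * w * (u1x * c) -
    ((k - b) ^+ 2 * t - lam * t^-1) * r * (u1 * c) +
   (t^-1 * r * (u2xx * s) - t^-1 * r * w * (u2x * s) -
    ((k - b) ^+ 2 * t - lam * t^-1) * r * (u2 * s)) +
   (t * r * (u1yy * c) + t * r * (u1y * - (k * s))) +
   (t * r * (u2yy * s) + t * r * (u2y * (k * c)))) =
  (- (u1xx - w * u1x + t ^+ 2 * (u1yy + 2 * b * u2y - b ^+ 2 * u1)) * (r * c) -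
   (u2xx - w * u2x + t ^+ 2 * (u2yy - 2 * b * u1y - b ^+ 2 * u2)) * (r * s)) * t^-1 -
  lam * ((u1 * (r * c) + u2 * (r * s)) * t^-1).
Proof. by move=> t0; field. Qed.

Section Divergence.
Variable R : realType.
Notation plane := (measurableTypeR R * measurableTypeR R)%type.
Notation hemi := (@hemi R : set plane).
Implicit Types (g : R * R -> R) (K T S : R -> R).

Lemma pihalf_gt0 : 0 < pi / 2 :> R.
Proof. by rewrite divr_gt0// pi_gt0. Qed.

Lemma pihalf_sin (x : R) : 0 < x < pi / 2 -> 0 < sin x.
Proof. exact: sin_gt0_pihalf. Qed.

Lemma pihalf_cos (x : R) : 0 < x < pi / 2 -> 0 < cos x.
Proof.
move=> /andP[x0 x1]; apply: cos_gt0_pihalf.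
by rewrite x1 andbT (lt_trans _ x0)// oppr_lt0 pihalf_gt0.
Qed.

Lemma isd_tan (x : R) : 0 < x < pi / 2 -> isd x tan ((cos x ^+ 2)^-1).
Proof. by move=> hx; apply: is_derive_tan; rewrite gt_eqF// pihalf_cos. Qed.

Lemma isd_cot (x : R) : 0 < x < pi / 2 ->
  isd x (fun t => (tan t)^-1) (- (sin x ^+ 2)^-1).
Proof.
move=> hx; have s0 := pihalf_sin hx; have c0 := pihalf_cos hx.
have t0 : tan x != 0 by rewrite /tan mulf_neq0// ?invr_eq0 gt_eqF.
apply: isd_eq (isdV t0 (isd_tan hx)) _.
by rewrite /tan; field; rewrite !gt_eqF.
Qed.

Lemma cont_tan (x : R) : 0 < x < pi / 2 -> {for x, continuous tan}.
Proof. by move=> /isd_tan /isd_cont. Qed.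

Lemma cont_cot (x : R) : 0 < x < pi / 2 -> {for x, continuous (fun t => (tan t)^-1)}.
Proof. by move=> /isd_cot /isd_cont. Qed.

Lemma cont_sincosV (x : R) : 0 < x < pi / 2 ->
  {for x, continuous (fun t => (sin t * cos t)^-1)}.
Proof.
move=> hx; have s0 := pihalf_sin hx; have c0 := pihalf_cos hx.
apply: continuousV; first by rewrite mulf_neq0// gt_eqF.
by apply: cvgM; [exact: continuous_sin|exact: continuous_cos].
Qed.

Lemma cont_slice1 g y : continuous g -> continuous (fun x => g (x, y)).
Proof.
move=> cg x; have h : {for x, continuous (fun t : R => (t, y))}.
  exact: (@cvg_pair R R R (nbhs x) (nbhs x) (nbhs y) _ _ _ id (fun=> y) cvg_id (cvg_cst y)).
by apply: (continuous_comp h); exact: cg.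
Qed.

Lemma cont_slice2 g x : continuous g -> continuous (fun y => g (x, y)).
Proof.
move=> cg y; have h : {for y, continuous (fun t : R => (x, t))}.
  exact: (@cvg_pair R R R (nbhs y) (nbhs x) (nbhs y) _ _ _ (fun=> x) id (cvg_cst x) cvg_id).
by apply: (continuous_comp h); exact: cg.
Qed.

Lemma cont_mul_snd g T : continuous g -> continuous T ->
  continuous (fun p => g p * T p.2).
Proof.
move=> cg cT p; apply: cvgM; first exact: cg.
by apply: (@cvg_comp _ _ _ snd T _ (nbhs p.2)); [exact: cvg_snd|exact: cT].
Qed.

Lemma rtest_integrable K T g : rtest g -> continuous T ->
  (forall x, 0 < x < pi / 2 -> {for x, continuous K}) ->
  rintegrable (fun p => K p.1 * (g p * T p.2)).
Proof.
move=> tg cT cK; have [_ _ [e [e0 vg]]] := tg.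
apply: (@vanishing_integrable _ K (fun p => g p * T p.2) e) => //.
  by apply: cont_mul_snd => //; exact: rtest_cont.
by split=> // x y h; rewrite vg// mul0r.
Qed.

(** [f] is the angular derivative of [K g T], and periodicity closes up its integral over each
    circle. *)
Lemma rint_dphi_parts K T T' g : rtest g -> continuous T' ->
  (forall y, isd y T (T' y)) -> (forall y, T (y + pi *+ 2) = T y) ->
  (forall x, 0 < x < pi / 2 -> {for x, continuous K}) ->
  let f := (fun p => K p.1 * ('D_(0, 1) g p * T p.2) + K p.1 * (g p * T' p.2)) in
  rintegrable f /\ rint f = 0.
Proof.
move=> tg cT' dT pT cK f.
have cT : continuous T by move=> y; apply: isd_cont (dT y).
have [dg tg'] := rtest_dy tg; have [_ pg _] := tg.
have fi : rintegrable f by apply: rintegrableD; exact: rtest_integrable.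
split => //; apply: (rint_fubini' fi) => x hx.
have cf : continuous (fun y => f (x, y)).
  move=> y; rewrite /continuous_at /f /=.
  apply: cvgD; (apply: cvgM; first exact: cvg_cst).
  - apply: cvgM; last exact: cT.
    exact: (cont_slice2 (g := fun p => 'D_(0, 1) g p) (rtest_cont tg')).
  - apply: cvgM; last exact: cT'.
    exact: (cont_slice2 (rtest_cont tg)).
have mf : measurable_fun (T := measurableTypeR R) setT (fun y => (f (x, y))%:E).
  by apply/measurable_EFinP; exact: continuous_measurable_fun.
rewrite integral_itv_bndo_bndc; last exact: measurable_funTS.
have dF y : isd y (fun t => K x * (g (x, t) * T t)) (f (x, y)).
  have /is_derive_snd d1 := dg (x, y).
  apply: isd_eq (isdM (isd_cst y (K x)) (isdM d1 (dT y))) _.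
  by rewrite /f /=; ring.
rewrite (@ftc _ (fun y => K x * (g (x, y) * T y))) => //.
- by have := pg x 0; have := pT 0; rewrite !add0r => -> ->; rewrite subrr.
- by rewrite mulrn_wgt0// pi_gt0.
- by move=> y _; apply: isd_cont (dF y).
- by move=> y _; exact: cf.
Qed.

Variables (Rr Tr : R -> R) (m2 lam : R).
Hypothesis dRr : forall x, 0 < x < pi / 2 -> isd x Rr (tan x * Tr x).
Hypothesis dTr : forall x, 0 < x < pi / 2 ->
  isd x Tr ((m2 * tan x - lam * (tan x)^-1) * Rr x).

Lemma cont_Rr x : 0 < x < pi / 2 -> {for x, continuous Rr}.
Proof. by move=> /dRr /isd_cont. Qed.

(** The x-derivative of (cot(x) Rr d_x g - Tr g) T. The hypotheses on [Rr] and [Tr = cot(x) Rr'] are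
    the Sturm-Liouville equation (cot(x) R')' = (m2 tan(x) - lam cot(x)) R written as a first-order
    system. *)
Definition xpart g T p := (tan p.1)^-1 * Rr p.1 * ('D_(1, 0) (fun q => 'D_(1, 0) g q) p * T p.2) -
  (tan p.1)^-1 * Rr p.1 * (sin p.1 * cos p.1)^-1 * ('D_(1, 0) g p * T p.2) -
  (m2 * tan p.1 - lam * (tan p.1)^-1) * Rr p.1 * (g p * T p.2).

Lemma rint_dx_parts g T : rtest g -> continuous T ->
  rintegrable (xpart g T) /\ rint (xpart g T) = 0.
Proof.
move=> tg cT; have [dg tg'] := rtest_dx tg; have [dg' tg''] := rtest_dx tg'.
have cK1 x : 0 < x < pi / 2 -> {for x, continuous (fun x => (tan x)^-1 * Rr x)}.
  by move=> hx; apply: cvgM; [exact: cont_cot|exact: cont_Rr].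
have cK2 x : 0 < x < pi / 2 -> {for x, continuous (fun x => (tan x)^-1 * Rr x * (sin x * cos x)^-1)}.
  by move=> hx; apply: cvgM; [exact: cK1|exact: cont_sincosV].
have cK3 x : 0 < x < pi / 2 -> {for x, continuous (fun x => (m2 * tan x - lam * (tan x)^-1) * Rr x)}.
  move=> hx; apply: cvgM; last exact: cont_Rr.
  by apply: cvgB; (apply: cvgM; first exact: cvg_cst); [exact: cont_tan|exact: cont_cot].
have fi : rintegrable (xpart g T).
  apply: rintegrableB; first apply: rintegrableB.
  - exact: (rtest_integrable tg'' cT cK1).
  - exact: (rtest_integrable tg' cT cK2).
  - exact: (rtest_integrable tg cT cK3).
split => //; apply: (rint_fubini fi) => y hy.
have [_ _ [e [e0 vg]]] := tg; have [_ _ [e1 [e10 vg']]] := tg'.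
have [_ _ [e2 [e20 vg'']]] := tg''.
pose e3 := Num.min e (Num.min e1 e2).
have e3e : [/\ e3 <= e, e3 <= e1 & e3 <= e2] by rewrite !ge_min !lexx !orbT.
apply: (@ftc_support _ (fun x => ((tan x)^-1 * Rr x * 'D_(1, 0) g (x, y) - g (x, y) * Tr x) * T y) _ e3).
- exact: pihalf_gt0.
- by rewrite !lt_min e0 e10 e20.
- move=> x hx; have s0 := pihalf_sin hx; have c0 := pihalf_cos hx.
  have /is_derive_fst d1 := dg (x, y); have /is_derive_fst d2 := dg' (x, y).
  apply: isd_eq (isdM (isdB (isdM (isdM (isd_cot hx) (dRr hx)) d2) (isdM d1 (dTr hx)))
    (isd_cst x (T y))) _.
  rewrite /xpart /=; set A := 'D_(1, 0) _ (x, y); set B := 'D_(1, 0) g (x, y).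
  by rewrite /tan; field; rewrite !gt_eqF.
- move=> x hx; rewrite /prop_for /continuous_at /xpart /=.
  apply: cvgB; first apply: cvgB.
  + apply: cvgM; first exact: cK1.
    by apply: cvgM; [exact: (cont_slice1 (rtest_cont tg''))|exact: cvg_cst].
  + apply: cvgM; first exact: cK2.
    by apply: cvgM; [exact: (cont_slice1 (rtest_cont tg'))|exact: cvg_cst].
  + apply: cvgM; first exact: cK3.
    by apply: cvgM; [exact: (cont_slice1 (rtest_cont tg))|exact: cvg_cst].
- move=> x hx h; case: e3e => h1 h2 h3.
  rewrite (vg x y) ?(vg' x y); first by rewrite mulr0 mul0r subr0 mul0r.
  + by case: h => h; [left|right]; lra.
  + by case: h => h; [left|right]; lra.
- move=> x hx h; case: e3e => h1 h2 h3.
  rewrite /xpart /= (vg x y) ?(vg' x y) ?(vg'' x y); first by rewrite !(mul0r, mulr0) !subr0.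
  + by case: h => h; [left|right]; lra.
  + by case: h => h; [left|right]; lra.
  + by case: h => h; [left|right]; lra.
Qed.

Variables (k b : R) (C S : R -> R).
Hypothesis m2E : m2 = (k - b) ^+ 2.
Hypothesis dC : forall y, isd y C (- (k * S y)).
Hypothesis dS : forall y, isd y S (k * C y).
Hypothesis pC : forall y, C (y + pi *+ 2) = C y.
Hypothesis pS : forall y, S (y + pi *+ 2) = S y.

Notation dx g := (fun q => 'D_(1, 0) g q).
Notation dy g := (fun q => 'D_(0, 1) g q).

Definition lap_re (u1 u2 : R * R -> R) p := dx (dx u1) p -
  (sin p.1 * cos p.1)^-1 * dx u1 p + tan p.1 ^+ 2 *
  (dy (dy u1) p + 2 * b * dy u2 p - b ^+ 2 * u1 p).

Definition lap_im (u1 u2 : R * R -> R) p := dx (dx u2) p -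
  (sin p.1 * cos p.1)^-1 * dx u2 p + tan p.1 ^+ 2 *
  (dy (dy u2) p - 2 * b * dy u1 p - b ^+ 2 * u2 p).

(** The integrand is a combination of exact derivatives, each with vanishing integral. [C] and [S]
    stay abstract because two pairs are needed: (cos, sin) gives the real part of the pairing with
    psi, (-sin, cos) the imaginary part. *)
Lemma weak_eigen u1 u2 : rtest u1 -> rtest u2 ->
  let f := (fun p => (- lap_re u1 u2 p * (Rr p.1 * C p.2) -
    lap_im u1 u2 p * (Rr p.1 * S p.2)) * (tan p.1)^-1
     - lam * ((u1 p * (Rr p.1 * C p.2) + u2 p * (Rr p.1 * S p.2)) * (tan p.1)^-1)) in
  rintegrable f /\ rint f = 0.
Proof.
move=> t1 t2 f.
have cC : continuous C by move=> y; apply: isd_cont (dC y).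
have cS : continuous S by move=> y; apply: isd_cont (dS y).
have cC' : continuous (fun y => - (k * S y)).
  by move=> y; apply: cvgN; apply: cvgM; [exact: cvg_cst|exact: cS].
have cS' : continuous (fun y => k * C y).
  by move=> y; apply: cvgM; [exact: cvg_cst|exact: cC].
pose K x := tan x * Rr x.
have cK x : 0 < x < pi / 2 -> {for x, continuous K}.
  by move=> hx; apply: cvgM; [exact: cont_tan|exact: cont_Rr].
have [_ t1'] := rtest_dy t1; have [_ t2'] := rtest_dy t2.
have [iA1 A1] := rint_dx_parts t1 cC; have [iA2 A2] := rint_dx_parts t2 cS.
have [iB1 B1] := rint_dphi_parts t1' cC' dC pC cK.
have [iB2 B2] := rint_dphi_parts t1 cS' dS pS cK.
have [iB3 B3] := rint_dphi_parts t2' cS' dS pS cK.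
have [iB4 B4] := rint_dphi_parts t2 cC' dC pC cK.
move: iA1 iA2 iB1 iB2 iB3 iB4 A1 A2 B1 B2 B3 B4.
set a1 := xpart u1 C; set a2 := xpart u2 S.
set b1 := (fun p : R * R => K p.1 * ('D_(0, 1) (dy u1) p * C p.2) + _).
set b2 := (fun p : R * R => K p.1 * ('D_(0, 1) u1 p * S p.2) + _).
set b3 := (fun p : R * R => K p.1 * ('D_(0, 1) (dy u2) p * S p.2) + _).
set b4 := (fun p : R * R => K p.1 * ('D_(0, 1) u2 p * C p.2) + _).
move=> iA1 iA2 iB1 iB2 iB3 iB4 A1 A2 B1 B2 B3 B4.
have i1 : rintegrable (fun p => a1 p + a2 p) by exact: rintegrableD.
have i2 : rintegrable (fun p => (a1 p + a2 p) + b1 p) by exact: rintegrableD.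
have i3 : rintegrable (fun p => (a1 p + a2 p) + b1 p + b3 p) by exact: rintegrableD.
have j2 : rintegrable (fun p => (2 * b - k) * b2 p) by exact: rintegrableZ.
have j4 : rintegrable (fun p => (2 * b - k) * b4 p) by exact: rintegrableZ.
have i4 : rintegrable (fun p => (2 * b - k) * b2 p - (2 * b - k) * b4 p).
  exact: rintegrableB.
pose f' p := ((2 * b - k) * b2 p - (2 * b - k) * b4 p) -
   ((a1 p + a2 p) + b1 p + b3 p).
have ff' p : hemi p -> f' p = f p.
  move=> hp; have s0 := hemi_sin_gt0 hp; have c0 := hemi_cos_gt0 hp.
  rewrite /f /f' /lap_re /lap_im /a1 /a2 /b1 /b2 /b3 /b4 /xpart /K m2E.
  apply: weak_eigen_algebra.
  by rewrite /tan mulf_neq0// ?invr_eq0 gt_eqF.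
split; first by apply: (eq_rintegrable ff'); exact: rintegrableB.
rewrite -(eq_rint ff') (rintB i4 i3) (rintB j2 j4) (rintZ _ iB2) (rintZ _ iB4).
rewrite (rintD i2 iB3) (rintD i1 iB1) (rintD iA1 iA2).
by rewrite A1 A2 B1 B2 B3 B4; ring.
Qed.

End Divergence.

(** * Radial functions *)

Section Radial.
Variables (R : realType) (m : R).
Hypothesis m0 : 0 <= m.
Implicit Types (p : {poly R}).

Definition radial p (x : R) : R := cos x `^ m * p.[cos x ^+ 2].

(** The operator cot(x) d/dx in the variable z = cos(x)^2, after division by cos(x)^m: it acts on
    polynomials as - m - 2 z d/dz, so differentiation stays within radial functions up to a factor
    tan(x). *)
Definition dradial p : {poly R} := - m *: p - 2 *: ('X * p^`()).

Lemma isd_poly p (x : R) : isd x (horner p) (p^`().[x]).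
Proof. exact: is_derive_poly. Qed.

Lemma isd_radial p x : 0 < x < pi / 2 ->
  isd x (radial p) (tan x * radial (dradial p) x).
Proof.
move=> hx; have c0 := pihalf_cos hx; have s0 := pihalf_sin hx.
have dc2 : isd x (fun t => cos t ^+ 2) (- (2 * cos x * sin x)).
  by apply: isd_eq (isdX 2 (is_derive_cos x)) _; rewrite /= expr1; ring.
have dpow : isd x (fun t => cos t `^ m) (m * cos x `^ (m - 1) * - sin x).
  exact: (isd_comp (f := fun t => t `^ m) (is_derive1_powR m c0) (is_derive_cos x)).
have pE : cos x `^ (m - 1) = cos x `^ m / cos x.
  rewrite powRB; last by apply/implyP => _; rewrite gt_eqF.
  by rewrite powRr1// ltW.
apply: isd_eq (isdM dpow (isd_comp (f := horner p) (g := fun t => cos t ^+ 2) (isd_poly p (cos x ^+ 2)) dc2)) _.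
rewrite /radial /dradial !(hornerD, hornerN, hornerZ, hornerM, hornerX, hornerC) pE /tan.
by field; rewrite gt_eqF.
Qed.

(** The hypergeometric equation at z = cos(x)^2, where 1 - z = sin(x)^2; the 4 in the eigenvalue
    comes from applying 2 z d/dz twice. *)
Lemma isd_dradial n x : 0 < x < pi / 2 ->
  isd x (radial (dradial (hpoly m n)))
   ((m ^+ 2 * tan x - 4 * n%:R * (n%:R + m) * (tan x)^-1) * radial (hpoly m n) x).
Proof.
move=> hx; have c0 := pihalf_cos hx; have s0 := pihalf_sin hx.
apply: isd_eq (isd_radial _ hx) _; rewrite /radial.
set p := hpoly m n; set t := cos x ^+ 2.
have ode := congr1 (fun q => q.[t]) (hpoly_ode m0 n).
rewrite !(hornerD, hornerN, hornerZ, hornerM, hornerX, hornerC) -/p in ode.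
have t1 : 1 - t = sin x ^+ 2 by rewrite /t -(cos2Dsin2 x) addrC addKr.
rewrite t1 in ode.
have -> : (dradial (dradial p)).[t] =
   m ^+ 2 * p.[t] + 4 * t * ((1 + m) * p^`().[t] + t * p^`()^`().[t]).
  rewrite /dradial !(derivB, derivZ, derivM, derivX) !(hornerD, hornerN, hornerZ, hornerM, hornerX, hornerC); ring.
have e2 : (1 + m) * p^`().[t] + t * p^`()^`().[t] =
   - (n%:R * (n%:R + m) * p.[t]) / sin x ^+ 2.
  by apply: (mulIf (x := sin x ^+ 2)); rewrite ?divfK ?expf_neq0 ?gt_eqF//;
     move/eqP: ode; rewrite -subr_eq0 subr0 => /eqP; lra.
rewrite e2 /tan /t; field.
by rewrite !gt_eqF.
Qed.

Lemma poly_bound p : exists2 M : R, 0 <= M & forall t, 0 <= t <= 1 -> `|p.[t]| <= M.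
Proof.
exists (\sum_(i < size p) `|p`_i|); first exact: sumr_ge0.
move=> t /andP[t0 t1]; rewrite horner_coef; apply: le_trans (ler_norm_sum _ _ _) _.
apply: ler_sum => i _; rewrite normrM ler_piMr// ger0_norm ?exprn_ge0//.
exact: exprn_ile1.
Qed.

Lemma poly_root1 p : p.[1] = 0 -> exists r, p = (1 - 'X) * r.
Proof.
move=> p1; have /factor_theorem[r ->] : root p 1 by apply/rootP.
by exists (- r); rewrite mulrN -mulNr opprB mulrC.
Qed.

Lemma cos2_itv (x : R) : 0 <= cos x ^+ 2 <= 1.
Proof.
by rewrite sqr_ge0 -(cos2Dsin2 x) lerDl sqr_ge0.
Qed.

Lemma powRcos_le1 (x : R) : cos x `^ m <= 1.
Proof.
have c1 := cos_le1 x; have [c0|c0] := leP 0 (cos x).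
  have := ge0_ler_powR m0 (x := cos x) (y := 1).
  by rewrite !nnegrE powR1; apply.
by rewrite /powR lt_eqF// ln0 ?mulr0 ?expR0// ltW.
Qed.

Lemma radial_bound p : p.[1] = 0 ->
  exists2 M, 0 <= M & forall x, `|radial p x| <= M * sin x ^+ 2.
Proof.
move=> /poly_root1[r ->]; have [M M0 hM] := poly_bound r; exists M => // x.
rewrite /radial hornerM !(hornerD, hornerN, hornerZ, hornerM, hornerX, hornerC) normrM (ger0_norm (powR_ge0 _ _)).
have -> : 1 - cos x ^+ 2 = sin x ^+ 2 by rewrite -(cos2Dsin2 x) addrC addKr.
rewrite normrM (ger0_norm (sqr_ge0 _)).
have h := hM _ (cos2_itv x).
apply: (@le_trans _ _ (1 * (sin x ^+ 2 * M))); last by rewrite mul1r mulrC.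
apply: ler_pM; [exact: powR_ge0|by rewrite mulr_ge0 ?sqr_ge0|exact: powRcos_le1|].
by rewrite ler_wpM2l ?sqr_ge0.
Qed.

(** At pi/2, where the cosine changes sign, only boundedness of the power of cos is used; the zero
    of [h] makes the product continuous. *)
Lemma cont_powRcos_mul (h : R -> R) (x : R) : 0 <= x <= pi / 2 ->
  {for x, continuous h} -> h (pi / 2) = 0 ->
  {for x, continuous (fun t => cos t `^ m * cos t `^ m * h t)}.
Proof.
move=> /andP[x0 x1] ch h0; have bnd t : 0 <= cos t `^ m * cos t `^ m <= 1.
  rewrite mulr_ge0 ?powR_ge0//= -[leRHS]mulr1.
  by apply: ler_pM; rewrite ?powR_ge0 ?powRcos_le1.
move: x1; rewrite le_eqVlt => /predU1P[x1|x1]; last first.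
  have c0 : 0 < cos x.
    by apply: cos_gt0_pihalf; rewrite x1 andbT (lt_le_trans _ x0)// oppr_lt0 pihalf_gt0.
  have cp : {for x, continuous (fun t => cos t `^ m)}.
    apply: isd_cont.
    exact: (isd_comp (f := fun t => t `^ m) (is_derive1_powR m c0) (is_derive_cos x)).
  by apply: cvgM => //; apply: cvgM.
rewrite x1 in ch *; rewrite /prop_for /continuous_at h0 mulr0.
apply/cvgr0Pnorm_lt => e e0.
have : h @ (pi / 2) --> 0 by move: ch; rewrite /prop_for /continuous_at h0.
move=> /cvgr0Pnorm_lt/(_ _ e0); apply: filterS => t ht.
rewrite normrM; apply: le_lt_trans ht; have /andP[b0 b1] := bnd t.
by rewrite ger0_norm// ler_piMl.
Qed.

Lemma cont_poly_cos2 p (x : R) : {for x, continuous (fun t => p.[cos t ^+ 2])}.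
Proof.
have dc2 := isdX 2 (is_derive_cos x).
exact: isd_cont (isd_comp (f := horner p) (g := fun t => cos t ^+ 2) (isd_poly p (cos x ^+ 2)) dc2).
Qed.

(** Lagrange's identity: [W], a Wronskian of the two radial functions, has derivative (ll - ln)
    times the integrand. It vanishes at 0, where both polynomials are evaluated at 1, and at pi/2,
    where it carries a factor cos^2. *)
Lemma radial_orth n l : (0 < n)%N -> (0 < l)%N -> n != l ->
  (\int[lebesgue_measure]_(x in `]0%R, (pi / 2)%R[)
    (radial (hpoly m n) x * radial (hpoly m l) x * (tan x)^-1)%:E = 0)%E.
Proof.
move=> n0 l0 nl; pose p := hpoly m n; pose q := hpoly m l.
have [r rE] := poly_root1 (hpoly1 m0 n0); have [r' rE'] := poly_root1 (hpoly1 m0 l0).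
pose ln := 4 * n%:R * (n%:R + m); pose ll := 4 * l%:R * (l%:R + m).
have lnl : ll - ln != 0.
  have -> : ll - ln = 4 * (l%:R - n%:R) * (l%:R + n%:R + m).
    by rewrite /ll /ln; ring.
  have h1 : l%:R - n%:R != 0 :> R by rewrite subr_eq0 eqr_nat eq_sym.
  have h2 : l%:R + n%:R + m != 0.
    by rewrite gt_eqF// ltr_wpDr// -natrD ltr0n addn_gt0 l0.
  by rewrite !mulf_neq0// pnatr_eq0.
(* The integrand and [W] in forms continuous up to both ends: the factors sin^2 of the two radial
   parts absorb the cotangent, and the terms in [m] cancel in [W]. *)
pose f x := cos x `^ m * cos x `^ m * (cos x * sin x ^+ 3 * (r * r').[cos x ^+ 2]).
pose h x := (- 2 * cos x ^+ 2 * (p^`() * q - q^`() * p).[cos x ^+ 2]).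
pose W x := cos x `^ m * cos x `^ m * h x.
have cf x : 0 <= x <= pi / 2 -> {for x, continuous f}.
  move=> hx; apply: cont_powRcos_mul => //; last by rewrite cos_pihalf !mul0r.
  apply: cvgM; last exact: cont_poly_cos2.
  apply: cvgM; first exact: continuous_cos.
  exact: isd_cont (isdX 3 (is_derive_sin x)).
have cW x : 0 <= x <= pi / 2 -> {for x, continuous W}.
  move=> hx; apply: cont_powRcos_mul => //; last first.
    by rewrite /h cos_pihalf expr0n/= mulr0 mul0r.
  apply: cvgM; last exact: cont_poly_cos2.
  apply: cvgM; first exact: cvg_cst.
  exact: isd_cont (isdX 2 (is_derive_cos x)).
have WE x : W x = radial (dradial p) x * radial q x - radial (dradial q) x * radial p x.
  rewrite /W /radial /h /dradial; set c := cos x.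
  by rewrite !(hornerD, hornerN, hornerZ, hornerM, hornerX, hornerC); ring.
have fE x : 0 < x < pi / 2 -> f x = radial p x * radial q x * (tan x)^-1.
  move=> hx; have c0 := pihalf_cos hx; have s0 := pihalf_sin hx.
  rewrite /f /radial /p /q rE rE' /tan !hornerM !(hornerD, hornerN, hornerX, hornerC).
  have -> : 1 - cos x ^+ 2 = sin x ^+ 2 by rewrite -(cos2Dsin2 x) addrC addKr.
  by field; rewrite !gt_eqF.
have dW x : 0 < x < pi / 2 -> isd x W ((ll - ln) * f x).
  move=> hx.
  have -> : W = fun x => radial (dradial p) x * radial q x - radial (dradial q) x * radial p x.
    by apply/funext.
  apply: isd_eq (isdB (isdM (isd_dradial n hx) (isd_radial q hx))
    (isdM (isd_dradial l hx) (isd_radial p hx))) _.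
  rewrite fE// -/p -/q -/ln -/ll; ring.
have If : (\int[lebesgue_measure]_(x in `[0%R, (pi / 2)%R]) ((ll - ln) * f x)%:E = 0)%E.
  rewrite (@ftc _ W)//; last 2 first.
  - exact: pihalf_gt0.
  - by move=> x hx; apply: cvgM; [exact: cvg_cst|exact: cf].
  rewrite /W /h cos0 cos_pihalf expr1n expr0n/= !(hornerD, hornerN, hornerZ, hornerM, hornerX, hornerC).
  by rewrite /p /q !hpoly1// !(mul0r, mulr0, subr0, subrr).
have mf : measurable_fun (T := measurableTypeR R) `[0, pi / 2]%classic f.
  apply: subspace_continuous_measurable_fun => //.
  apply: continuous_in_subspaceT => x; rewrite inE/= in_itv/=; exact: cf.
have mf' : measurable_fun (T := measurableTypeR R) `]0, pi / 2[%classic f.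
  apply: measurable_funS mf => //.
  by move=> x /=; rewrite !in_itv/= => /andP[/ltW -> /ltW ->].
have i0 : lebesgue_measure.-integrable `[0, (pi / 2)]%classic (EFin \o f).
  apply: continuous_compact_integrable; first exact: segment_compact.
  apply: continuous_in_subspaceT => x; rewrite inE/= in_itv/=; exact: cf.
have I2 : (\int[lebesgue_measure]_(x in `]0%R, (pi / 2)%R[) (f x)%:E =
   \int[lebesgue_measure]_(x in `[0%R, (pi / 2)%R]) (f x)%:E)%E.
  apply/esym; apply: integral_itv_bndoo.
  exact/measurable_EFinP.
transitivity (\int[lebesgue_measure]_(x in `]0%R, (pi / 2)%R[) (f x)%:E)%E.
  apply: eq_integral => x; rewrite inE/= in_itv/= => hx.
  by rewrite fE.
rewrite I2; move: If; under eq_integral do rewrite EFinM.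
rewrite integralZl// => /eqP; rewrite mule_eq0 eqe (negbTE lnl)/= => /eqP.
exact.
Qed.

End Radial.

(** * The eigenfunctions *)

Lemma complex_laplacian_algebra (R : realType)
    (w t b u1 u2 x1 x2 xx1 xx2 y1 y2 yy1 yy2 : R) :
  (xx1 +i* xx2) - w%:C * (x1 +i* x2) + t%:C * ((yy1 +i* yy2) -
    2 * (0 +i* 1) * b%:C * (y1 +i* y2) - (b ^+ 2)%:C * (u1 +i* u2)) =
  (xx1 - w * x1 + t * (yy1 + 2 * b * y2 - b ^+ 2 * u1)) +i*
  (xx2 - w * x2 + t * (yy2 - 2 * b * y1 - b ^+ 2 * u2)).
Proof. by simpc; congr (_ +i* _); ring. Qed.

Section Eigenfunctions.
Variables (R : realType) (b : R).
Notation mu := (@lebesgue_measure R).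
Notation plane := (measurableTypeR R * measurableTypeR R)%type.
Notation hemi := (@hemi R : set plane).
Notation leb2 := (@leb2 R).
Notation L := (@square_integrable R).
Implicit Types (k j : int) (n l : nat) (u : cfun R).

Definition mexp k : R := `|k%:~R - b|.
Definition phase k (y : R) : R := k%:~R * y + (k%:~R - b) * (pi / 2).
Definition rpsi n k : R -> R := radial (mexp k) (hpoly (mexp k) n).

Lemma mexp_ge0 k : 0 <= mexp k.
Proof. exact: normr_ge0. Qed.

Lemma expiD (s t : R) : expi s * expi t = expi (s + t).
Proof. by rewrite /expi cosD sinD; simpc; congr (_ +i* _); ring. Qed.

Lemma psiE n k p : psi b n k p =
  (rpsi n k p.1 * cos (phase k p.2)) +i* (rpsi n k p.1 * sin (phase k p.2)).
Proof.
rewrite /psi /= expiD -/(mexp k) hypergeometricE ?mexp_ge0//.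
rewrite /rpsi /radial /expi -/(phase k p.2); simpc.
by congr (_ +i* _); rewrite mulrC.
Qed.

Lemma cosD_int (a : R) k : cos (a + k%:~R * (pi *+ 2)) = cos a.
Proof.
case: k => n; first by rewrite -pmulrn mulr_natl (periodicn (@cosD2pi R)).
rewrite NegzE mulrNz mulNr -[LHS](periodicn (@cosD2pi R) n.+1).
by rewrite -pmulrn mulr_natl subrK.
Qed.

Lemma sinD_int (a : R) k : sin (a + k%:~R * (pi *+ 2)) = sin a.
Proof.
case: k => n; first by rewrite -pmulrn mulr_natl (periodicn (@sinD2pi R)).
rewrite NegzE mulrNz mulNr -[LHS](periodicn (@sinD2pi R) n.+1).
by rewrite -pmulrn mulr_natl subrK.
Qed.

Lemma phaseD2pi k (y : R) : phase k (y + pi *+ 2) = phase k y + k%:~R * (pi *+ 2).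
Proof. by rewrite /phase mulrDr addrAC. Qed.

Lemma isd_phase k (y : R) : isd y (phase k) k%:~R.
Proof.
apply: isd_eq (isdD (isdM (isd_cst y k%:~R) (isd_id y)) (isd_cst y _)) _.
by rewrite mul0r add0r mulr1 addr0.
Qed.

Lemma isd_cos_phase k (y : R) :
  isd y (fun y => cos (phase k y)) (- (k%:~R * sin (phase k y))).
Proof.
apply: isd_eq (isd_comp (f := cos) (is_derive_cos _) (isd_phase k y)) _.
by rewrite mulNr mulrC.
Qed.

Lemma isd_sin_phase k (y : R) :
  isd y (fun y => sin (phase k y)) (k%:~R * cos (phase k y)).
Proof.
apply: isd_eq (isd_comp (f := sin) (is_derive_sin _) (isd_phase k y)) _.
by rewrite mulrC.
Qed.

Lemma isd_rpsi n k x : 0 < x < pi / 2 -> isd x (rpsi n k)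
  (tan x * radial (mexp k) (dradial (mexp k) (hpoly (mexp k) n)) x).
Proof. exact: isd_radial. Qed.

Lemma isd_drpsi n k x : 0 < x < pi / 2 ->
  isd x (radial (mexp k) (dradial (mexp k) (hpoly (mexp k) n)))
   (((k%:~R - b) ^+ 2 * tan x - lambda b n k * (tan x)^-1) * rpsi n k x).
Proof.
move=> hx; apply: isd_eq (isd_dradial (mexp_ge0 k) n hx) _.
by rewrite /lambda /mexp real_normK ?num_real.
Qed.

Lemma hmeas_rpsi n k : hmeas (fun p => rpsi n k p.1).
Proof.
by apply: hmeas_x => x; rewrite in_itv/= => hx; apply: isd_cont (isd_rpsi n k hx).
Qed.

Lemma hmeas_cos_phase k : hmeas (fun p => cos (phase k p.2)).
Proof.
apply: (hmeas_y (K := fun y => cos (phase k y))) => y.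
exact: isd_cont (isd_cos_phase k y).
Qed.

Lemma hmeas_sin_phase k : hmeas (fun p => sin (phase k p.2)).
Proof.
apply: (hmeas_y (K := fun y => sin (phase k y))) => y.
exact: isd_cont (isd_sin_phase k y).
Qed.

Lemma hmeasC_psi n k : hmeasC (psi b n k).
Proof.
split; [apply: (eq_hmeas (f := fun p => rpsi n k p.1 * cos (phase k p.2)))|
        apply: (eq_hmeas (f := fun p => rpsi n k p.1 * sin (phase k p.2)))];
  try (by move=> p _; rewrite psiE); apply: hmeasM; try exact: hmeas_rpsi.
- exact: hmeas_cos_phase.
- exact: hmeas_sin_phase.
Qed.

Lemma sqmod_psi n k p : sqmod (psi b n k p) = rpsi n k p.1 ^+ 2.
Proof.
rewrite psiE /sqmod /= !exprMn -mulrDr.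
by rewrite cos2Dsin2 mulr1.
Qed.

Lemma hpoly_mexp1 n k : (0 < n)%N -> (hpoly (mexp k) n).[1] = 0.
Proof. by apply: hpoly1; exact: mexp_ge0. Qed.

Lemma rpsi_bound n k : (0 < n)%N ->
  exists2 M, 0 <= M & forall x, `|rpsi n k x| <= M * sin x ^+ 2.
Proof. by move=> n0; apply: radial_bound; [exact: mexp_ge0|exact: hpoly_mexp1]. Qed.

(** Two factors sin^2, one from each mode, beat the volume density: sin^4 cot = sin^3 cos. *)
Lemma sin4_vol p : hemi p -> sin p.1 ^+ 2 * sin p.1 ^+ 2 * vol p <= 1.
Proof.
move=> hp; have s0 := hemi_sin_gt0 hp; have c0 := hemi_cos_gt0 hp.
have -> : sin p.1 ^+ 2 * sin p.1 ^+ 2 * vol p = sin p.1 ^+ 3 * cos p.1.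
  by rewrite /vol /tan; field; rewrite !gt_eqF.
rewrite -[leRHS]mulr1.
by apply: ler_pM; rewrite ?exprn_ge0 ?exprn_ile1 ?(ltW s0) ?(ltW c0) ?sin_le1 ?cos_le1.
Qed.

Lemma rpsi2_bound n l k j : (0 < n)%N -> (0 < l)%N -> exists M, forall p, hemi p ->
  `|rpsi n k p.1 * rpsi l j p.1 * vol p| <= M.
Proof.
move=> /(rpsi_bound k)[M M0 hM] /(rpsi_bound j)[N N0 hN]; exists (M * N) => p hp.
have v0 := vol_gt0 hp; rewrite normrM (normrM (rpsi n k p.1)) (gtr0_norm v0).
apply: (@le_trans _ _ (M * sin p.1 ^+ 2 * (N * sin p.1 ^+ 2) * vol p)).
  by rewrite ler_pM2r//; apply: ler_pM; rewrite ?normr_ge0 ?hM ?hN.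
have -> : M * sin p.1 ^+ 2 * (N * sin p.1 ^+ 2) * vol p =
  M * N * (sin p.1 ^+ 2 * sin p.1 ^+ 2 * vol p) by ring.
by rewrite -[leRHS]mulr1 ler_wpM2l ?mulr_ge0//; exact: sin4_vol.
Qed.

Lemma sqint_psi n k : (0 < n)%N -> L (psi b n k).
Proof.
move=> n0; have [M hM] := rpsi2_bound k k n0 n0.
apply/sqintP; split; first exact: hmeasC_psi.
apply: (rintegrable_bounded (M := M)).
  apply: hmeasM; last exact: hmeas_vol.
  by apply: hmeas_sqmod; exact: hmeasC_psi.
by move=> p hp; rewrite sqmod_psi expr2; exact: hM.
Qed.

(** [hpoly] equals 1 at 0, so psi has no zero on a strip next to the pole, and this strip has
    positive measure; the bound pi/4 keeps the strip inside the hemisphere. *)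
Lemma psi_neq0 n k : ~ ae_equal (psi b n k) (fun=> 0).
Proof.
move=> [N [mN N0 sub]]; have m0 := mexp_ge0 k.
have [d d0 hd] : exists2 d, 0 < d & forall x, `|x - pi / 2| < d ->
    0 < (hpoly (mexp k) n).[cos x ^+ 2].
  have := @cont_poly_cos2 R (hpoly (mexp k) n) (pi / 2).
  rewrite /prop_for /continuous_at cos_pihalf expr0n/= hpoly0// => /cvgrPdist_lt.
  move=> /(_ 1 ltr01)[d /= d0 hd]; exists d => // x xd.
  have := hd x; rewrite /= distrC => /(_ xd).
  by rewrite ltr_norml => /andP[_]; lra.
pose a : R := Num.max (pi / 2 - d) (pi / 4).
have p0 := pi_gt0 R.
have ap : a < pi / 2 by rewrite gt_max; apply/andP; split; lra.
have a0 : 0 < a by rewrite lt_max orbC divr_gt0.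
pose Q : set plane := `]a, (pi / 2)[%classic `*` `[0, (pi *+ 2)[%classic.
have mQ : measurable Q by apply: measurableX; exact: measurable_itv.
have QN : Q `<=` N.
  move=> [x y] [/=]; rewrite !in_itv/= => /andP[x0 x1] hy; apply: sub => /=.
  have hx : 0 < x < pi / 2 by rewrite (lt_trans a0).
  have hp : hemi (x, y) by apply/hemiP.
  move=> /(_ hp) h; have := sqmod_psi n k (x, y); rewrite h sqmod0 => /esym/eqP.
  rewrite sqrf_eq0 => /eqP /=; apply/eqP; rewrite gt_eqF// /rpsi /radial mulr_gt0//.
    by rewrite powR_gt0// pihalf_cos.
  apply: hd; rewrite distrC ger0_norm ?subr_ge0 ?ltW//.
  by move: x0; rewrite gt_max => /andP[]; lra.
have : (leb2 Q <= leb2 N)%E by apply: le_measure => //; rewrite inE.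
rewrite [leb2 N]N0 leNgt => /negP; apply.
rewrite /leb2 product_measure1E; [|exact: measurable_itv..].
have pos (c d' : R) x y : c < d' -> (0 < mu [set` Interval (BSide x c) (BSide y d')])%E.
  by move=> cd; rewrite lebesgue_measure_itv/= lte_fin cd -EFinD lte_fin subr_gt0.
by apply: mule_gt0; apply: pos => //; rewrite mulrn_wgt0.
Qed.

(** A nonzero integer frequency integrates to 0 over a full period. The free phase [c] lets the
    lemma serve for sines too, as cosines shifted by pi/2. *)
Lemma rint_mode (F : R -> R) a c : a != 0 -> (exists M, forall p, hemi p -> `|F p.1| <= M) ->
  hmeas (fun p => F p.1) -> (exists i : int, a = i%:~R) ->
  rint (fun p => F p.1 * cos (a * p.2 + c)) = 0.
Proof.
move=> a0 [M FM] mF [i ai].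
have dS y : isd y (fun y => sin (a * y + c) / a) (cos (a * y + c)).
  have d1 : isd y (fun y => a * y + c) a.
    apply: isd_eq (isdD (isdM (isd_cst y a) (isd_id y)) (isd_cst y _)) _.
    by rewrite mul0r add0r mulr1 addr0.
  apply: isd_eq (isdM (isd_comp (f := sin) (is_derive_sin _) d1) (isd_cst y a^-1)) _.
  by rewrite mulr0 addr0 mulfK.
have cC : continuous (fun y => cos (a * y + c)).
  move=> y; apply: (@continuous_comp _ _ _ (fun y => a * y + c) cos); last exact: continuous_cos.
  by apply: cvgD; [apply: cvgM; [exact: cvg_cst|exact: cvg_id]|exact: cvg_cst].
apply: rint_fubini'.
  apply: (rintegrable_bounded (M := M)).
    by apply: hmeasM => //; exact: (hmeas_y cC).
  move=> p hp; rewrite normrM -[leRHS]mulr1; apply: ler_pM => //; first exact: FM.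
  by rewrite ler_norml cos_geN1 cos_le1.
move=> x hx.
have mf : measurable_fun (T := measurableTypeR R) setT (fun y => (F x * cos (a * y + c))%:E).
  apply/measurable_EFinP; apply: continuous_measurable_fun => y.
  by apply: cvgM; [exact: cvg_cst|exact: cC].
rewrite integral_itv_bndo_bndc; last exact: measurable_funTS.
rewrite (@ftc _ (fun y => F x * (sin (a * y + c) / a))).
- rewrite mulr0 add0r [_ + c]addrC ai sinD_int subrr//.
- by rewrite mulrn_wgt0// pi_gt0.
- by move=> y _; apply: isd_eq (isdM (isd_cst y (F x)) (dS y)) _; rewrite mul0r add0r.
- by move=> y _; apply: isd_cont (isdM (isd_cst y (F x)) (dS y)).
- by move=> y _; rewrite /prop_for /continuous_at /=; apply: cvgM; [exact: cvg_cst|exact: cC].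
Qed.

Lemma phaseB k j (y : R) : phase k y - phase j y =
  (k - j)%:~R * y + (k - j)%:~R * (pi / 2).
Proof. by rewrite /phase intrB; ring. Qed.

Lemma inner_psiE n l k j : inner (psi b n k) (psi b l j) =
  rint (fun p => rpsi n k p.1 * rpsi l j p.1 * vol p * cos (phase k p.2 - phase j p.2)) +i*
  rint (fun p => rpsi n k p.1 * rpsi l j p.1 * vol p * sin (phase k p.2 - phase j p.2)).
Proof.
rewrite /inner integralCE; congr (_ +i* _); apply: eq_rint => p _.
  by rewrite !psiE cosB /=; ring.
by rewrite !psiE sinB /=; ring.
Qed.

Lemma psi_orth n l k j : (0 < n)%N -> (0 < l)%N -> (n, k) != (l, j) ->
  inner (psi b n k) (psi b l j) = 0.
Proof.
move=> n0 l0 nl; rewrite inner_psiE.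
have [M hM] := rpsi2_bound k j n0 l0.
have mF : hmeas (fun p => rpsi n k p.1 * rpsi l j p.1 * vol p).
  apply: hmeasM; last exact: hmeas_vol.
  by apply: hmeasM; exact: hmeas_rpsi.
have [kj|kj] := eqVneq k j.
  subst j; have {}nl : n != l by apply: contra nl => /eqP ->.
  have -> : (fun p => rpsi n k p.1 * rpsi l k p.1 * vol p * sin (phase k p.2 - phase k p.2)) =
    (fun=> 0).
    by apply/funext => p; rewrite subrr sin0 mulr0.
  have -> : (fun p => rpsi n k p.1 * rpsi l k p.1 * vol p * cos (phase k p.2 - phase k p.2)) =
    (fun p => rpsi n k p.1 * rpsi l k p.1 * vol p).
    by apply/funext => p; rewrite subrr cos0 mulr1.
  rewrite rint0 rint_fubini//; first exact: (rintegrable_bounded mF hM).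
  by move=> y _; exact: (radial_orth (mexp_ge0 k) n0 l0 nl).
have a0 : (k - j)%:~R != 0 :> R by rewrite intr_eq0 subr_eq0.
pose F x := rpsi n k x * rpsi l j x * (tan x)^-1.
have hF : exists M, forall p, hemi p -> `|F p.1| <= M by exists M => p /hM.
have -> : rint (fun p => rpsi n k p.1 * rpsi l j p.1 * vol p * cos (phase k p.2 - phase j p.2)) = 0.
  rewrite -[RHS](@rint_mode F (k - j)%:~R ((k - j)%:~R * (pi / 2)) a0 hF mF); last by exists (k - j).
  by apply: eq_rint => p _; rewrite phaseB.
have -> : rint (fun p => rpsi n k p.1 * rpsi l j p.1 * vol p * sin (phase k p.2 - phase j p.2)) = 0.
  rewrite -[RHS](@rint_mode F (k - j)%:~R ((k - j)%:~R * (pi / 2) - pi / 2) a0 hF mF); last by exists (k - j).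
  apply: eq_rint => p _; by rewrite phaseB [in RHS]addrA cosBpihalf.
by [].
Qed.

Lemma test_rtest u : test_function u ->
  rtest (fun p => complex.Re (u p)) /\ rtest (fun p => complex.Im (u p)).
Proof.
move=> [su pu [e e0 vu]]; split; split.
- by move=> n; case: (su n).
- by move=> x y; rewrite pu.
- by exists e; split => // x y h; rewrite vu.
- by move=> n; case: (su n).
- by move=> x y; rewrite pu.
- by exists e; split => // x y h; rewrite vu.
Qed.

Notation lapre u := (lap_re b (fun p => complex.Re (u p)) (fun p => complex.Im (u p))).
Notation lapim u := (lap_im b (fun p => complex.Re (u p)) (fun p => complex.Im (u p))).

Lemma magnetic_laplacianE u p :
  magnetic_laplacian b u p = lapre u p +i* lapim u p.
Proof.
have uE : u p = complex.Re (u p) +i* complex.Im (u p) by case: (u p).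
rewrite /magnetic_laplacian uE; exact: complex_laplacian_algebra.
Qed.

(** A convenient sufficient condition for square integrability: if [f] and [f * vol] are bounded, so
    is f^2 vol, on a domain of finite Lebesgue measure. It is stable under linear combinations. *)
Definition bvol (f : R * R -> R) := hmeas f /\
  exists M, forall p, hemi p -> `|f p| <= M /\ `|f p * vol p| <= M.

Lemma bvolD f g : bvol f -> bvol g -> bvol (fun p => f p + g p).
Proof.
move=> [mf [M hM]] [mg [N hN]]; split; first exact: hmeasD.
exists (M + N) => p hp; have [f1 f2] := hM p hp; have [g1 g2] := hN p hp.
split; first by apply: le_trans (ler_normD _ _) _; exact: lerD.
by rewrite mulrDl; apply: le_trans (ler_normD _ _) _; exact: lerD.
Qed.

Lemma bvolZ a f : bvol f -> bvol (fun p => a * f p).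
Proof.
move=> [mf [M hM]]; split; first by apply: hmeasM => //; exact: hmeas_cst.
exists (`|a| * M) => p hp; have [f1 f2] := hM p hp.
by split; rewrite -?mulrA normrM ler_wpM2l.
Qed.

Lemma eq_bvol f g : (forall p, hemi p -> f p = g p) -> bvol f -> bvol g.
Proof.
move=> fg [mf [M hM]]; split; first exact: eq_hmeas mf.
by exists M => p hp; rewrite -fg//; exact: hM.
Qed.

Lemma bvol_sqint u : bvol (fun p => complex.Re (u p)) ->
  bvol (fun p => complex.Im (u p)) -> L u.
Proof.
move=> [m1 [M h1]] [m2 [N h2]]; have mu : hmeasC u by [].
apply/sqintP; split => //; apply: (rintegrable_bounded (M := M * M + N * N)).
  by apply: hmeasM; [exact: hmeas_sqmod|exact: hmeas_vol].
move=> p hp; have [f1 f2] := h1 p hp; have [g1 g2] := h2 p hp.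
rewrite /sqmod mulrDl !expr2 -!mulrA; apply: le_trans (ler_normD _ _) _.
by apply: lerD; rewrite normrM; apply: ler_pM.
Qed.

Lemma rtest_bvol (K : R -> R) g : rtest g ->
  (forall x, 0 < x < pi / 2 -> {for x, continuous K}) ->
  bvol (fun p => K p.1 * g p).
Proof.
move=> tg cK; have cg := rtest_cont tg; have [_ _ [e vg]] := tg.
split; first exact: vanishing_hmeas.
have [M hM] := vanishing_bounded cg vg cK.
have cK' x : 0 < x < pi / 2 -> {for x, continuous (fun x => K x * (tan x)^-1)}.
  by move=> hx; apply: cvgM; [exact: cK|exact: cont_cot].
have [N hN] := vanishing_bounded cg vg cK'.
exists (Num.max M N) => p hp; rewrite !le_max hM// mulrAC /vol.
by split => //; apply/orP; right; exact: hN.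
Qed.

Lemma rtest_bvol1 g : rtest g -> bvol g.
Proof.
move=> tg; apply: (eq_bvol (f := fun p => 1 * g p)) => [p _|]; first by rewrite mul1r.
by apply: (rtest_bvol (K := fun=> 1)) => // x _; exact: cst_continuous.
Qed.

Lemma sqint_test u : test_function u -> L u.
Proof. by move=> /test_rtest[t1 t2]; apply: bvol_sqint; exact: rtest_bvol1. Qed.

Lemma lap_bvol (g h : R * R -> R) c : rtest g -> rtest h ->
  bvol (fun p => 'D_(1, 0) (fun q => 'D_(1, 0) g q) p -
  (sin p.1 * cos p.1)^-1 * 'D_(1, 0) g p + tan p.1 ^+ 2 *
  ('D_(0, 1) (fun q => 'D_(0, 1) g q) p + c * 'D_(0, 1) h p - b ^+ 2 * g p)).
Proof.
move=> tg th; have [_ gx] := rtest_dx tg; have [_ gxx] := rtest_dx gx.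
have [_ gy] := rtest_dy tg; have [_ gyy] := rtest_dy gy; have [_ hy] := rtest_dy th.
have ct x : 0 < x < pi / 2 -> {for x, continuous (fun x : R => tan x ^+ 2)}.
  by move=> hx; apply: isd_cont (isdX 2 (isd_tan hx)).
have B1 := rtest_bvol1 gxx.
have B2 := bvolZ (-1) (rtest_bvol gx (@cont_sincosV R)).
have B3 := rtest_bvol gyy ct.
have B4 := bvolZ c (rtest_bvol hy ct).
have B5 := bvolZ (- b ^+ 2) (rtest_bvol tg ct).
have alg (xx w x t yy y v : R) : xx + -1 * (w * x) +
    (t * yy + (c * (t * y) + - b ^+ 2 * (t * v))) =
    xx - w * x + t * (yy + c * y - b ^+ 2 * v) by ring.
by apply: eq_bvol (bvolD (bvolD B1 B2) (bvolD B3 (bvolD B4 B5))) => p _; exact: alg.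
Qed.

Lemma sqint_lap u : test_function u -> L (fun p => - magnetic_laplacian b u p).
Proof.
move=> /test_rtest[t1 t2]; apply: bvol_sqint.
  apply: eq_bvol (bvolZ (-1) (lap_bvol (2 * b) t1 t2)) => p _.
  by rewrite magnetic_laplacianE /lap_re /= mulN1r.
apply: eq_bvol (bvolZ (-1) (lap_bvol (- (2 * b)) t2 t1)) => p _.
by rewrite magnetic_laplacianE /lap_im /= mulN1r mulNr.
Qed.

Lemma inner_lap_psi n k u : (0 < n)%N -> test_function u ->
  inner (fun p => - magnetic_laplacian b u p) (psi b n k) =
  (lambda b n k)%:C * inner u (psi b n k).
Proof.
move=> n0 tu; have [t1 t2] := test_rtest tu.
have Lp := sqint_psi k n0.
have [i1 i2] := sqint_mulconj (sqint_lap tu) Lp.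
have [j1 j2] := sqint_mulconj (sqint_test tu) Lp.
have pc (y : R) : cos (phase k (y + pi *+ 2)) = cos (phase k y).
  by rewrite phaseD2pi cosD_int.
have ps (y : R) : sin (phase k (y + pi *+ 2)) = sin (phase k y).
  by rewrite phaseD2pi sinD_int.
have dms (y : R) : isd y (fun y => - sin (phase k y)) (- (k%:~R * cos (phase k y))).
  have := isdM (isd_cst y (-1)) (isd_sin_phase k y).
  rewrite mul0r add0r mulN1r.
  suff -> : (fun y => -1 * sin (phase k y)) = (fun y => - sin (phase k y)) by [].
  by apply/funext => t; rewrite mulN1r.
have dcs (y : R) : isd y (fun y => cos (phase k y)) (k%:~R * - sin (phase k y)).
  by apply: isd_eq (isd_cos_phase k y) _; rewrite mulrN.
have pms (y : R) : - sin (phase k (y + pi *+ 2)) = - sin (phase k y) by rewrite ps.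
have [_ w1] := weak_eigen (isd_rpsi n k) (isd_drpsi n k) (erefl _)
  (isd_cos_phase k) (isd_sin_phase k) pc ps t1 t2.
have [_ w2] := weak_eigen (isd_rpsi n k) (isd_drpsi n k) (erefl _)
  dms dcs pms pc t1 t2.
set lam := lambda b n k in w1 w2 *.
have E1 : rint (fun p => complex.Re (- magnetic_laplacian b u p * conjc (psi b n k p)) * vol p) =
    lam * rint (fun p => complex.Re (u p * conjc (psi b n k p)) * vol p).
  apply/eqP; rewrite -subr_eq0 -(rintZ _ j1) -(rintB i1 (rintegrableZ _ j1)) -{}w1.
  apply/eqP/eq_rint => p _; rewrite magnetic_laplacianE psiE /vol.
  case: (u p) (lapre u p) (lapim u p) => u1 u2 l1 l2 /=.
  by congr (_ * _ - _ * (_ * _)); ring.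
have E2 : rint (fun p => complex.Im (- magnetic_laplacian b u p * conjc (psi b n k p)) * vol p) =
    lam * rint (fun p => complex.Im (u p * conjc (psi b n k p)) * vol p).
  apply/eqP; rewrite -subr_eq0 -(rintZ _ j2) -(rintB i2 (rintegrableZ _ j2)) -{}w2.
  apply/eqP/eq_rint => p _; rewrite magnetic_laplacianE psiE /vol.
  case: (u p) (lapre u p) (lapim u p) => u1 u2 l1 l2 /=.
  by congr (_ * _ - _ * (_ * _)); ring.
by rewrite /inner !integralCE E1 E2; simpc.
Qed.

End Eigenfunctions.

(** * Logarithmic cutoffs *)

Section Cutoff.
Variable R : realType.
Notation U := [set x : R | 0 < x < pi / 2].
Implicit Types (L x t : R).

(** The standard bump exp(1 - 1/(1 - t^2)) on (-1, 1), normalized to 1 at 0. The derivative of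
    [flat 0] is [flat 2], which explains [dbump]. *)
Definition bump t : R := expR 1 * flat 0 (1 - t ^+ 2).
Definition dbump t : R := expR 1 * (flat 2 (1 - t ^+ 2) * (- (2 * t))).

Lemma bump0 : bump 0 = 1.
Proof. by rewrite /bump expr0n/= subr0 /flat ltr01 expr0 mul1r invr1 -expRD subrr expR0. Qed.

Lemma bump_ge0 t : 0 <= bump t.
Proof. by rewrite mulr_ge0 ?expR_ge0 ?flat_ge0. Qed.

Lemma bump_le1 t : bump t <= 1.
Proof.
rewrite /bump /flat; case: ifP => [t1|_]; last by rewrite mulr0.
rewrite expr0 mul1r -expRD -[leRHS]expR0 ler_expR subr_le0.
by rewrite invf_ge1// lerBlDr lerDl sqr_ge0.
Qed.

Lemma bump_eq0 t : 1 <= `|t| -> bump t = 0.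
Proof.
move=> t1; rewrite /bump /flat ifF ?mulr0//; apply/negbTE.
by rewrite -leNgt subr_le0 -real_normK ?num_real// exprn_ege1.
Qed.

Lemma isd_bump t : isd t bump (dbump t).
Proof.
have d : isd t (fun t => 1 - t ^+ 2) (- (2 * t)).
  by apply: isd_eq (isdB (isd_cst t 1) (isdX 2 (isd_id t))) _; rewrite sub0r mulr1/= expr1.
have := isdM (isd_cst t (expR 1)) (isd_comp (f := flat 0) (g := fun t => 1 - t ^+ 2) (flat_isd 0 _) d).
by rewrite mul0r add0r mul0r subr0.
Qed.

Lemma dbump_eq0 t : 1 <= `|t| -> dbump t = 0.
Proof.
move=> t1; rewrite /dbump /flat ifF ?mul0r ?mulr0//; apply/negbTE.
by rewrite -leNgt subr_le0 -real_normK ?num_real// exprn_ege1.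
Qed.

Lemma dbump_le t : `|dbump t| <= 4 * expR 1.
Proof.
have [t1|t1] := leP 1 `|t|.
  by rewrite dbump_eq0// normr0 mulr_ge0 ?expR_ge0.
rewrite /dbump normrM (ger0_norm (expR_ge0 _)) mulrC ler_wpM2r ?expR_ge0//.
rewrite normrM (ger0_norm (flat_ge0 _ _)) normrN normrM (ger0_norm (ler0n _ 2)).
(* [flat 2] is at most 2! = 2, and |2 t| is at most 2 on the support. *)
have -> : (4 : R) = 2 * (2 * 1) by ring.
apply: ler_pM; rewrite ?flat_ge0 ?mulr_ge0//; first exact: flat_bound.
by rewrite ler_pM2l// ltW.
Qed.

Lemma CnOn_bump n V : CnOn n V bump.
Proof.
apply: CnOnM; first exact: CnOn_cst.
apply: (@CnOn_comp _ _ _ setT (flat 0) (fun t => 1 - t ^+ 2)) => //; first exact: CnOn_flat.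
by apply: CnOnD; [exact: CnOn_cst|apply: CnOnN; apply: CnOn_X; exact: CnOn_id].
Qed.

Lemma open_pihalf : open U.
Proof.
have -> : U = `]0, (pi / 2)[%classic by apply/seteqP; split => x /=; rewrite in_itv.
exact: interval_open.
Qed.

Lemma CnOn_tan n : CnOn n U tan.
Proof.
apply: CnOnM; first exact: CnOn_sin.
apply: (@CnOn_comp _ _ _ [set x | x != 0] (fun x => x^-1) cos); first by move=> x /= /pihalf_cos /gt_eqF ->.
  exact: CnOn_inv.
exact: CnOn_cos.
Qed.

Definition lntan x : R := ln (tan x).

Lemma tan_gt0 x : 0 < x < pi / 2 -> 0 < tan x.
Proof. by move=> hx; rewrite divr_gt0// ?pihalf_sin ?pihalf_cos. Qed.

Lemma CnOn_lntan n : CnOn n U lntan.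
Proof.
apply: (@CnOn_comp _ _ _ [set x | 0 < x] (@ln R) tan); first by move=> x /tan_gt0.
  exact: CnOn_ln.
exact: CnOn_tan.
Qed.

Lemma isd_lntan x : 0 < x < pi / 2 -> isd x lntan (sin x * cos x)^-1.
Proof.
move=> hx; have t0 := tan_gt0 hx.
apply: isd_eq (isd_comp (f := @ln R) (g := tan) (is_derive1_ln t0) (isd_tan hx)) _.
by rewrite /tan; field; rewrite !gt_eqF ?pihalf_sin ?pihalf_cos.
Qed.

Lemma ltr_tan_pihalf x y : 0 < x < pi / 2 -> 0 < y < pi / 2 ->
  (tan x < tan y) = (x < y).
Proof.
have p0 : - (pi / 2) < 0 :> R by rewrite oppr_lt0 pihalf_gt0.
move=> /andP[x0 x1] /andP[y0 y1]; rewrite ltr_tan// in_itv/= ?x1 ?y1 andbT.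
  by rewrite (lt_trans p0).
by rewrite (lt_trans p0).
Qed.

Lemma atan_pihalf x : 0 < x -> 0 < atan x < pi / 2.
Proof.
move=> x0; rewrite atan_ltpi2 andbT.
rewrite -ltr_tan ?in_itv/= ?atan_ltpi2 ?atan_gtNpi2 ?pihalf_gt0 ?oppr_lt0 ?pihalf_gt0//.
by rewrite tan0 atanK.
Qed.

(* In the variable log tan both ends of (0, pi/2) are infinitely far away, and
   d(log tan) = dx / (sin cos) makes the energy of the cutoff O(1/L). *)
Definition cutoff L x : R := if 0 < x < pi / 2 then bump (lntan x / L) else 0.
Definition cut_lo L : R := atan (expR (- L)).
Definition cut_hi L : R := atan (expR L).

Lemma cut_loP L : 0 < cut_lo L < pi / 2.
Proof. by apply: atan_pihalf; exact: expR_gt0. Qed.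

Lemma cut_hiP L : 0 < cut_hi L < pi / 2.
Proof. by apply: atan_pihalf; exact: expR_gt0. Qed.

Lemma lntan_lo L : lntan (cut_lo L) = - L.
Proof. by rewrite /lntan atanK expRK. Qed.

Lemma lntan_hi L : lntan (cut_hi L) = L.
Proof. by rewrite /lntan atanK expRK. Qed.

Lemma ltr_lntan x y : 0 < x < pi / 2 -> 0 < y < pi / 2 ->
  (lntan x < lntan y) = (x < y).
Proof.
by move=> hx hy; rewrite /lntan ltr_ln ?posrE ?tan_gt0// ltr_tan_pihalf.
Qed.

Lemma cut_lohi L : 0 < L -> cut_lo L < cut_hi L.
Proof.
move=> L0; rewrite -ltr_lntan ?cut_loP ?cut_hiP// lntan_lo lntan_hi; lra.
Qed.

Lemma lntan_out L x : 0 < L -> 0 < x < pi / 2 -> x < cut_lo L \/ cut_hi L < x ->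
  1 <= `|lntan x / L|.
Proof.
move=> L0 hx h; rewrite normrM normfV (gtr0_norm L0) ler_pdivlMr// mul1r.
case: h => h.
  have : lntan x < - L by rewrite -(lntan_lo L) ltr_lntan ?cut_loP.
  by move=> lx; rewrite ler_normr; apply/orP; right; lra.
have : L < lntan x by rewrite -[ltLHS](lntan_hi L) ltr_lntan ?cut_hiP.
by move=> lx; rewrite ler_normr; apply/orP; left; lra.
Qed.

Lemma cutoff_out L x : 0 < L -> x < cut_lo L \/ cut_hi L < x -> cutoff L x = 0.
Proof.
move=> L0 h; rewrite /cutoff; case: ifP => // hx.
by apply: bump_eq0; apply: lntan_out.
Qed.

Lemma cutoff_ge0 L x : 0 <= cutoff L x.
Proof. by rewrite /cutoff; case: ifP => // _; exact: bump_ge0. Qed.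

Lemma cutoff_le1 L x : cutoff L x <= 1.
Proof. by rewrite /cutoff; case: ifP => // _; exact: bump_le1. Qed.

Lemma setT_cover L : 0 < L ->
  setT = U `|` ([set x | x < cut_lo L] `|` [set x | cut_hi L < x]).
Proof.
move=> L0; apply/seteqP; split => // x _.
have /andP[l0 l1] := cut_loP L; have /andP[h0 h1] := cut_hiP L.
have [x0|x0] := leP x 0; first by right; left; rewrite /= (le_lt_trans x0).
have [x1|x1] := ltP x (pi / 2); first by left; rewrite /= x0.
by right; right; rewrite /= (lt_le_trans h1).
Qed.

(** [f] is smooth only inside (0, pi/2), yet the product is smooth on the whole line: it is a
    product of smooth functions inside and 0 beyond [cut_lo] and [cut_hi], and these open sets cover
    the line. *)
Lemma CnOn_cutoff_mul n L (f : R -> R) : 0 < L -> CnOn n U f ->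
  CnOn n setT (fun x => cutoff L x * f x).
Proof.
move=> L0 cf; rewrite (setT_cover L0); apply: CnOnU.
- exact: open_pihalf.
- by apply: openU; [exact: open_lt|exact: open_gt].
- apply: CnOnM => //; apply: (@CnOn_eq _ n U (fun x => bump (lntan x / L))).
  + exact: open_pihalf.
  + by move=> x /= hx; rewrite /cutoff hx.
  + apply: (@CnOn_comp _ _ _ setT bump (fun x => lntan x / L)) => //.
      exact: CnOn_bump.
    by apply: CnOnM; [exact: CnOn_lntan|exact: CnOn_cst].
- apply: (@CnOn_eq _ n _ (fun=> 0)); last exact: CnOn_cst.
  + by apply: openU; [exact: open_lt|exact: open_gt].
  + by move=> x h; rewrite cutoff_out ?mul0r.
Qed.

Lemma CnOn_cutoff n L : 0 < L -> CnOn n setT (cutoff L).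
Proof.
move=> L0; apply: CnOn_ext (CnOn_cutoff_mul L0 (CnOn_cst n U 1)).
by apply/funext => x; rewrite mulr1.
Qed.

Lemma isd_cutoff L x : 0 < x < pi / 2 ->
  isd x (cutoff L) (dbump (lntan x / L) * ((sin x * cos x)^-1 / L)).
Proof.
move=> hx; apply: (@isd_open _ U x (fun x => bump (lntan x / L))) => //.
- exact: open_pihalf.
- by move=> y /= hy; rewrite /cutoff hy.
apply: (isd_comp (f := bump) (g := fun x => lntan x / L)); first exact: isd_bump.
apply: isd_eq (isdM (isd_lntan hx) (isd_cst x L^-1)) _.
by rewrite mulr0 addr0.
Qed.

Lemma CnOn_radial (m : R) p n : CnOn n U (radial m p).
Proof.
apply: CnOnM; last by apply: CnOn_poly; apply: CnOn_X; exact: CnOn_cos.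
apply: (@CnOn_eq _ n U (fun x => expR (m * ln (cos x)))).
- exact: open_pihalf.
- by move=> x /= /pihalf_cos c0; rewrite /powR gt_eqF.
apply: (@CnOn_comp _ _ _ setT expR (fun x => m * ln (cos x))) => //; first exact: CnOn_expR.
apply: CnOnM; first exact: CnOn_cst.
apply: (@CnOn_comp _ _ _ [set x | 0 < x] (@ln R) cos); first by move=> x /pihalf_cos.
  exact: CnOn_ln.
exact: CnOn_cos.
Qed.

Lemma cutoff_cvg x : 0 < x < pi / 2 ->
  (fun n => cutoff n.+1%:R x) @ \oo --> (1 : R).
Proof.
move=> hx; rewrite /cutoff hx.
have cb : {for 0, continuous bump} by apply: isd_cont (isd_bump 0).
have h : (fun n => lntan x / n.+1%:R) @ \oo --> (0 : R).
  rewrite -(mulr0 (lntan x)); apply: cvgM; first exact: cvg_cst.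
  exact: cvg_harmonic.
have := cvg_comp _ _ h cb.
by rewrite bump0.
Qed.

End Cutoff.

(** * Integrals of functions of x alone and the logarithmic weight *)

Section Separated.
Variable R : realType.
Notation mu := (@lebesgue_measure R).

Lemma derive_prod_x (S S' T : R -> R) : (forall x, isd x S (S' x)) ->
  forall p, 'D_(1, 0) (fun q : R * R => S q.1 * T q.2) p = S' p.1 * T p.2.
Proof.
move=> dS [x y]; have : is_derive (x, y) ((1, 0) : R * R) (fun q => S q.1 * T q.2) (S' x * T y).
  by apply/is_derive_fst; apply: isd_eq (isdM (dS x) (isd_cst x (T y))) _; rewrite mulr0 addr0.
by case.
Qed.

Lemma derive_prod_y (S T T' : R -> R) : (forall x, isd x T (T' x)) ->
  forall p, 'D_(0, 1) (fun q : R * R => S q.1 * T q.2) p = S p.1 * T' p.2.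
Proof.
move=> dT [x y]; have : is_derive (x, y) ((0, 1) : R * R) (fun q => S q.1 * T q.2) (S x * T' y).
  by apply/is_derive_snd; apply: isd_eq (isdM (isd_cst y (S x)) (dT y)) _; rewrite mul0r add0r.
by case.
Qed.

Lemma mu_pihalf : mu `]0%R, (pi / 2)%R[ = (pi / 2)%:E.
Proof. by rewrite lebesgue_measure_itv/= lte_fin pihalf_gt0 sube0. Qed.

(** Subtracting the constant with the same mean reduces the claim to vanishing slices. The factor
    [2 / pi * rint (fun=> 1)] is the length of the angular interval, left unevaluated. *)
Lemma rint_fst (f : R -> R) M I :
  measurable_fun (T := measurableTypeR R) `]0, (pi / 2)[%classic f ->
  (forall x, 0 < x < pi / 2 -> `|f x| <= M) ->
  (\int[mu]_(x in `]0%R, (pi / 2)%R[) (f x)%:E = I%:E)%E ->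
  rintegrable (fun p => f p.1) /\ rint (fun p => f p.1) = I * (2 / pi * rint (fun=> 1)).
Proof.
move=> mf fM fI.
have mf1 : hmeas (fun p => f p.1).
  apply: (measurable_comp (F := `]0, (pi / 2)[%classic) _ _ mf).
  - exact: measurable_itv.
  - by move=> _ [p [hp _] <-].
  - by apply: measurable_funTS; exact: measurable_fst.
have i1 : rintegrable (fun p => f p.1).
  by apply: (rintegrable_bounded (M := M)) => // -[x y] /hemiP[hx _]; exact: fM.
pose c := I * (2 / pi).
have ic := rintegrable_cst c; split => //.
apply/eqP; rewrite mulrA -/c -subr_eq0.
have -> : c * rint (fun=> 1) = rint (fun=> c).
  by rewrite -rintZ ?mulr1//; exact: rintegrable_cst.
rewrite -rintB//; apply/eqP/rint_fubini; first exact: rintegrableB.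
move=> y hy /=.
have m0 : measurable (`]0, (pi / 2)[%classic : set (measurableTypeR R)) by exact: measurable_itv.
have fin : (mu `]0%R, (pi / 2)%R[ < +oo)%E by rewrite mu_pihalf ltry.
have if1 : mu.-integrable `]0%R, (pi / 2)%R[ (EFin \o f).
  apply: measurable_bounded_integrable => //.
  exists M; split; first exact: num_real.
  by move=> N MN x; rewrite /= in_itv/= => /fM /le_trans; apply; exact: ltW.
have ic1 : mu.-integrable `]0%R, (pi / 2)%R[ (EFin \o (fun=> c)).
  apply: measurable_bounded_integrable => //.
  exact: bounded_cst.
under eq_integral do rewrite EFinB.
rewrite (integralB_EFin _ if1 ic1)//= fI integral_cst//= mu_pihalf -EFinM -EFinB /c.
by congr (_%:E); rewrite -mulrA mulf_div [2 * _]mulrC divff ?mulr1 ?subrr// mulf_neq0 ?gt_eqF// pi_gt0.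
Qed.

Lemma cut_in (L x : R) : 0 < L -> cut_lo L <= x <= cut_hi L -> 0 < x < pi / 2.
Proof.
move=> L0 /andP[h1 h2]; have /andP[l0 _] := cut_loP L; have /andP[_ l1] := cut_hiP L.
by rewrite (lt_le_trans l0)// (le_lt_trans h2).
Qed.

Definition cutind (L x : R) : R := if cut_lo L <= x <= cut_hi L then 1 else 0.

Lemma cutindE (L x : R) : cutind L x = \1_(`[cut_lo L, cut_hi L]%classic) x.
Proof. by rewrite indicE mem_setE in_itv /cutind; case: ifP. Qed.

Lemma log_integral (L : R) : 0 < L ->
  (\int[mu]_(x in `]0%R, (pi / 2)%R[) (cutind L x * (sin x * cos x)^-1)%:E = (2 * L)%:E)%E.
Proof.
move=> L0; have /andP[l0 _] := cut_loP L; have /andP[_ l1] := cut_hiP L.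
rewrite (integral_support l0 l1); last first.
  move=> x _ h; rewrite /cutind; case: andP => [[h1 h2]|]; last by rewrite mul0r.
  by case: h => h; [rewrite leNgt h in h1|rewrite leNgt h in h2].
transitivity (\int[mu]_(x in `[cut_lo L, cut_hi L]) ((sin x * cos x)^-1)%:E)%E.
  by apply: eq_integral => x; rewrite inE/= in_itv/= => h; rewrite /cutind h mul1r.
rewrite (@ftc _ (@lntan R)).
- by rewrite lntan_lo lntan_hi opprK; congr (_%:E); ring.
- exact: cut_lohi.
- by move=> x /andP[h1 h2]; apply/isd_lntan/(@cut_in L); rewrite // !ltW.
- by move=> x h; apply: isd_cont (isd_lntan (cut_in L0 h)).
- by move=> x h; apply: cont_sincosV; exact: cut_in h.
Qed.

(** 1/(sin cos) = tan + cot, and the tangent lies between e^-L and e^L on this interval. *)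
Lemma sincosV_bound (L x : R) : 0 < L -> cut_lo L <= x <= cut_hi L ->
  (sin x * cos x)^-1 <= 2 * expR L.
Proof.
move=> L0 h; have hx := cut_in L0 h; have s0 := pihalf_sin hx; have c0 := pihalf_cos hx.
have t0 := tan_gt0 hx.
have -> : (sin x * cos x)^-1 = tan x + (tan x)^-1.
  rewrite /tan -{1}(mul1r (sin x * _)^-1) -(cos2Dsin2 x); field; by rewrite !gt_eqF.
case/andP: h => h1 h2.
have t1 : tan x <= expR L.
  by rewrite -[leRHS]atanK leNgt ltr_tan_pihalf ?cut_hiP// -leNgt.
have t2 : expR (- L) <= tan x.
  by rewrite -[leLHS]atanK leNgt ltr_tan_pihalf ?cut_loP// -leNgt.
have t3 : (tan x)^-1 <= expR L.
  by rewrite -[leRHS]invrK lef_pV2 ?posrE ?invr_gt0 ?expR_gt0// -expRN.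
lra.
Qed.

Lemma rint_log (L : R) : 0 < L ->
  rintegrable (fun p => cutind L p.1 * (sin p.1 * cos p.1)^-1) /\
  rint (fun p => cutind L p.1 * (sin p.1 * cos p.1)^-1) =
  2 * L * (2 / pi * rint (fun=> 1 : R)).
Proof.
move=> L0.
pose f x : R := cutind L x * (sin x * cos x)^-1.
apply: (@rint_fst f (2 * expR L)); last exact: log_integral.
  apply: measurable_funM.
    apply: measurable_funTS.
    have -> : cutind L = \1_(`[cut_lo L, cut_hi L]%classic : set (measurableTypeR R)).
      by apply/funext => x; exact: cutindE.
    exact: measurable_indic.
  apply: open_continuous_measurable_fun; first exact: interval_open.
  by move=> x /set_mem; rewrite /= in_itv/= => hx; exact: cont_sincosV.
move=> x hx; rewrite /f /cutind; case: ifP => h; last by rewrite mul0r normr0 mulr_ge0 ?expR_ge0.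
rewrite mul1r ger0_norm ?(sincosV_bound L0 h)// invr_ge0 mulr_ge0// ltW// ?pihalf_sin ?pihalf_cos//.
Qed.

End Separated.

(** * The eigenfunctions lie in the form domain *)

Section Approximation.
Variables (R : realType) (b : R).
Notation nsq := (nsq (@inner R)).
Implicit Types (L x : R).
Variables (n : nat) (k : int).
Hypothesis n0 : (0 < n)%N.
Notation r := (rpsi b n k).

Definition cutpsi L : cfun R := fun p =>
  (cutoff L p.1 * r p.1 * cos (phase b k p.2)) +i*
  (cutoff L p.1 * r p.1 * sin (phase b k p.2)).

Lemma CnOn_phase j V : CnOn j V (phase b k).
Proof.
apply: CnOnD; last exact: CnOn_cst.
by apply: CnOnM; [exact: CnOn_cst|exact: CnOn_id].
Qed.

Lemma CnOn_cut j L : 0 < L -> CnOn j setT (fun x => cutoff L x * r x).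
Proof. by move=> L0; apply: CnOn_cutoff_mul => //; exact: CnOn_radial. Qed.

Definition cut_edge L : R := Num.min (cut_lo L) (pi / 2 - cut_hi L).

Lemma cut_edgeP L : 0 < L ->
  0 < cut_edge L /\ forall x, x < cut_edge L \/ pi / 2 - cut_edge L < x -> x < cut_lo L \/ cut_hi L < x.
Proof.
move=> L0; have /andP[l0 _] := cut_loP L; have /andP[_ l1] := cut_hiP L; split.
  by rewrite lt_min l0 subr_gt0.
move=> x [h|h]; [left; apply: lt_le_trans h _; by rewrite ge_min lexx|right].
have h' : cut_edge L <= pi / 2 - cut_hi L by rewrite ge_min lexx orbT.
lra.
Qed.

Lemma test_cutpsi L : 0 < L -> test_function (cutpsi L).
Proof.
move=> L0; split.
- move=> j; split.
    apply: (@Ck_prod R j (fun x => cutoff L x * r x) (fun y => cos (phase b k y))).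
      exact: CnOn_cut.
    by apply: (@CnOn_comp R j setT setT) => //; [exact: CnOn_cos|exact: CnOn_phase].
  apply: (@Ck_prod R j (fun x => cutoff L x * r x) (fun y => sin (phase b k y))).
    exact: CnOn_cut.
  by apply: (@CnOn_comp R j setT setT) => //; [exact: CnOn_sin|exact: CnOn_phase].
- by move=> x y; rewrite /cutpsi/= phaseD2pi cosD_int sinD_int.
- have [e0 he] := cut_edgeP L0; exists (cut_edge L) => // x y /he h.
  by rewrite /cutpsi/= (cutoff_out L0 h) !mul0r.
Qed.

Lemma sqmod_cutpsi L p : sqmod (cutpsi L p) = (cutoff L p.1 * r p.1) ^+ 2.
Proof.
by rewrite /sqmod /= !exprMn -mulrDr cos2Dsin2 mulr1.
Qed.

(** The angular terms k^2, -2bk and b^2 combine to (k - b)^2, and the phases drop out through cos^2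
    + sin^2 = 1. *)
Lemma lap_cutpsi L S1 S2 p :
  (forall x, isd x (fun x => cutoff L x * r x) (S1 x)) ->
  (forall x, isd x S1 (S2 x)) ->
  complex.Re (- magnetic_laplacian b (cutpsi L) p * conjc (cutpsi L p)) =
  (- S2 p.1 + (sin p.1 * cos p.1)^-1 * S1 p.1 +
    tan p.1 ^+ 2 * (k%:~R - b) ^+ 2 * (cutoff L p.1 * r p.1)) * (cutoff L p.1 * r p.1).
Proof.
move=> d1 d2; rewrite magnetic_laplacianE /lap_re /lap_im /=.
have ds (y : R) : isd y (fun y => - (k%:~R * sin (phase b k y))) (- (k%:~R ^+ 2 * cos (phase b k y))).
  have -> : (fun y => - (k%:~R * sin (phase b k y))) = (fun y => - k%:~R * sin (phase b k y)).
    by apply/funext => t; rewrite mulNr.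
  apply: isd_eq (isdM (isd_cst y (- k%:~R)) (isd_sin_phase b k y)) _.
  by rewrite mul0r add0r mulrA mulNr -expr2 mulNr.
have dc (y : R) : isd y (fun y => k%:~R * cos (phase b k y)) (- (k%:~R ^+ 2 * sin (phase b k y))).
  apply: isd_eq (isdM (isd_cst y k%:~R) (isd_cos_phase b k y)) _.
  by rewrite mul0r add0r mulrN mulrA -expr2.
pose C := fun y => cos (phase b k y); pose D := fun y => sin (phase b k y).
pose S x := cutoff L x * r x.
have X1 T q := derive_prod_x T d1 q; have X2 T q := derive_prod_x T d2 q.
have Y1 q := derive_prod_y S (isd_cos_phase b k) q.
have Y2 q := derive_prod_y S (isd_sin_phase b k) q.
have := derive_prod_y S dc p; have := derive_prod_y S ds p.
have := Y1 p; have := Y2 p; have := funext Y1; have := funext Y2.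
have := X2 D p; have := X2 C p; have := X1 D p; have := X1 C p.
have := funext (X1 C); have := funext (X1 D); rewrite /S /C /D.
rewrite /= => -> -> -> -> /= -> -> -> -> -> -> /= -> ->.
have := cos2Dsin2 (phase b k p.2); move: (cos _) (sin (phase b k p.2)) => c s cs.
set s0 := _ * r _; set w := (_ * _)^-1; set t := tan _ ^+ 2.
rewrite [RHS](_ : _ = (- S2 p.1 + w * S1 p.1 + t * (k%:~R - b) ^+ 2 * s0) * s0 * (c ^+ 2 + s ^+ 2)).
  ring.
by rewrite cs mulr1.
Qed.

Notation rho := (radial (mexp b k) (dradial (mexp b k) (hpoly (mexp b k) n))).

(** [cutgrad] is the derivative of the cutoff chi, and [cuterr] the density |chi'|^2 |psi|^2 vol of
    the energy excess. *)
Definition cutgrad L x : R := dbump (lntan x / L) * ((sin x * cos x)^-1 / L).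
Definition cuterr L x : R := cutgrad L x ^+ 2 * r x ^+ 2 * (tan x)^-1.

(** With |psi| <= M sin^2 the weights combine to (4 e M)^2 tan(x) / L^2, and tan <= tan + cot =
    1/(sin cos), whose integral over the support of the cutoff is 2L. *)
Lemma cuterr_le : exists2 c, 0 <= c & forall L x, 0 < L -> 0 < x < pi / 2 ->
  0 <= cuterr L x <= c / L ^+ 2 * (cutind L x * (sin x * cos x)^-1).
Proof.
have [M M0 hM] := rpsi_bound b k n0.
exists ((4 * expR 1 * M) ^+ 2); first exact: sqr_ge0.
move=> L x L0 hx; have s0 := pihalf_sin hx; have c0 := pihalf_cos hx.
have t0 := tan_gt0 hx; have w0 : 0 < (sin x * cos x)^-1 by rewrite invr_gt0 mulr_gt0.
have ct0 : 0 <= (tan x)^-1 by rewrite invr_ge0 ltW.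
apply/andP; split.
  by apply: mulr_ge0 => //; apply: mulr_ge0; exact: sqr_ge0.
rewrite /cutind; case: ifPn => h; last first.
  rewrite mul0r mulr0 /cuterr /cutgrad dbump_eq0 ?mul0r ?expr0n ?mul0r//.
  apply: lntan_out => //; move: h; rewrite negb_and -!ltNge => /orP[]; [left|right] => //.
rewrite mul1r /cuterr /cutgrad.
have h1 : dbump (lntan x / L) ^+ 2 <= (4 * expR 1) ^+ 2.
  rewrite -(real_normK (num_real (dbump _))); apply: lerXn2r (dbump_le _); rewrite nnegrE// mulr_ge0 ?expR_ge0//.
have h2 : r x ^+ 2 <= (M * sin x ^+ 2) ^+ 2.
  rewrite -(real_normK (num_real (r x))); apply: lerXn2r (hM x); rewrite nnegrE// mulr_ge0 ?sqr_ge0//.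
have k0 : 0 <= ((sin x * cos x)^-1 / L) ^+ 2 * (tan x)^-1.
  by rewrite mulr_ge0 ?sqr_ge0.
apply: (@le_trans _ _ ((4 * expR 1) ^+ 2 * (M * sin x ^+ 2) ^+ 2 *
    (((sin x * cos x)^-1 / L) ^+ 2 * (tan x)^-1))).
  rewrite (exprMn _ (dbump _)) -mulrA -(mulrA (dbump _ ^+ 2)) [X in _ * X](_ : _ =
    r x ^+ 2 * (((sin x * cos x)^-1 / L) ^+ 2 * (tan x)^-1)); last by rewrite mulrCA mulrA.
  rewrite mulrA; apply: ler_wpM2r => //; apply: ler_pM; rewrite ?sqr_ge0//.
have -> : (4 * expR 1) ^+ 2 * (M * sin x ^+ 2) ^+ 2 *
    (((sin x * cos x)^-1 / L) ^+ 2 * (tan x)^-1) = (4 * expR 1 * M) ^+ 2 / L ^+ 2 * tan x.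
  by rewrite /tan; field; rewrite !gt_eqF.
rewrite ler_wpM2l ?divr_ge0 ?sqr_ge0//.
have -> : (sin x * cos x)^-1 = tan x + (tan x)^-1.
  rewrite /tan -{1}(mul1r (sin x * _)^-1) -(cos2Dsin2 x); field; by rewrite !gt_eqF.
by rewrite lerDl.
Qed.

Lemma cont_lntan L x : 0 < x < pi / 2 -> {for x, continuous (fun x => lntan x / L)}.
Proof.
by move=> hx; apply: isd_cont (isdM (isd_lntan hx) (isd_cst x L^-1)).
Qed.

Lemma cont_dbump : continuous (@dbump R).
Proof.
move=> t; suff : CnOn 0 setT (@dbump R) by case=> /(_ t I).
apply: CnOnM; first exact: CnOn_cst.
apply: CnOnM; last by apply/CnOnN/CnOnM; [exact: CnOn_cst|exact: CnOn_id].
apply: (@CnOn_comp R 0 setT setT (flat 2) (fun t => 1 - t ^+ 2)) => //; first exact: CnOn_flat.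
by apply: CnOnD; [exact: CnOn_cst|apply: CnOnN; apply: CnOn_X; exact: CnOn_id].
Qed.

Lemma cont_cutgrad L x : 0 < x < pi / 2 -> {for x, continuous (cutgrad L)}.
Proof.
move=> hx; apply: cvgM; last by apply: cvgM; [exact: cont_sincosV|exact: cvg_cst].
by apply: (@cvg_comp _ _ _ (fun x => lntan x / L) (@dbump R) _ (nbhs (lntan x / L)));
  [exact: cont_lntan|exact: cont_dbump].
Qed.

Lemma cont_cuterr L x : 0 < x < pi / 2 -> {for x, continuous (cuterr L)}.
Proof.
move=> hx; have cr := isd_cont (isd_rpsi b n k hx); have cg := @cont_cutgrad L x hx.
by apply: cvgM; [apply: cvgM; apply: cvgM|exact: cont_cot].
Qed.

Lemma rint_cuterr : exists2 c, 0 <= c & forall L, 0 < L ->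
  rintegrable (fun p => cuterr L p.1) /\ rint (fun p => cuterr L p.1) <= c / L.
Proof.
have [c c0 hc] := cuterr_le; pose K : R := 2 / pi * rint (fun=> 1 : R).
have K0 : 0 <= K.
  by apply: mulr_ge0; [rewrite divr_ge0// (ltW (pi_gt0 R))|exact: rint_ge0].
exists (c * 2 * K); first by apply: mulr_ge0 => //; exact: mulr_ge0.
move=> L L0; have [i1 e1] := rint_log L0.
have i2 := rintegrableZ (c / L ^+ 2) i1.
have ie : rintegrable (fun p => cuterr L p.1).
  apply: rintegrable_le i2 _.
    by apply: hmeas_x => x; rewrite in_itv/= => hx; exact: cont_cuterr.
  by move=> [x y] /hemiP[hx _] /=; have /andP[h1 h2] := hc L x L0 hx; rewrite ger0_norm.
split => //; apply: (@le_trans _ _ (rint (fun p => c / L ^+ 2 * (cutind L p.1 * (sin p.1 * cos p.1)^-1)))).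
  by apply: le_rint => // -[x y] /hemiP[hx _] /=; have /andP[] := hc L x L0 hx.
rewrite rintZ// e1 -/K; suff -> : c / L ^+ 2 * (2 * L * K) = c * 2 * K / L by [].
by field; rewrite gt_eqF.
Qed.

(* IMS localization.  With s, c, t the sine, cosine and tangent, q' = t rh, h the
   cutoff and S = h q, the energy density of h q exceeds l (h q)^2 / t by
   h'^2 q^2 / t up to the exact derivative of h^2 q rh - S S' / t. *)
Lemma ims_algebra (F : fieldType) (s c t S S1 S2 h h1 q rh m2 l : F) : s != 0 -> c != 0 ->
  t = s / c -> S = h * q -> S1 = h1 * q + h * (t * rh) ->
  - ((S1 * S1 + S * S2) * t^-1 + S * S1 * - (s ^+ 2)^-1 -
     ((h1 * h + h * h1) * (q * rh) + h * h * (t * rh * rh + q * ((m2 * t - l * t^-1) * q)))) =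
  (- S2 + (s * c)^-1 * S1 + t ^+ 2 * m2 * S) * S * t^-1 - l * (S ^+ 2 * t^-1) -
  h1 ^+ 2 * q ^+ 2 * t^-1.
Proof. by move=> s0 c0 -> -> ->; field; rewrite s0 c0. Qed.

(** The difference of the two sides is the integral of [f], which is the x-derivative of [F]; and
    [F] vanishes near both ends. *)
Lemma cutpsi_energy L : 0 < L ->
  complex.Re (inner (fun p => - magnetic_laplacian b (cutpsi L) p) (cutpsi L)) =
  lambda b n k * nsq (cutpsi L) + rint (fun p => cuterr L p.1).
Proof.
move=> L0; have tw := test_cutpsi L0.
have [cS [S1 d1 [cS1 [S2 d2 [cS2 _]]]]] := CnOn_cut 2 L0.
pose S x := cutoff L x * r x.
have hS1 x : 0 < x < pi / 2 -> S1 x = cutgrad L x * r x + cutoff L x * (tan x * rho x).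
  by move=> hx; apply: isd_unique (d1 x I) (isdM (isd_cutoff L hx) (isd_rpsi b n k hx)).
pose lam := lambda b n k.
pose E x := - S2 x + (sin x * cos x)^-1 * S1 x + tan x ^+ 2 * (k%:~R - b) ^+ 2 * S x.
pose f x := E x * S x * (tan x)^-1 - lam * (S x ^+ 2 * (tan x)^-1) - cuterr L x.
pose F x := - (S x * S1 x * (tan x)^-1 - cutoff L x * cutoff L x * (r x * rho x)).
have dF x : 0 < x < pi / 2 -> isd x F (f x).
  move=> hx; have s0 := pihalf_sin hx; have c0 := pihalf_cos hx.
  have dc := isd_cutoff L hx; have dr := isd_rpsi b n k hx.
  have dS : isd x S (S1 x) by exact: d1.
  have D := isdB (isdM (isdM dS (d2 x I)) (isd_cot hx))
    (isdM (isdM dc dc) (isdM dr (isd_drpsi b n k hx))).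
  have D1 := isdM (isd_cst x (-1)) D.
  have -> : F = (fun x => -1 * (S x * S1 x * (tan x)^-1 -
      cutoff L x * cutoff L x * (r x * rho x))).
    by apply/funext => t; rewrite mulN1r.
  apply: isd_eq D1 _; rewrite mul0r add0r mulN1r /f /E /cuterr.
  by apply: (@ims_algebra _ (sin x) (cos x)); rewrite ?gt_eqF// hS1.
have cSx x : {for x, continuous S} by exact: cS.
have cE x : 0 < x < pi / 2 -> {for x, continuous E}.
  move=> hx; apply: cvgD; first (apply: cvgD; first by apply: cvgN; exact: cS2).
    by apply: cvgM; [exact: cont_sincosV|exact: cS1].
  apply: cvgM; last exact: cS.
  apply: cvgM; last exact: cvg_cst.
  by apply: cvgM; exact: cont_tan.
have cf x : 0 < x < pi / 2 -> {for x, continuous f}.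
  move=> hx; have cc := cont_cot hx; have ce := cE x hx.
  apply: cvgB; last exact: cont_cuterr.
  apply: cvgB; first by apply: cvgM; [apply: cvgM => //; exact: cSx|].
  apply: cvgM; first exact: cvg_cst.
  by apply: cvgM; [apply: cvgM; exact: cSx|].
have [e0 he] := cut_edgeP L0.
have S0 x : x < cut_edge L \/ pi / 2 - cut_edge L < x -> S x = 0.
  by move=> /he /(cutoff_out L0) h; rewrite /S h mul0r.
have err0 x : 0 < x < pi / 2 -> x < cut_edge L \/ pi / 2 - cut_edge L < x -> cuterr L x = 0.
  move=> hx /he /(lntan_out L0 hx) h.
  by rewrite /cuterr /cutgrad dbump_eq0// mul0r expr0n !mul0r.
have cSp : continuous (fun p : R * R => S p.1).
  by move=> p; apply: (@cvg_comp _ _ _ fst S _ (nbhs p.1)); [exact: cvg_fst|exact: cS].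
have vS : vanishing (fun p : R * R => S p.1) (cut_edge L).
  by split => // x y /S0.
have [c _ /(_ L L0)[ie _]] := rint_cuterr.
have iE : rintegrable (fun p => E p.1 * S p.1 * (tan p.1)^-1).
  apply: eq_rintegrable (@vanishing_integrable R (fun x => E x * (tan x)^-1) _ _ cSp vS _).
    by move=> p _ /=; rewrite mulrAC.
  by move=> x hx; apply: cvgM; [exact: cE|exact: cont_cot].
have iS : rintegrable (fun p => S p.1 ^+ 2 * (tan p.1)^-1).
  apply: eq_rintegrable (@vanishing_integrable R (fun x => S x * (tan x)^-1) _ _ cSp vS _).
    by move=> p _ /=; rewrite mulrAC -expr2.
  by move=> x hx; apply: cvgM; [exact: cSx|exact: cont_cot].
have f0 : rint (fun p => f p.1) = 0.
  apply: rint_fubini.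
    by apply: rintegrableB => //; apply: rintegrableB => //; exact: rintegrableZ.
  move=> y _; apply: (@ftc_support _ F _ (cut_edge L)) => //.
  - exact: pihalf_gt0.
  - move=> x hx h; rewrite /F S0//; have -> : cutoff L x = 0 by move/he: h => /(cutoff_out L0).
    by rewrite !mul0r subr0 oppr0.
  - by move=> x hx h; rewrite /f err0// S0// expr0n !(mul0r, mulr0) !subr0.
have -> : complex.Re (inner (fun p => - magnetic_laplacian b (cutpsi L) p) (cutpsi L)) =
    rint (fun p => E p.1 * S p.1 * (tan p.1)^-1).
  rewrite /inner integralCE /=; apply: eq_rint => p _.
  have := @lap_cutpsi L S1 S2 p (fun x => d1 x I) (fun x => d2 x I).
  by rewrite /= => ->.
rewrite nsq_inner -/lam.
have -> : rint (fun p => sqmod (cutpsi L p) * vol p) = rint (fun p => S p.1 ^+ 2 * (tan p.1)^-1).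
  by apply: eq_rint => p _; rewrite sqmod_cutpsi.
apply/eqP; rewrite -subr_eq0 -(rintZ lam iS) opprD addrA -(rintB iE (rintegrableZ lam iS)).
by rewrite -rintB ?f0//; apply: rintegrableB => //; exact: rintegrableZ.
Qed.

Lemma cutpsi_cvg : (fun j => nsq (cutpsi j.+1%:R - psi b n k)) @ \oo --> (0 : R).
Proof.
have /sqintP[_ ipsi] := sqint_psi b k n0.
have E j : nsq (cutpsi j.+1%:R - psi b n k) =
    rint (fun p => (cutoff j.+1%:R p.1 - 1) ^+ 2 * (sqmod (psi b n k p) * vol p)).
  rewrite nsq_inner; apply: eq_rint => p _; rewrite mulrA; congr (_ * _).
  have -> : (cutpsi j.+1%:R - psi b n k) p = cutpsi j.+1%:R p - psi b n k p by [].
  by rewrite psiE /sqmod /cutpsi /=; ring.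
rewrite (_ : (fun j => _) = fun j => rint (fun p => (cutoff j.+1%:R p.1 - 1) ^+ 2 *
    (sqmod (psi b n k p) * vol p))); last by apply/funext.
rewrite -(rint0 R).
apply: (rint_dominated (g := fun p => sqmod (psi b n k p) * vol p) _ _ _ ipsi _).2.
- move=> j; apply: hmeasM; last exact: rintegrable_measurable ipsi.
  apply: (@hmeas_x R (fun x => (cutoff j.+1%:R x - 1) ^+ 2)) => x _.
  have [cc _] := CnOn_cutoff 0 (ltr0Sn R j).
  have h : {for x, continuous (fun x => cutoff j.+1%:R x - 1 : R)}.
    by apply: cvgB; [exact: cc|exact: cvg_cst].
  by apply: cvgM.
- exact: hmeas_cst.
- apply: nearW => -[x y] /hemiP[hx _] /=.
  rewrite [X in _ --> X](_ : _ = (1 - 1) ^+ 2 * (sqmod (psi b n k (x, y)) * vol (x, y))); last first.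
    by rewrite subrr expr0n mul0r.
  have h : (fun j => cutoff j.+1%:R x - 1) @ \oo --> (1 - 1 : R).
    by apply: cvgB; [exact: cutoff_cvg|exact: cvg_cst].
  by apply: cvgM; [apply: cvgM|exact: cvg_cst].
- move=> j p hp; have v0 := vol_gt0 hp.
  have q0 : 0 <= sqmod (psi b n k p) * vol p by rewrite mulr_ge0 ?sqmod_ge0// ltW.
  rewrite normrM (ger0_norm q0) ler_piMl// ger0_norm ?sqr_ge0//.
  have := @cutoff_ge0 R j.+1%:R p.1; have := @cutoff_le1 R j.+1%:R p.1.
  move: (cutoff _ _) => a a1 a0; nra.
Qed.

Lemma psi_approx e : 0 < e -> exists w, [/\ test_function w, nsq (w - psi b n k) < e &
  complex.Re (inner (fun p => - magnetic_laplacian b w p) w) < lambda b n k * nsq w + e].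
Proof.
move=> e0; have [c c0 hc] := rint_cuterr.
have h : (fun j => c * j.+1%:R^-1) @ \oo --> (0 : R).
  by rewrite -(mulr0 c); apply: cvgM; [exact: cvg_cst|exact: cvg_harmonic].
near \oo => j.
exists (cutpsi j.+1%:R); split.
- exact: test_cutpsi.
- by near: j; apply: cvgr_lt cutpsi_cvg _ e0.
- rewrite cutpsi_energy// ltrD2l; have [_ h2] := hc j.+1%:R (ltr0Sn R j).
  apply: le_lt_trans h2 _; near: j; exact: cvgr_lt h _ e0.
Unshelve. all: by end_near. Qed.

End Approximation.

(** * Moments and completeness in one variable *)

Section PolynomialStep.
Variable R : realType.
Implicit Types (s t u : R).

(** 1 - u^n is 1 - u times a sum of n powers of u, each at least u^n. *)
Lemma mulr_expr_le u n : 0 <= u < 1 -> n%:R * u ^+ n * (1 - u) <= 1.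
Proof.
move=> /andP[u0 u1]; apply: (@le_trans _ _ (1 - u ^+ n)); last by rewrite gerBl exprn_ge0.
have -> : 1 - u ^+ n = (\sum_(i < n) u ^+ i) * (1 - u).
  by apply: oppr_inj; rewrite opprB subrX1 -mulrN opprB mulrC.
rewrite ler_wpM2r ?subr_ge0 ?(ltW u1)// mulr_natl -[X in _ *+ X](card_ord n) -sumr_const.
by apply: ler_sum => i _; apply: ler_wiXn2l; rewrite ?(ltW u1)// ltnW.
Qed.

(** With u = v^2, the product n v^n stays below 1/(1 - v) while the remaining factor v^n tends to
    0. *)
Lemma cvg_mulr_expr u : 0 <= u < 1 -> (fun n => n%:R * u ^+ n) @ \oo --> (0 : R).
Proof.
move=> /andP[u0 u1]; pose v := Num.sqrt u.
have v0 : 0 <= v by exact: sqrtr_ge0.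
have uE : u = v * v by rewrite -expr2 sqr_sqrtr.
have v1 : v < 1 by rewrite -sqrtr1 ltr_sqrt.
have d0 : 0 < 1 - v by rewrite subr_gt0.
have h : (fun n => (1 - v)^-1 * v ^+ n) @ \oo --> (0 : R).
  rewrite -(mulr0 (1 - v)^-1); apply: cvgM; first exact: cvg_cst.
  by apply: cvg_expr; rewrite ger0_norm.
apply: (squeeze_cvgr _ (cvg_cst 0) h); apply: nearW => n.
rewrite mulr_ge0 ?exprn_ge0//= uE exprMn mulrA ler_wpM2r ?exprn_ge0//.
by rewrite -[leRHS]mul1r ler_pdivlMr// mulr_expr_le// v0.
Qed.

Lemma bernoulli_ge u n : 0 <= u -> 1 + n%:R * u <= (1 + u) ^+ n.
Proof.
move=> u0; elim: n => [|n IH]; first by rewrite mul0r addr0 expr0.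
rewrite exprS; apply: le_trans (ler_wpM2l _ IH); last by rewrite addr_ge0.
have : 0 <= n%:R * u ^+ 2 by rewrite mulr_ge0 ?sqr_ge0.
rewrite -natr1; lra.
Qed.

Lemma bernoulli_le u n : 0 <= u <= 1 -> 1 - n%:R * u <= (1 - u) ^+ n.
Proof.
move=> /andP[u0 u1]; elim: n => [|n IH]; first by rewrite mul0r subr0 expr0.
rewrite exprS; apply: le_trans (ler_wpM2l _ IH); last by rewrite subr_ge0.
have : 0 <= n%:R * u ^+ 2 by rewrite mulr_ge0 ?sqr_ge0.
rewrite -natr1; lra.
Qed.

(* By Bernoulli's inequality 1 - (1 - t^n)^(n ceil(s^-n)) tends to 0 for t < s and
   to 1 for t >= s. *)
Definition step_mult s n : nat := (n * (Num.truncn (s ^- n)).+1)%N.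
Definition step_poly s n : {poly R} := 1 - (1 - 'X^n) ^+ step_mult s n.

Lemma step_polyE s n t : (step_poly s n).[t] = 1 - (1 - t ^+ n) ^+ step_mult s n.
Proof. by rewrite /step_poly -polyC1 !(hornerD, hornerN, horner_exp, hornerX, hornerC). Qed.

Lemma step_poly_bound s n t : 0 <= t <= 1 -> 0 <= (step_poly s n).[t] <= 1.
Proof.
move=> /andP[t0 t1]; rewrite step_polyE.
have h0 : 0 <= 1 - t ^+ n by rewrite subr_ge0 exprn_ile1.
have h1 : 1 - t ^+ n <= 1 by rewrite gerBl exprn_ge0.
by apply/andP; split; [rewrite subr_ge0 exprn_ile1|rewrite gerBl exprn_ge0].
Qed.

Lemma step_poly_cvg s t : 0 < s < 1 -> 0 <= t <= 1 ->
  (fun n => (step_poly s n).[t]) @ \oo --> (if s <= t then 1 else 0 : R).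
Proof.
move=> /andP[s0 s1] /andP[t0 t1].
have K n : s ^- n <= (Num.truncn (s ^- n)).+1%:R <= s ^- n + 1.
  have s0n : 0 <= s ^- n by rewrite invr_ge0 exprn_ge0 // ltW.
  have /andP[h1 h2] := truncn_itv s0n.
  by rewrite (ltW h2) -natr1 lerD2r.
have un n : 0 <= t ^+ n <= 1 by rewrite exprn_ge0// exprn_ile1.
case: leP => [st|ts].
- have h : (fun n => 1 - n.+1%:R^-1 : R) @ \oo --> (1 : R).
    rewrite -[X in _ --> X]subr0; apply: cvgB; [exact: cvg_cst|exact: cvg_harmonic].
  apply: (squeeze_cvgr _ h (cvg_cst (1 : R))); apply: nearW => n.
  have t01 : 0 <= t <= 1 by rewrite t0.
  have /andP[_ ->] := step_poly_bound s n t01; rewrite andbT step_polyE lerD2l lerN2.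
  have /andP[u0 u1] := un n; set u := t ^+ n; set M := step_mult s n.
  (* For t >= s, M t^n >= n (t/s)^n >= n, so (1 - u)^M <= (1 + u)^-M <= 1/(1 + n). *)
  have Mu : n%:R <= M%:R * u.
    rewrite /M natrM -mulrA ler_peMr//; have /andP[h1 _] := K n.
    apply: le_trans (ler_wpM2r u0 h1); rewrite mulrC ler_pdivlMr ?exprn_gt0// mul1r.
    by rewrite lerXn2r// nnegrE // ltW.
  have p1 : 0 < (1 + u) ^+ M by rewrite exprn_gt0// ltr_pwDl.
  apply: (@le_trans _ _ (((1 + u) ^+ M)^-1)).
    rewrite -[leRHS]mul1r ler_pdivlMr// -exprMn.
    have -> : (1 - u) * (1 + u) = 1 - u ^+ 2 by ring.
    by rewrite exprn_ile1 ?subr_ge0 ?exprn_ile1// gerBl sqr_ge0.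
  rewrite lef_pV2 ?posrE//; apply: le_trans (bernoulli_ge _ u0).
  by rewrite -natr1 addrC lerD2l.
(* For t < s, M t^n <= n (t/s)^n + n t^n; the second term is the cost of rounding s^-n up to an
   integer. *)
- have h1 : (fun n => n%:R * (t / s) ^+ n + n%:R * t ^+ n) @ \oo --> (0 + 0 : R).
    apply: cvgD; apply: cvg_mulr_expr; last by rewrite t0 (lt_trans ts).
    by rewrite divr_ge0// ?(ltW s0)// ltr_pdivrMr// mul1r.
  rewrite addr0 in h1.
  apply: (squeeze_cvgr _ (cvg_cst (0 : R)) h1); apply: nearW => n.
  have t01 : 0 <= t <= 1 by rewrite t0.
  have /andP[-> _] /= := step_poly_bound s n t01; rewrite step_polyE lerBlDr -lerBlDl.
  apply: le_trans (bernoulli_le (step_mult s n) (un n)); rewrite lerD2l lerN2.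
  have /andP[u0 u1] := un n; have /andP[_ h2] := K n.
  rewrite /step_mult natrM -mulrA -mulrDr; apply: ler_wpM2l => //.
  apply: le_trans (ler_wpM2r u0 h2) _.
  by rewrite mulrDl mul1r exprMn exprVn mulrC.
Qed.

End PolynomialStep.

#[global] Instance lebesgue_ae_filter (R : realType) :
  Filter (nbhs (almost_everywhere (@lebesgue_measure R))).
Proof. exact: ae_filter_ringOfSetsType. Qed.

Lemma lebesgue_aeI (R : realType) (P Q : R -> Prop) :
  {ae (@lebesgue_measure R), forall x, P x} -> {ae (@lebesgue_measure R), forall x, Q x} ->
  {ae (@lebesgue_measure R), forall x, P x /\ Q x}.
Proof. by move=> hP hQ; apply: filterS2 hP hQ => x. Qed.

(** * Functions whose moments vanish *)

Section Moments.
Variable R : realType.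
Notation mu := (@lebesgue_measure R).
Implicit Types (A h tau : R -> R).
Notation integ A := (mu.-integrable setT (EFin \o A)).

Lemma integ_mul A h M : integ A -> measurable_fun setT h -> (forall x, `|h x| <= M) ->
  integ (fun x => A x * h x).
Proof.
move=> iA mh hM; have mA : measurable_fun setT A by apply/measurable_EFinP; exact: measurable_int iA.
have M0 : 0 <= M by apply: le_trans (hM 0).
apply: (le_integrable measurableT) (integrableZl measurableT M iA).
  by apply/measurable_EFinP; exact: measurable_funM.
move=> x _ /=; rewrite lee_fin !normrM (ger0_norm M0) mulrC ler_wpM2r//.
Qed.

Lemma moment_step A tau (s : R) : integ A -> measurable_fun setT tau ->
  (forall x, 0 <= tau x <= 1) -> 0 < s < 1 ->
  (forall p : {poly R}, \int[mu]_x (A x * p.[tau x]) = 0) ->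
  \int[mu]_x (A x * (if s <= tau x then 1 else 0)) = 0.
Proof.
move=> iA mt t01 s01 A0.
have mA : measurable_fun setT A by apply/measurable_EFinP; exact: measurable_int iA.
have mp n : measurable_fun setT (fun x => (step_poly s n).[tau x]).
  apply: (@measurableT_comp _ _ _ _ _ _ (horner (step_poly s n))) => //.
  apply: continuous_measurable_fun => t; exact: isd_cont (isd_poly (step_poly s n) t).
have ms : measurable_fun setT (fun x => if s <= tau x then 1 else 0 : R).
  apply: measurable_fun_if => //; exact: (measurable_fun_ler (measurable_cst s) mt).
have := @dominated_convergence _ _ _ mu _ measurableT
  (fun n => EFin \o (fun x => A x * (step_poly s n).[tau x]))
  (EFin \o (fun x => A x * (if s <= tau x then 1 else 0))) (EFin \o (fun x => `|A x|)).
case=> //.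
- by move=> n; apply/measurable_EFinP; exact: (measurable_funM mA (mp n)).
- by apply/measurable_EFinP; exact: (measurable_funM mA ms).
- apply: aeW => x _; apply: cvg_EFin; first exact: nearW.
  by apply: cvgM; [exact: cvg_cst|exact: step_poly_cvg].
- exact: (integrable_norm iA).
- apply: aeW => x n _; rewrite /= lee_fin normrM ler_piMr//.
  by have /andP[h0 h1] := step_poly_bound s n (t01 x); rewrite ger0_norm.
move=> iF _ h.
have : (fun n => \int[mu]_x (A x * (step_poly s n).[tau x])) @ \oo -->
    \int[mu]_x (A x * (if s <= tau x then 1 else 0)).
  apply: fine_cvg; rewrite fineK; first exact: h.
  by apply: integrable_fin_num.
under eq_fun do rewrite A0.
by move=> /(cvg_lim (@Rhausdorff R)) <-; rewrite lim_cst.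
Qed.

Lemma ae_eq0_primitive A c : integ A ->
  (forall d, 0 < d < c -> \int[mu]_(x in `]-oo, d]) A x = 0) ->
  {ae mu, forall x, 0 < x < c -> A x = 0}.
Proof.
move=> iA A0; have iA' y : mu.-integrable `]-oo, y] (EFin \o A).
  by apply: integrableS iA.
have lA : locally_integrable setT A by apply: open_integrable_locally => //; exact: openT.
have := FTC1Ny iA' lA; apply: filterS => x [dF Fx] hx.
have h : isd x (fun y => \int[mu]_(t in [set` `]-oo, y]]) A t) (A x).
  by rewrite -Fx derive1E; exact: derivableP.
apply: isd_unique (isd_open _ _ _ h) (isd_cst x 0).
- exact: (@interval_open _ (BRight 0) (BLeft c)).
- by rewrite /= in_itv.
- by move=> y /=; rewrite in_itv/= => /A0.
Qed.

(** On (0, pi/2) the superlevel set of cos^2 at level cos(d)^2 is (0, d], so the polynomial step at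
    that level produces the primitive at [d]. The positive weight cos^m is absorbed into the
    function and divided out at the end. *)
Lemma radial_complete A (m : R) : 0 <= m -> integ A ->
  (forall x, ~~ (0 < x < pi / 2) -> A x = 0) ->
  (forall p : {poly R}, \int[mu]_x (A x * cos x `^ m * p.[cos x ^+ 2]) = 0) ->
  {ae mu, forall x, A x = 0}.
Proof.
move=> m0 iA Aout A0.
have mc : measurable_fun setT (fun x : R => cos x `^ m).
  apply: (@measurableT_comp _ _ _ _ _ _ (@powR R ^~ m) _ cos); first exact: measurable_powR.
  by apply: continuous_measurable_fun; exact: continuous_cos.
have mt : measurable_fun setT (fun x : R => cos x ^+ 2).
  by apply: continuous_measurable_fun => x; apply: isd_cont (isdX 2 (is_derive_cos x)).
have iB : integ (fun x => A x * cos x `^ m).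
  apply: (integ_mul (M := 1)) => // x; rewrite ger0_norm ?powR_ge0//; exact: powRcos_le1.
suff : {ae mu, forall x, 0 < x < pi / 2 -> A x * cos x `^ m = 0}.
  apply: filterS => x h; have [hx|hx] := boolP (0 < x < pi / 2); last exact: Aout.
  by have /eqP := h hx; rewrite mulf_eq0 (gt_eqF (powR_gt0 _ (pihalf_cos hx))) orbF => /eqP.
apply: ae_eq0_primitive => // d hd.
have c0 := pihalf_cos hd; have s0 := pihalf_sin hd.
have s01 : 0 < cos d ^+ 2 < 1.
  by rewrite exprn_gt0//= -(cos2Dsin2 d) ltrDl exprn_gt0.
rewrite -[RHS](moment_step iB mt (fun x => cos2_itv x) s01 A0) Rintegral_mkcond.
apply: eq_Rintegral => x _; rewrite patchE mem_setE in_itv/=.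
have [hx|/Aout ->] := boolP (0 < x < pi / 2); last by rewrite !mul0r; case: ifP.
have itv t : 0 < t < pi / 2 -> t \in `[0, pi].
  by rewrite in_itv/= => /andP[t0 t1]; rewrite (ltW t0)/=; have := pi_gt0 R; lra.
have -> : (cos d ^+ 2 <= cos x ^+ 2) = (x <= d).
  rewrite ler_sqr ?nnegrE ?(ltW c0) ?(ltW (pihalf_cos hx))//.
  by rewrite leNgt ltr_cos ?itv// -leNgt.
by case: ifP => _; rewrite ?mulr1 ?mulr0.
Qed.

(** [tau] peaks at d/2, and its superlevel set at level [s] is exactly [0, d] within one period.
    Polynomials in [tau] are trigonometric polynomials, so their moments against [A] vanish. *)
Lemma trig_complete A : integ A ->
  (forall y, ~~ (0 <= y < pi *+ 2) -> A y = 0) ->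
  (forall k : int, \int[mu]_y (A y * cos (k%:~R * y)) = 0 /\
                   \int[mu]_y (A y * sin (k%:~R * y)) = 0) ->
  {ae mu, forall y, A y = 0}.
Proof.
move=> iA Aout A0.
suff : {ae mu, forall y, 0 < y < pi *+ 2 -> A y = 0}.
  have h0 : {ae mu, forall y : R, y != 0}.
    exists [set 0]; split; [exact: measurable_set1|exact: lebesgue_measure_set1|].
    by move=> y /= /negP; rewrite negbK => /eqP.
  move: h0; apply: filterS2 => y y0 h.
  have [hy|/Aout//] := boolP (0 <= y < pi *+ 2).
  by apply: h; rewrite lt_neqAle eq_sym y0.
apply: ae_eq0_primitive => // d /andP[d0 d1].
have d2 : 0 < d / 2 < pi by rewrite divr_gt0//= ltr_pdivrMr// mulr_natr.
pose tau y := (1 + cos (y - d / 2)) / 2 : R; pose s := (1 + cos (d / 2)) / 2.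
have cd : continuous (fun y : R => cos (y - d / 2)).
  move=> y; apply: (@continuous_comp _ _ _ (fun y : R => y - d / 2) (@cos R)); last exact: continuous_cos.
  by apply: cvgB; [exact: cvg_id|exact: cvg_cst].
have ct : continuous tau.
  move=> y; apply: cvgM; last exact: cvg_cst.
  by apply: cvgD; [exact: cvg_cst|exact: cd].
have mt : measurable_fun setT tau by exact: continuous_measurable_fun.
have t01 y : 0 <= tau y <= 1.
  by have := cos_geN1 (y - d / 2); have := cos_le1 (y - d / 2); rewrite /tau; lra.
have ccs (k : int) th : measurable_fun setT (fun y : R => cos (k%:~R * y + th)).
  apply: continuous_measurable_fun => y.
  apply: (@continuous_comp _ _ _ (fun y : R => k%:~R * y + th) (@cos R)); last exact: continuous_cos.
  by apply: cvgD; [apply: cvgM; [exact: cvg_cst|exact: cvg_id]|exact: cvg_cst].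
have css (k : int) : measurable_fun setT (fun y : R => sin (k%:~R * y)).
  apply: continuous_measurable_fun => y.
  apply: (@continuous_comp _ _ _ (fun y : R => k%:~R * y) (@sin R)); last exact: continuous_sin.
  by apply: cvgM; [exact: cvg_cst|exact: cvg_id].
have cosb (t : R) : `|cos t| <= 1 by rewrite ler_norml cos_geN1 cos_le1.
have sinb (t : R) : `|sin t| <= 1 by rewrite ler_norml sin_geN1 sin_le1.
pose Z h := integ h /\ \int[mu]_y h y = 0.
have ZD f g : Z f -> Z g -> Z (fun y => f y + g y).
  move=> [f1 f2] [g1 g2]; split; first exact: (integrableD measurableT f1 g1).
  by rewrite RintegralD// f2 g2 addr0.
have ZZ a f : Z f -> Z (fun y => a * f y).
  move=> [f1 f2]; split; first exact: (integrableZl measurableT a f1).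
  by rewrite RintegralZl// f2 mulr0.
have Zeq f g : f =1 g -> Z f -> Z g by move=> /funext ->.
have Zc (k : int) th : Z (fun y => A y * cos (k%:~R * y + th)).
  have [z1 z2] := A0 k; have c0 := ccs k 0.
  have Z1 : Z (fun y => A y * cos (k%:~R * y)).
    split => //; apply: (integ_mul (M := 1)) => //.
    by under eq_fun do rewrite -[_ * _]addr0.
  have Z2 : Z (fun y => A y * sin (k%:~R * y)).
    by split => //; exact: (integ_mul (M := 1)).
  apply: Zeq (ZD _ _ (ZZ (cos th) _ Z1) (ZZ (- sin th) _ Z2)) => y.
  by rewrite cosD; ring.
(* Multiplying a cosine by [tau] gives 1/2 of it plus 1/4 of the cosines at the two neighbouring
   frequencies, so the induction runs over all frequencies and phases at once. *)
have Zp (p : {poly R}) : forall (k : int) th, Z (fun y => A y * p.[tau y] * cos (k%:~R * y + th)).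
  elim/poly_ind: p => [|p c IH] k th.
    by apply: Zeq (ZZ 0 _ (Zc k th)) => y; rewrite horner0 mulr0 !mul0r.
  apply: Zeq (ZD _ _ (ZD _ _ (ZZ (1 / 2) _ (IH k th))
    (ZD _ _ (ZZ (1 / 4) _ (IH (k + 1) (th - d / 2))) (ZZ (1 / 4) _ (IH (k - 1) (th + d / 2)))))
    (ZZ c _ (Zc k th))) => y.
  rewrite hornerMXaddC.
  have -> : (k + 1)%:~R * y + (th - d / 2) = (k%:~R * y + th) + (y - d / 2).
    by rewrite intrD; ring.
  have -> : (k - 1)%:~R * y + (th + d / 2) = (k%:~R * y + th) - (y - d / 2).
    by rewrite intrB; ring.
  by rewrite (cosD (_ + th)) (cosB (_ + th)) /tau; field.
have Z0 (p : {poly R}) : \int[mu]_y (A y * p.[tau y]) = 0.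
  have [_ <-] := Zp p 0 0; apply: eq_Rintegral => y _.
  by rewrite mul0r addr0 cos0 mulr1.
have itv t : 0 <= t <= pi -> t \in `[0, pi :> R] by rewrite in_itv.
have s01 : 0 < s < 1.
  have /andP[e0 e1] := d2; have pi0 := pi_ge0 R.
  have h1 : cos (d / 2) < 1 by rewrite -[ltRHS]cos0 ltr_cos ?itv ?lexx ?pi0 ?(ltW e0) ?(ltW e1).
  have h2 : -1 < cos (d / 2) by rewrite -[ltLHS]cospi ltr_cos ?itv ?lexx ?pi0 ?(ltW e0) ?(ltW e1).
  rewrite /s; lra.
rewrite -[RHS](moment_step iA mt t01 s01 Z0) Rintegral_mkcond.
apply: eq_Rintegral => y _; rewrite patchE mem_setE in_itv/=.
have [hy|/Aout ->] := boolP (0 <= y < pi *+ 2); last by rewrite !mul0r; case: ifP.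
have -> : (s <= tau y) = (y <= d).
  have -> : (s <= tau y) = (cos (d / 2) <= cos (y - d / 2)).
    by rewrite /s /tau ler_pM2r ?invr_gt0// lerD2l.
  case/andP: d2 => e0 e1; case/andP: hy => y0 y1; rewrite mulr2n in y1.
  have [yd|yd] := leP y d.
    have -> : cos (y - d / 2) = cos `|y - d / 2|.
      by case: ler0P => _ //; rewrite cosN.
    have yb : `|y - d / 2| <= d / 2 by rewrite ler_norml; lra.
    by rewrite leNgt ltr_cos ?itv -?leNgt ?normr_ge0 //=; lra.
  apply/negbTE; rewrite -ltNge.
  (* Past the antipode of d/2 the cosine increases again; the angle is reflected to 2 pi - (y -
     d/2), which still exceeds d/2 because y < 2 pi. *)
  have [yp|yp] := leP (y - d / 2) pi.
    by rewrite ltr_cos ?itv//; lra.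
  have -> : cos (y - d / 2) = cos (pi *+ 2 - (y - d / 2)).
    by rewrite -cosN -(cosD2pi (- _)); congr cos; ring.
  by rewrite mulr2n ltr_cos ?itv//; lra.
by case: ifP => _; rewrite ?mulr1 ?mulr0.
Qed.

End Moments.

(** * Completeness of the eigenfunctions *)

Section Slices.
Variable R : realType.
Notation mu := (@lebesgue_measure R).
Notation plane := (measurableTypeR R * measurableTypeR R)%type.
Notation hemi := (@hemi R : set plane).
Notation leb2 := (@leb2 R).
Implicit Types (u : R * R -> R) (A B G : R -> R).
Notation integ A := (mu.-integrable setT (EFin \o A)).
Notation integ2 u := (leb2.-integrable setT (EFin \o u)).

Lemma ae_eq_RintegralT A B : integ A -> integ B -> {ae mu, forall x, A x = B x} ->
  \int[mu]_x A x = \int[mu]_x B x.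
Proof.
move=> iA iB AB; rewrite /Rintegral; congr fine.
apply: ae_eq_integral => //.
- exact: measurable_int iA.
- exact: measurable_int iB.
- by move: AB; apply: filterS => x /= -> .
Qed.

Definition slice u x : R := \int[mu]_y u (x, y).

Lemma slice_ae u : integ2 u -> {ae mu, forall x, integ (fun y => u (x, y))}.
Proof. by move=> iu; exact: (ae_integrable1 iu). Qed.

Lemma slice_integ u : integ2 u -> integ (slice u).
Proof.
move=> iu; have iF := integrable_fubini_F iu.
apply: (le_integrable measurableT) iF.
  apply/measurable_EFinP; apply: measurableT_comp; first exact: fine_measurable.
  exact: (measurable_fubini_F iu).
(* [fine] sends infinite values to 0, so [slice] is dominated by the extended-real slice
   integral. *)
move=> x _ /=; rewrite /slice /Rintegral /fubini_F.
by case: (integral _ _ _) => [r| |] //=; rewrite normr0 ?leey.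
Qed.

Lemma slice_int u : integ2 u -> \int[mu]_x slice u x = \int[leb2]_p u p.
Proof.
move=> iu; rewrite /Rintegral -(integral12_prod_meas1 iu); congr fine.
apply: ae_eq_integral => //.
- exact: measurable_int (slice_integ iu).
- exact: measurable_int (integrable_fubini_F iu).
- have := slice_ae iu; apply: filterS => x ix _; rewrite /slice /Rintegral /= fineK//.
  exact: integrable_fin_num.
Qed.

Lemma integ2_mul u (h : R * R -> R) M : integ2 u -> measurable_fun (setT : set plane) h ->
  (forall x, `|h x| <= M) -> integ2 (fun x => u x * h x).
Proof.
move=> iA mh hM; have mA : measurable_fun (setT : set plane) u.
  by apply/measurable_EFinP; exact: measurable_int iA.
have M0 : 0 <= M by apply: le_trans (hM (0, 0)).
apply: (le_integrable measurableT) (integrableZl measurableT M iA).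
  by apply/measurable_EFinP; exact: measurable_funM.
move=> x _ /=; rewrite lee_fin !normrM (ger0_norm M0) mulrC ler_wpM2r//.
Qed.

Lemma slice_mul u G M : integ2 u -> measurable_fun (setT : set (measurableTypeR R)) G ->
  (forall x, `|G x| <= M) ->
  \int[mu]_x (slice u x * G x) = \int[leb2]_p (u p * G p.1).
Proof.
move=> iu mG GM.
have iG : integ2 (fun p => u p * G p.1).
  by apply: (integ2_mul (M := M)) => //; apply: measurableT_comp => //; exact: measurable_fst.
rewrite -(slice_int iG); apply: ae_eq_RintegralT.
- by apply: (integ_mul (M := M)) => //; exact: slice_integ.
- exact: slice_integ.
- have := slice_ae iu; apply: filterS => x ix.
  by rewrite /slice /= RintegralZr.
Qed.

(** Extension by 0, which makes the slices integrals over the whole line, as in the one-variable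
    completeness lemmas. *)
Definition ext u : R * R -> R := u \_ (hemi : set (R * R)).

Lemma extE u p : hemi p -> ext u p = u p.
Proof. by move=> hp; rewrite /ext patchE mem_set. Qed.

Lemma ext_out u p : ~ hemi p -> ext u p = 0.
Proof. by move=> hp; rewrite /ext patchE memNset. Qed.

Lemma ext_integ u : rintegrable u -> integ2 (ext u).
Proof.
move=> /(integrable_mkcond _ (@measurable_hemi R)); rewrite /ext.
by rewrite restrict_EFin.
Qed.

Lemma ext_int u : \int[leb2]_p ext u p = rint u.
Proof. by rewrite /rint [RHS]Rintegral_mkcond. Qed.

End Slices.

Section Total.
Variables (R : realType) (b : R).
Notation mu := (@lebesgue_measure R).
Notation plane := (measurableTypeR R * measurableTypeR R)%type.
Notation hemi := (@hemi R : set plane).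
Notation nsq := (nsq (@inner R)).
Notation L := (@square_integrable R).
Implicit Types (k : int) (p : {poly R}).
Variable f : cfun R.
Hypothesis Lf : L f.
Hypothesis f_orth : forall n k, (0 < n)%N -> inner f (psi b n k) = 0.

Definition modef k p : cfun R := fun z =>
  (radial (mexp b k) p z.1 * cos (phase b k z.2)) +i*
  (radial (mexp b k) p z.1 * sin (phase b k z.2)).

(** [hpoly_ind] carries the orthogonality from the hypergeometric polynomials to all polynomials
    vanishing at 1. *)
Lemma modef_orth k p : p.[1] = 0 -> L (modef k p) /\ inner (modef k p) f = 0.
Proof.
have Ph n : (0 < n)%N -> L (modef k (hpoly (mexp b k) n)) /\
    inner (modef k (hpoly (mexp b k) n)) f = 0.
  move=> n0; have -> : modef k (hpoly (mexp b k) n) = psi b n k.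
    by apply/funext => z; rewrite psiE.
  split; first exact: sqint_psi.
  by rewrite (inner_conj Lf (sqint_psi b k n0)) f_orth//; apply/eqP; rewrite eq_complex /= oppr0 !eqxx.
have Pl a (q r : {poly R}) : L (modef k q) /\ inner (modef k q) f = 0 ->
    L (modef k r) /\ inner (modef k r) f = 0 ->
    L (modef k (a *: q + r)) /\ inner (modef k (a *: q + r)) f = 0.
  move=> [Lq q0] [Lr r0]; have -> : modef k (a *: q + r) = a%:C *: modef k q + modef k r.
    apply/funext => z; rewrite [RHS](_ : _ = a%:C * modef k q z + modef k r z)//.
    by rewrite /modef /radial hornerD hornerZ; simpc; congr (_ +i* _); ring.
  by split; [exact: sqint_lin|rewrite inner_lin// q0 r0 mulr0 addr0].
apply: (@hpoly_ind R _ (mexp_ge0 b k) (fun p => L (modef k p) /\ inner (modef k p) f = 0)) => //.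
by have := Pl (-1) _ _ (Ph 1%N isT) (Ph 1%N isT); rewrite scaleN1r addNr.
Qed.

(* sin^2 is the factor 1 - cos^2 of the polynomials vanishing at 1; it makes the
   integrals converge at x = 0, where [vol] is not integrable. *)
Definition wre z : R := complex.Re (f z) * (sin z.1 ^+ 2 * vol z).
Definition wim z : R := complex.Im (f z) * (sin z.1 ^+ 2 * vol z).

Lemma w_integrable : rintegrable wre /\ rintegrable wim.
Proof.
have ms : hmeas (fun z : R * R => sin z.1 ^+ 2).
  by apply: (@hmeas_x R (fun x => sin x ^+ 2)) => x _; apply: isd_cont (isdX 2 (is_derive_sin x)).
have Ls : L (fun z => (sin z.1 ^+ 2)%:C).
  apply/sqintP; have mC : hmeasC (fun z : R * R => (sin z.1 ^+ 2)%:C).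
    by split => //; exact: hmeas_cst.
  split => //; apply: (rintegrable_bounded (M := 1)).
    by apply: hmeasM; [exact: hmeas_sqmod|exact: hmeas_vol].
  move=> z hz; have v0 := vol_gt0 hz.
  rewrite sqmod_real expr2 ger0_norm ?sin4_vol//.
  by apply: mulr_ge0 (ltW v0); apply: mulr_ge0; exact: sqr_ge0.
have [i1 i2] := sqint_mulconj Lf Ls; split.
  apply: eq_rintegrable i1 => z _; rewrite /wre; case: (f z) => f1 f2 /=; ring.
apply: eq_rintegrable i2 => z _; rewrite /wim; case: (f z) => f1 f2 /=; ring.
Qed.

(** [wcos] and [wsin] are the real and imaginary parts of conj(w) e^(i k phi), where w = wre + i
    wim. *)
Definition wcos k z : R := wre z * cos (k%:~R * z.2) + wim z * sin (k%:~R * z.2).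
Definition wsin k z : R := wre z * sin (k%:~R * z.2) - wim z * cos (k%:~R * z.2).

(** The arbitrary [p] is multiplied by 1 - X, whose value sin^2 is the factor contained in [wre] and
    [wim]. The constant phase [th] of psi is undone by the rotation with coefficients cos th and sin
    th. *)
Lemma w_orth k p :
  rint (fun z => wcos k z * (cos z.1 `^ mexp b k * p.[cos z.1 ^+ 2])) = 0 /\
  rint (fun z => wsin k z * (cos z.1 `^ mexp b k * p.[cos z.1 ^+ 2])) = 0.
Proof.
have p1 : ((1 - 'X) * p).[1] = 0.
  by rewrite hornerM -polyC1 !(hornerD, hornerN, hornerX, hornerC) subrr mul0r.
have [Lm m0] := modef_orth k p1; have [i1 i2] := sqint_mulconj Lm Lf.
have [j1 j2] : rint (fun z => complex.Re (modef k ((1 - 'X) * p) z * conjc (f z)) * vol z) = 0 /\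
    rint (fun z => complex.Im (modef k ((1 - 'X) * p) z * conjc (f z)) * vol z) = 0.
  by move: m0; rewrite /inner integralCE => -[-> ->].
pose th : R := (k%:~R - b) * (pi / 2).
have pE z : ((1 - 'X) * p).[cos z ^+ 2] = sin z ^+ 2 * p.[cos z ^+ 2].
  rewrite hornerM -polyC1 !(hornerD, hornerN, hornerX, hornerC); congr (_ * _).
  by rewrite -(cos2Dsin2 z) addrC addKr.
have ky z : k%:~R * z = phase b k z - th by rewrite /phase addrK.
split.
- transitivity (rint (fun z =>
    cos th * (complex.Re (modef k ((1 - 'X) * p) z * conjc (f z)) * vol z) +
    sin th * (complex.Im (modef k ((1 - 'X) * p) z * conjc (f z)) * vol z))).
    apply: eq_rint => z _; rewrite /wcos /wre /wim /modef /radial pE ky cosB sinB.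
    by case: (f z) => f1 f2 /=; ring.
  by rewrite rintD ?rintZ ?j1 ?j2 ?mulr0 ?addr0//; exact: rintegrableZ.
- transitivity (rint (fun z =>
    cos th * (complex.Im (modef k ((1 - 'X) * p) z * conjc (f z)) * vol z) +
    - sin th * (complex.Re (modef k ((1 - 'X) * p) z * conjc (f z)) * vol z))).
    apply: eq_rint => z _; rewrite /wsin /wre /wim /modef /radial pE ky cosB sinB.
    by case: (f z) => f1 f2 /=; ring.
  by rewrite rintD ?rintZ ?j1 ?j2 ?mulr0 ?addr0//; exact: rintegrableZ.
Qed.

Lemma slice_radial_ae k (u : R * R -> R) : rintegrable u ->
  (forall p, rint (fun z => u z * (cos z.1 `^ mexp b k * p.[cos z.1 ^+ 2])) = 0) ->
  {ae mu, forall x, slice (ext u) x = 0}.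
Proof.
move=> iu u0; have ie := ext_integ iu; apply: (radial_complete (mexp_ge0 b k)).
- exact: slice_integ.
- move=> x /negP hx; rewrite /slice (_ : (fun y => ext u (x, y)) = fun=> 0).
    by rewrite Rintegral_cst// mul0r.
  by apply/funext => y; rewrite ext_out// => /hemiP[/hx].
- move=> p; have [M M0 hM] := poly_bound p.
  under eq_Rintegral do rewrite -mulrA.
  rewrite (slice_mul (M := M) (G := fun x => cos x `^ mexp b k * p.[cos x ^+ 2]) ie).
  + rewrite -[RHS](u0 p) -ext_int; apply: eq_Rintegral => z _.
    have [hz|hz] := pselect (hemi z); first by rewrite !extE.
    by rewrite !ext_out ?mul0r.
  + apply: measurable_funM.
      apply: (@measurableT_comp _ _ _ _ _ _ (@powR R ^~ (mexp b k)) _ cos); first exact: measurable_powR.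
      by apply: continuous_measurable_fun; exact: continuous_cos.
    apply: continuous_measurable_fun; exact: cont_poly_cos2.
  + move=> x; rewrite normrM -[leRHS]mul1r; apply: ler_pM => //.
      by rewrite ger0_norm ?powR_ge0//; apply: powRcos_le1; exact: mexp_ge0.
    by apply: hM; exact: cos2_itv.
Qed.

Lemma trig_integrable (u : R * R -> R) (T : R -> R) : rintegrable u -> continuous T ->
  (forall y, `|T y| <= 1) -> rintegrable (fun z => u z * T z.2).
Proof.
move=> iu cT T1; apply: rintegrable_le (rintegrable_norm iu) _.
  by apply: hmeasM; [exact: rintegrable_measurable iu|exact: hmeas_y].
by move=> z _; rewrite normrM ler_piMr.
Qed.

Lemma ae_all_int (P : int -> R -> Prop) : (forall k, {ae mu, forall x, P k x}) ->
  {ae mu, forall x, forall k, P k x}.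
Proof.
move=> h; have h1 : {ae mu, forall x, forall n : nat, P (Posz n) x} by apply: ae_foralln => n; exact: h.
have h2 : {ae mu, forall x, forall n : nat, P (Negz n) x} by apply: ae_foralln => n; exact: h.
by move: h1 h2; apply: filterS2 => x x1 x2 [n|n].
Qed.

Lemma psi_total : nsq f = 0.
Proof.
have [ire iim] := w_integrable.
have cc k : continuous (fun y : R => cos (k%:~R * y)).
  move=> y; apply: (@continuous_comp _ _ _ (fun y : R => k%:~R * y) (@cos R)); last exact: continuous_cos.
  by apply: cvgM; [exact: cvg_cst|exact: cvg_id].
have cs k : continuous (fun y : R => sin (k%:~R * y)).
  move=> y; apply: (@continuous_comp _ _ _ (fun y : R => k%:~R * y) (@sin R)); last exact: continuous_sin.
  by apply: cvgM; [exact: cvg_cst|exact: cvg_id].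
have cosb (t : R) : `|cos t| <= 1 by rewrite ler_norml cos_geN1 cos_le1.
have sinb (t : R) : `|sin t| <= 1 by rewrite ler_norml sin_geN1 sin_le1.
have ic k : rintegrable (wcos k).
  apply: rintegrableD.
    by apply: (@trig_integrable wre (fun y => cos (k%:~R * y))).
  by apply: (@trig_integrable wim (fun y => sin (k%:~R * y))).
have is_ k : rintegrable (wsin k).
  apply: rintegrableB.
    by apply: (@trig_integrable wre (fun y => sin (k%:~R * y))).
  by apply: (@trig_integrable wim (fun y => cos (k%:~R * y))).
(* The frequencies are countable, so one null set of x serves all of them. *)
have sc : {ae mu, forall x, forall k, slice (ext (wcos k)) x = 0}.
  by apply: ae_all_int => k; apply: (slice_radial_ae (k := k)) => // p; case: (w_orth k p).
have ss : {ae mu, forall x, forall k, slice (ext (wsin k)) x = 0}.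
  by apply: ae_all_int => k; apply: (slice_radial_ae (k := k)) => // p; case: (w_orth k p).
have ia := slice_ae (ext_integ ire); have ib := slice_ae (ext_integ iim).
have z0 : {ae mu, forall x, {ae mu, forall y, hemi (x, y) -> f (x, y) = 0}}.
  have sss := lebesgue_aeI sc ss; have ii := lebesgue_aeI ia ib.
  have all := lebesgue_aeI sss ii; move: all; apply: filterS => x [[scx ssx] [iax ibx]].
  pose A y := ext wre (x, y); pose B y := ext wim (x, y).
  have mc k : measurable_fun setT (fun y : R => cos (k%:~R * y)) by exact: continuous_measurable_fun.
  have ms k : measurable_fun setT (fun y : R => sin (k%:~R * y)) by exact: continuous_measurable_fun.
  have iAc k := integ_mul iax (mc k) (fun y => cosb _).
  have iAs k := integ_mul iax (ms k) (fun y => sinb _).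
  have iBc k := integ_mul ibx (mc k) (fun y => cosb _).
  have iBs k := integ_mul ibx (ms k) (fun y => sinb _).
  have e1 k : \int[mu]_y (A y * cos (k%:~R * y)) + \int[mu]_y (B y * sin (k%:~R * y)) = 0.
    rewrite -RintegralD// -[RHS](scx k); apply: eq_Rintegral => y _.
    have [hz|hz] := pselect (hemi (x, y)); first by rewrite /A /B !extE.
    by rewrite /A /B !ext_out// !mul0r addr0.
  have e2 k : \int[mu]_y (A y * sin (k%:~R * y)) - \int[mu]_y (B y * cos (k%:~R * y)) = 0.
    rewrite -RintegralB// -[RHS](ssx k); apply: eq_Rintegral => y _.
    have [hz|hz] := pselect (hemi (x, y)); first by rewrite /A /B !extE.
    by rewrite /A /B !ext_out// !mul0r subr0.
  have cN (C : R -> R) k : \int[mu]_y (C y * cos ((- k)%:~R * y)) = \int[mu]_y (C y * cos (k%:~R * y)).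
    by apply: eq_Rintegral => y _; rewrite mulrNz mulNr cosN.
  have sN (C : R -> R) k : mu.-integrable setT (EFin \o (fun y => C y * sin (k%:~R * y))) ->
      \int[mu]_y (C y * sin ((- k)%:~R * y)) = - \int[mu]_y (C y * sin (k%:~R * y)).
    move=> iC; rewrite -[RHS]mulN1r -RintegralZl//; apply: eq_Rintegral => y _.
    by rewrite mulrNz mulNr sinN mulrN mulN1r.
  have out u y : ~~ (0 <= y < pi *+ 2) -> ext u (x, y) = 0.
    by move=> /negP hy; rewrite ext_out// => /hemiP[_ /hy].
  have A0 : {ae mu, forall y, A y = 0}.
    apply: trig_complete => // [y|k]; first exact: out.
    (* The frequencies k and -k together decouple the cosine and sine moments of [A] and [B]. *)
    have := e1 k; have := e1 (- k); have := e2 k; have := e2 (- k).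
    by rewrite !cN !sN//; lra.
  have B0 : {ae mu, forall y, B y = 0}.
    apply: trig_complete => // [y|k]; first exact: out.
    have := e1 k; have := e1 (- k); have := e2 k; have := e2 (- k).
    by rewrite !cN !sN//; lra.
  have AB := lebesgue_aeI A0 B0; move: AB; apply: filterS => y [+ + hz]; rewrite /A /B => Ay By.
  have q0 : sin x ^+ 2 * vol (x, y) != 0.
    by rewrite mulf_neq0 ?expf_neq0// gt_eqF ?vol_gt0//; have := hemi_sin_gt0 hz.
  move: Ay By; rewrite !extE// /wre /wim /=.
  move=> /eqP; rewrite mulf_eq0 (negbTE q0) orbF => /eqP fr.
  move=> /eqP; rewrite mulf_eq0 (negbTE q0) orbF => /eqP fi.
  by case: (f (x, y)) fr fi => f1 f2 /= -> ->.
have /sqintP[_ iv] := Lf.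
rewrite nsq_inner -ext_int -(slice_int (ext_integ iv)).
(* Zero is written as the integral of the zero function so that almost everywhere equal integrands
   can be compared; the same is done inside each slice. *)
rewrite -[RHS](mul0r (fine (mu setT))) -Rintegral_cst//.
apply: ae_eq_RintegralT; first exact: slice_integ (ext_integ iv).
  exact: integrable0.
have := lebesgue_aeI z0 (slice_ae (ext_integ iv)); apply: filterS => x [zx ivx].
rewrite /slice -[RHS](mul0r (fine (mu setT))) -Rintegral_cst//.
apply: ae_eq_RintegralT => //; first exact: integrable0.
move: zx; apply: filterS => y fy; have [hz|hz] := pselect (hemi (x, y)); last by rewrite ext_out.
by rewrite extE// fy// sqmod0 mul0r.
Qed.

End Total.

(** * The spectrum *)

Section TestFunctions.
Variable R : realType.

Lemma Ck_lin (c : R) n (f g : R * R -> R) : Ck n f -> Ck n g -> Ck n (fun p => c * f p + g p).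
Proof.
elim: n f g => [|n IH] f g [cf hf] [cg hg].
  by split => // p; apply: cvgD; [apply: cvgM; [exact: cvg_cst|exact: cf]|exact: cg].
split.
  by move=> p; apply: cvgD; [apply: cvgM; [exact: cvg_cst|exact: cf]|exact: cg].
move=> v hv; have [df cf'] := hf v hv; have [dg cg'] := hg v hv.
have D p : is_derive p v (fun q => c * f q + g q) (c * 'D_v f p + 'D_v g p).
  have h1 := derivableP (df p); have h2 := derivableP (dg p).
  exact: (is_deriveD (is_deriveZ c h1) h2).
split; first by move=> p; case: (D p).
rewrite (_ : (fun p => _) = fun p => c * 'D_v f p + 'D_v g p); first exact: IH.
by apply/funext => p; case: (D p).
Qed.

Lemma test_lin (a : R[i]) (u v : cfun R) : test_function u -> test_function v ->
  test_function (a *: u + v).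
Proof.
case: a => a1 a2 [su pu [d d0 vu]] [sv pv [e e0 vv]].
have E p : ((a1 +i* a2) *: u + v) p = (a1 +i* a2) * u p + v p by [].
split.
- move=> n; have [u1 u2] := su n; have [v1 v2] := sv n; split.
    have -> : (fun p => complex.Re (((a1 +i* a2) *: u + v) p)) = (fun p =>
        a1 * complex.Re (u p) + (- a2 * complex.Im (u p) + complex.Re (v p))).
      by apply/funext => p; rewrite E; case: (u p) (v p) => x y [z t] /=; ring.
    by apply: (Ck_lin _ u1); exact: (Ck_lin _ u2).
  have -> : (fun p => complex.Im (((a1 +i* a2) *: u + v) p)) = (fun p =>
      a1 * complex.Im (u p) + (a2 * complex.Re (u p) + complex.Im (v p))).
    by apply/funext => p; rewrite E; case: (u p) (v p) => x y [z t] /=; ring.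
  by apply: (Ck_lin _ u2); exact: (Ck_lin _ u1).
- by move=> x y; rewrite !E pu pv.
- exists (Num.min d e); first by rewrite lt_min d0.
  move=> x y h; rewrite E vu ?vv ?mulr0 ?addr0//.
    by case: h => h; [left; move: h; rewrite lt_min => /andP[]|right; apply: le_lt_trans h; rewrite lerD2l lerN2 ge_min lexx ?orbT].
  by case: h => h; [left; move: h; rewrite lt_min => /andP[]|right; apply: le_lt_trans h; rewrite lerD2l lerN2 ge_min lexx ?orbT].
Qed.

Lemma Ck_cst n (c : R) : Ck n (fun=> c).
Proof.
elim: n c => [|n IH] c; (split; first by move=> p; exact: cst_continuous) => //.
move=> v hv; split; first by move=> p; exact: derivable_cst.
have -> : (fun p => 'D_v (fun=> c) p) = (fun=> 0 : R) by apply/funext => p; rewrite derive_cst.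
exact: IH.
Qed.

Lemma test0 : test_function (0 : cfun R).
Proof.
by split => //; [move=> n; split; exact: Ck_cst|exists 1].
Qed.

End TestFunctions.

HB.instance Definition _ := isPointed.Build int 0.

(** * Enumeration of the pairs (n, k) *)

Section Enumeration.

Lemma nat_int_bij : exists en : nat -> nat * int, bijective en.
Proof.
have h : ([set: nat] #= [set: nat * int])%card.
  apply: card_esym; apply: eq_card_nat; first exact: countableP.
  apply/infiniteP. apply/pcard_leTP/injPex; exists (fun n => (n, 0 : int)) => // m n _ _ [].
  done.
have /card_set_bijP[f fb] := h.
by exists f; rewrite -setTT_bijective.
Qed.

End Enumeration.

(** * The normalized eigenbasis and the spectrum of the Friedrichs operator *)

Section Spectrum.
Variables (R : realType) (b : R).
Notation nsq := (nsq (@inner R)).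
Notation L := (@square_integrable R).
Notation D := (@test_function R).
Notation H := (fun (u : cfun R) p => - magnetic_laplacian b u p).
Variables (en : nat -> nat * int) (en_inv : nat * int -> nat).
Hypotheses (enK : cancel en en_inv) (en_invK : cancel en_inv en).
Implicit Types (u v f : cfun R) (z : R[i]).

(** [en] enumerates all pairs of a natural number and an integer; the successor shifts the first
    component to n >= 1. *)
Definition mode i : cfun R := psi b (en i).1.+1 (en i).2.
Definition lam i : R := lambda b (en i).1.+1 (en i).2.
Definition scale i : R := (Num.sqrt (nsq (mode i)))^-1.
Definition basis i : cfun R := (scale i)%:C *: mode i.

Lemma L_mode i : L (mode i).
Proof. exact: sqint_psi. Qed.

Lemma L_basis i : L (basis i).
Proof. exact: (L_scale (sqint0 R) (@sqint_lin R)) (L_mode i). Qed.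

Lemma nsq_mode_gt0 i : 0 < nsq (mode i).
Proof.
rewrite lt_neqAle nsq_ge0 andbT eq_sym; apply/eqP => /(nsq_eq0 (L_mode i)).
exact: psi_neq0.
Qed.

Lemma scale_gt0 i : 0 < scale i.
Proof. by rewrite invr_gt0 sqrtr_gt0 nsq_mode_gt0. Qed.

Lemma mode_basis i : mode i = (scale i)^-1%:C *: basis i.
Proof.
rewrite /basis scalerA -real_complexM mulVf ?scale1r// gt_eqF//; exact: scale_gt0.
Qed.

Lemma basis_orth i j : inner (basis i) (basis j) = (i == j)%:R.
Proof.
have l0 := sqint0 R; have ll := @sqint_lin R; have li := @inner_lin R; have lc := @inner_conj R.
rewrite /basis (ipZ l0 li)//; last exact: L_basis; last exact: L_mode.
rewrite (ipZr l0 ll li lc)//; try exact: L_mode.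
case: eqVneq => [<-|ij].
  rewrite (nsqE lc)//; last exact: L_mode.
  rewrite conjc_real -!real_complexM /scale; congr (_%:C).
  have n0 := nsq_mode_gt0 i; rewrite mulrA -invfM -expr2 sqr_sqrtr ?(ltW n0)// mulVf// gt_eqF//.
rewrite psi_orth ?mulr0//; apply: contra_neq ij => -[h1 h2].
by rewrite -(enK i) -(enK j) (surjective_pairing (en i)) (surjective_pairing (en j)) h1 h2.
Qed.

Lemma basis_total u : L u -> (forall i, inner u (basis i) = 0) -> nsq u = 0.
Proof.
move=> Lu u0; apply: (@psi_total R b) => // n k n0.
have := u0 (en_inv (n.-1, k)); rewrite /basis (ipZr (sqint0 R) (@sqint_lin R) (@inner_lin R) (@inner_conj R))//;
  last exact: L_mode.
rewrite conjc_real /mode en_invK /= prednK// => /eqP; rewrite mulf_eq0 => /orP[|/eqP//].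
by have := scale_gt0 (en_inv (n.-1, k)); rewrite lt_def eq_complex /= eqxx andbT => /andP[/negbTE ->].
Qed.

(** The worst case is n = 1 and k = b; 4 is the constant [c0] given to the abstract theory. *)
Lemma lam_ge4 i : 4 <= lam i.
Proof.
rewrite /lam /lambda; have h := normr_ge0 ((en i).2%:~R - b).
have n1 : 1 <= (en i).1.+1%:R :> R by rewrite ler1n.
move: h n1; move: `|_| _%:R => x y; nra.
Qed.

Lemma lap_coef u i : D u -> inner (H u) (basis i) = (lam i)%:C * inner u (basis i).
Proof.
move=> Du; rewrite /basis !(ipZr (sqint0 R) (@sqint_lin R) (@inner_lin R) (@inner_conj R)) ?inner_lap_psi//.
- by rewrite mulrCA.
- exact: L_mode.
- exact: sqint_test.
- exact: L_mode.
- exact: sqint_lap.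
Qed.

Lemma basis_approx i r : 0 < r -> exists w, [/\ D w, nsq (w - basis i) < r &
  complex.Re (inner (H w) w) < lam i * nsq w + r].
Proof.
move=> r0; set c := scale i; have c0 : 0 < c := scale_gt0 i.
have l0 := sqint0 R; have ll := @sqint_lin R; have li := @inner_lin R; have lc := @inner_conj R.
(* Rescaling by [c] multiplies the squared norm and the form by c^2. *)
have [|w [Dw w1 w2]] := @psi_approx R b (en i).1.+1 (en i).2 isT (r / c ^+ 2).
  by rewrite divr_gt0// exprn_gt0.
have Lw := sqint_test Dw; have LH := sqint_lap b Dw.
have Dcw : D (c%:C *: w).
  by have := test_lin (c%:C) Dw (test0 R); rewrite addr0.
have Lcw := sqint_test Dcw; have LHc := sqint_lap b Dcw.
have LcH : L (c%:C *: H w) by exact: (L_scale l0 ll).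
(* Homogeneity of the Laplacian is obtained through coefficients: both functions pair equally with
   every basis vector, so their difference is null. *)
have Hc : inner (H (c%:C *: w)) (c%:C *: w) = inner (c%:C *: H w) (c%:C *: w).
  apply/eqP; rewrite -subr_eq0 -(ipB l0 ll li)//; apply/eqP.
  apply: (nsq_eq0_ip l0 ll li lc (@inner_ge0 R)) => //; first exact: (L_sub l0 ll).
  apply: basis_total; first exact: (L_sub l0 ll).
  move=> j; have Lj := L_basis j.
  rewrite (ipB l0 ll li)// lap_coef// !(ipZ l0 li)// lap_coef//.
  by rewrite mulrCA subrr.
have c2 : 0 < c ^+ 2 by rewrite exprn_gt0.
exists (c%:C *: w); split => //.
  rewrite /basis -scalerBr (nsqZ l0 ll li lc)//; last first.
    by apply: (L_sub l0 ll) => //; exact: L_mode.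
  by rewrite sqmod_real mulrC -ltr_pdivlMr.
rewrite Hc (ipZ l0 li)// (ipZr l0 ll li lc)// conjc_real mulrA -real_complexM Re_realM.
rewrite (nsqZ l0 ll li lc)// sqmod_real -expr2.
move: w2; rewrite -(ltr_pM2l c2) mulrDr [c ^+ 2 * (r / _)]mulrC divfK ?gt_eqF// mulrCA.
by [].
Qed.

Lemma norm2_cvg0 (v : nat -> cfun R) :
  (fun j => norm2 (v j)) @ \oo --> (0 : R) <-> (fun j => nsq (v j)) @ \oo --> (0 : R).
Proof.
under eq_fun do rewrite norm2E; split=> h; last first.
  by have := cvg_comp _ _ h (@sqrt_continuous R 0); rewrite sqrtr0.
have -> : (fun j => nsq (v j)) = (fun j => Num.sqrt (nsq (v j)) * Num.sqrt (nsq (v j))).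
  by apply/funext => j; rewrite -expr2 sqr_sqrtr// nsq_ge0.
by rewrite -(mulr0 (0 : R)); apply: cvgM.
Qed.

Lemma form_approxE u w : form_approx b u w <-> fapprox (@inner R) D H u w.
Proof.
split=> -[Dw nw cw]; split => //; first exact/(norm2_cvg0 (fun j => w j - u)).
exact/(norm2_cvg0 (fun j => w j - u)).
Qed.

Lemma form_domainE u : form_domain b u <-> fdom L (@inner R) D H u.
Proof. by split=> -[Lu [w /form_approxE wa]]; split => //; exists w. Qed.

Lemma friedrichsE u f : friedrichs b u f <-> fried L (@inner R) D H u f.
Proof.
split=> -[/form_domainE du Lf h]; split => // v /form_domainE dv wu wv
  /form_approxE au /form_approxE av; exact: h.
Qed.

Lemma friedrichsP u f : friedrichs b u f <->
  [/\ L u, L f & forall i, inner f (basis i) = (lam i)%:C * inner u (basis i)].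
Proof.
have P := @friedP R _ L (@inner R) (sqint0 R) (@sqint_lin R) (@inner_lin R) (@inner_conj R)
  (@inner_ge0 R) (@sqint_complete R) basis L_basis basis_orth basis_total D H lam 4
  (@sqint_test R) (test0 R) (@test_lin R) (@sqint_lap R b) lap_coef (ltr0Sn R 3) lam_ge4 basis_approx u f.
by split=> [/friedrichsE /P|h]; last exact/friedrichsE/P.
Qed.

Lemma friedrichs_resolvent z d f : 0 < d -> L f ->
  (forall i, d <= sqmod ((lam i)%:C - z)) ->
  exists2 u, friedrichs b u (fun p => z * u p + f p) & nsq u <= nsq f / d.
Proof.
move=> d0 Lf dz.
have [u uf un] := @fried_resolvent R _ L (@inner R) (sqint0 R) (@sqint_lin R) (@inner_lin R) (@inner_conj R)
  (@inner_ge0 R) (@sqint_complete R) basis L_basis basis_orth basis_total D H lam 4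
  (@sqint_test R) (test0 R) (@test_lin R) (@sqint_lap R b) lap_coef (ltr0Sn R 3) lam_ge4 basis_approx
  z d f d0 Lf dz.
by exists u => //; exact/friedrichsE.
Qed.

Lemma eigen_coef z u i : Defs.eigenspace (friedrichs b) z u -> (lam i)%:C != z -> inner u (basis i) = 0.
Proof.
move=> /friedrichsP[Lu Lf /(_ i)] + nz.
rewrite (ipZ (sqint0 R) (@inner_lin R) z Lu (L_basis i)) => /eqP.
rewrite -subr_eq0 -mulrBl mulf_eq0 subr_eq0 eq_sym (negbTE nz)/=.
by move/eqP.
Qed.

Lemma eigenspace_L z u : Defs.eigenspace (friedrichs b) z u -> L u.
Proof. by case/friedrichsP. Qed.

Lemma eigen_span z u K : Defs.eigenspace (friedrichs b) z u ->
  (forall i, (K <= i)%N -> (lam i)%:C != z) ->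
  ae_equal u (fun p => \sum_(i < K) inner u (basis i) * basis i p).
Proof.
move=> uz Kz; have Lu := eigenspace_L uz.
have Lp := @L_psum R _ L (sqint0 R) (@sqint_lin R) basis L_basis (fun i => inner u (basis i)) K.
have := (sqint_ae Lu Lp).1; rewrite /psum fct_sumE; apply.
have := @fried_eigen_span R _ L (@inner R) (sqint0 R) (@sqint_lin R) (@inner_lin R) (@inner_conj R)
  (@inner_ge0 R) (@sqint_complete R) basis L_basis basis_orth basis_total D H lam 4
  (@sqint_test R) (test0 R) (@test_lin R) (@sqint_lap R b) lap_coef (ltr0Sn R 3) lam_ge4 basis_approx
  z u K ((friedrichsE _ _).1 uz) Kz.
by rewrite /psum fct_sumE.
Qed.

Lemma mode_eigenfunction i : eigenfunction (friedrichs b) (lam i)%:C (mode i).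
Proof.
split; last exact: psi_neq0.
apply/friedrichsP; split => [||j]; first exact: L_mode.
  exact: (@L_scale R _ L (sqint0 R) (@sqint_lin R) (lam i)%:C (mode i) (L_mode i)).
rewrite (ipZ (sqint0 R) (@inner_lin R) (lam i)%:C (L_mode i) (L_basis j)) mode_basis.
rewrite (ipZ (sqint0 R) (@inner_lin R) _ (L_basis i) (L_basis j)) basis_orth.
by case: eqVneq => [->//|_]; rewrite !mulr0.
Qed.

Lemma lam_large B : exists K, forall i, (K <= i)%N -> B < lam i.
Proof.
(* If the eigenvalue of (n, k) is at most [B], then n <= |B| and |k - b| <= |B|, hence |k| <= |B| +
   |b| < N, which leaves finitely many pairs. *)
pose N := (Num.truncn (`|B| + `|b|)).+1.
have NB : `|B| + `|b| < N%:R by have /andP[] := truncn_itv (addr_ge0 (normr_ge0 B) (normr_ge0 b)).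
pose ints := [seq Posz j | j <- iota 0 N] ++ [seq Negz j | j <- iota 0 N].
pose s := [seq (n, k) | n <- iota 0 N, k <- ints].
pose K := (\max_(q <- s) en_inv q).+1.
exists K => i Ki; rewrite ltNge; apply/negP => iB.
have B1 := ler_norm B; have b0 := normr_ge0 b.
have h := normr_ge0 ((en i).2%:~R - b).
have n1 : 1 <= (en i).1.+1%:R :> R by rewrite ler1n.
have [l1 l2] : (en i).1.+1%:R <= `|B| /\ `|(en i).2%:~R - b| <= `|B|.
  by move: iB; rewrite /lam /lambda; move: h n1; move: `|_ - b| _%:R => x y; split; nra.
have i1 : (en i).1 \in iota 0 N.
  by rewrite mem_iota add0n /= -(ltr_nat R); apply: le_lt_trans NB; rewrite -natr1 in l1; lra.
have i2 : (en i).2 \in ints.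
  have : `|(en i).2%:~R| < N%:R :> R.
    apply: le_lt_trans NB; rewrite -[X in `|X|](subrK b); apply: le_trans (ler_normD _ _) _.
    by rewrite lerD2r.
  rewrite mem_cat; case: (en i).2 => j jN; apply/orP; [left|right]; apply: map_f; rewrite mem_iota add0n/=.
    by rewrite -pmulrn ger0_norm// ltr_nat in jN.
  rewrite NegzE mulrNz normrN -pmulrn ger0_norm// ltr_nat in jN.
  exact: ltnW.
have : en i \in s by rewrite [en i]surjective_pairing; apply: allpairs_f.
move=> /(@leq_bigmax_seq _ s predT (fun q => en_inv q)) /(_ isT).
by rewrite enK leqNgt; case/negP; rewrite /K in Ki.
Qed.

(** [d] bounds squared distances. Finitely many eigenvalues are compared one by one; the others
    exceed the real part of [z] by more than 1. *)
Lemma lam_separated z : exists2 d, 0 < d & forall i, (lam i)%:C = z \/ d <= sqmod ((lam i)%:C - z).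
Proof.
have [K hK] := lam_large (complex.Re z + 1).
have [d d0 hd] : exists2 d, 0 < d & forall i, (i < K)%N ->
    (lam i)%:C = z \/ d <= sqmod ((lam i)%:C - z).
  elim: K {hK} => [|K [d d0 hd]]; first by exists 1.
  have [E|E] := eqVneq (lam K)%:C z.
    by exists d => // i; rewrite ltnS leq_eqVlt => /predU1P[->|/hd//]; left.
  have s0 : 0 < sqmod ((lam K)%:C - z).
    rewrite lt_neqAle sqmod_ge0 andbT eq_sym; apply: contra_neq E => /sqmod_eq0 /eqP.
    by rewrite subr_eq0 => /eqP.
  exists (Num.min d (sqmod ((lam K)%:C - z))); first by rewrite lt_min d0.
  move=> i; rewrite ltnS leq_eqVlt => /predU1P[->|/hd[h|h]]; first by right; rewrite ge_min lexx orbT.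
    by left.
  by right; rewrite ge_min h.
exists (Num.min d 1); first by rewrite lt_min d0 ltr01.
move=> i; have [iK|Ki] := ltnP i K.
  by have [->|h] := hd i iK; [left|right; rewrite ge_min h].
right; rewrite ge_min; apply/orP; right.
have := hK i Ki; case: z {hd hK} => x y /= h; rewrite /sqmod /=.
have : 0 <= (0 - y) ^+ 2 by exact: sqr_ge0.
nra.
Qed.

Lemma mode_spectrum z : spectrum (friedrichs b) z <-> exists i, (lam i)%:C = z.
Proof.
split=> [h|[i iz] [h _]]; last first.
  by have [e1 e2] := mode_eigenfunction i; apply: e2; apply: h; rewrite -iz.
apply: contra_notP h => nz.
have [d d0 hd] := lam_separated z.
have hd' i : d <= sqmod ((lam i)%:C - z).
  by case: (hd i) => // E; case: nz; exists i.
have ne i : (lam i)%:C != z by apply/eqP => E; case: nz; exists i.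
split=> [u uz|].
  have Lu := eigenspace_L uz; apply/(nsq_eq0 Lu); apply: basis_total => // i.
  exact: eigen_coef uz (ne i).
(* As [d] is a squared distance, the resolvent is bounded by d^(-1/2). *)
exists (Num.sqrt d^-1) => f Lf; have [u uf un] := friedrichs_resolvent d0 Lf hd'.
exists u => //; rewrite !norm2E -sqrtrM ?invr_ge0 ?(ltW d0)//.
by apply: ler_wsqrtr; rewrite mulrC.
Qed.

End Spectrum.

Theorem theorem2p10 (R : realType) (b : R) :
  [/\ spectrum (friedrichs b) = discrete_spectrum (friedrichs b),
      discrete_spectrum (friedrichs b) =
        [set z : R[i] | exists (n : nat) (k : int),
           (1 <= n)%N /\ z = (lambda b n k)%:C],
      forall (n : nat) (k : int), (1 <= n)%N ->
        eigenfunction (friedrichs b) (lambda b n k)%:C (psi b n k) &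
      forall (z : R[i]) (u : cfun R), eigenfunction (friedrichs b) z u ->
        lin_span [set g | exists (n : nat) (k : int),
          [/\ (1 <= n)%N, (lambda b n k)%:C = z & g = psi b n k]] u].
Proof.
have [en [en_inv enK en_invK]] := nat_int_bij.
have specP := @mode_spectrum R b en en_inv enK en_invK.
have largeP := lam_large b enK.
have spanP := @eigen_span R b en en_inv enK en_invK.
have lamE n k : (1 <= n)%N -> lam b en (en_inv (n.-1, k)) = lambda b n k.
  by move=> n1; rewrite /lam en_invK /= prednK.
have tail z : exists K, forall i, (K <= i)%N -> (lam b en i)%:C != z.
  have [K hK] := largeP (complex.Re z); exists K => i /hK h.
  by apply/eqP => E; move: h; rewrite -E /= ltxx.
have SD : spectrum (friedrichs b) = discrete_spectrum (friedrichs b).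
  apply/seteqP; split=> z; last by case; case.
  move=> sz; have /specP[i0 iz] := sz; split.
  - split => //; have [d d0 hd] := lam_separated b enK z.
    exists (Num.sqrt d); first by rewrite sqrtr_gt0.
    move=> w /specP[i <-]; case: (hd i) => // h; rewrite ltr_sqrt// ltNge h //.
  - by exists (mode b en i0); rewrite -iz; exact: (@mode_eigenfunction R b en en_inv).
  - have [K hK] := tail z; exists K, (fun i : 'I_K => basis b en i) => u uz.
    exists K, (fun i : 'I_K => inner u (basis b en i)), (fun i : 'I_K => basis b en i).
    split; first by move=> i; exists i.
    exact: spanP uz hK.
split => //.
- rewrite -SD; apply/seteqP; split=> z.
    by move=> /specP[i <-]; exists (en i).1.+1, (en i).2.
  by move=> [n [k [n1 ->]]]; apply/specP; exists (en_inv (n.-1, k)); rewrite lamE.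
- move=> n k n1; have := @mode_eigenfunction R b en en_inv enK en_invK (en_inv (n.-1, k)).
  by rewrite lamE// /mode en_invK /= prednK.
- move=> z u [uz u0]; have [K hK] := tail z.
  have [i0 iz] : exists i, (lam b en i)%:C = z.
    by apply/specP => -[h _]; exact/u0/h.
  have B i : (lam b en i)%:C = z -> [set g | exists (n : nat) (k : int),
      [/\ (1 <= n)%N, (lambda b n k)%:C = z & g = psi b n k]] (mode b en i).
    by move=> E; exists (en i).1.+1, (en i).2.
  (* Modes of other eigenvalues enter with coefficient 0; they are replaced by [mode i0], so that
     every function of the family belongs to the eigenvalue [z]. *)
  pose P i := (lam b en i)%:C == z.
  exists K, (fun i : 'I_K => if P i then inner u (basis b en i) * (scale b en i)%:C else 0),
    (fun i : 'I_K => mode b en (if P i then i : nat else i0)); split.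
    by move=> i; apply: B; case: ifPn => // /eqP.
  have := spanP z u K uz hK; congr (ae_equal _ _); apply/funext => p; apply: eq_bigr => i _.
  case: ifPn => [_|nz]; first by rewrite -mulrA.
  by rewrite (@eigen_coef R b en en_inv enK en_invK z u i uz nz) !mul0r.
Qed.
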